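(* Let $\{\tau_i\}_{i\in\mathbb N}$ and $\{\xi_i\}_{i\in\mathbb N}$ be such that $\tau_i\in\mathcal T_i$ and $\xi_i\in\mathcal X_{\tau_i,p}$ for each $i\in\mathbb N$. Then $$\lim_{i\to\infty}\bigl|\theta_{\tau_i}(\xi_i)-\theta(\xi_i)\bigr|=0 .$$ That is, the Discretized Relaxed Switched System Optimal Control Problem is a consistent approximation of the Switched System Optimal Control Problem.
   Context: Setting. $\mathbb N=\{0,1,2,\dots\}$. Fix positive integers $n,m,q,N_c$, put $\mathcal Q=\{1,\dots,q\}$, $\mathcal J=\{1,\dots,N_c\}$, fix $x_0\in\mathbb R^n$ and a bounded convex set $U\subset\mathbb R^m$. Let $e_1,\dots,e_q$ be the standard basis of $\mathbb R^q$, $\Sigma_r^q=\{d\in[0,1]^q:\sum_{i=1}^q d_i=1\}$ and $\Sigma_p^q=\{e_1,\dots,e_q\}$. For a function $w$ on $[0,1]$ with Euclidean values, $\|w\|_{L^2}=(\int_0^1\|w(t)\|_2^2dt)^{1/2}$. Let $\mathcal U$, $\mathcal D_r$, $\mathcal D_p$ be the sets of functions in $L^2$ and of bounded variation on $[0,1]$ with values in $U$, $\Sigma_r^q$, $\Sigma_p^q$ respectively; $\mathcal X_r=\mathcal U\times\mathcal D_r$, $\mathcal X_p=\mathcal U\times\mathcal D_p\subset\mathcal X_r$, and $\|(u,d)\|_{\mathcal X}=\|u\|_{L^2}+\|d\|_{L^2}$. Dynamics. For each $i\in\mathcal Q$, $f(\cdot,\cdot,\cdot,e_i):\mathbb R\times\mathbb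 R^n\times\mathbb R^m\to\mathbb R^n$ is differentiable in $x$ and $u$, and there is $L>0$ such that for $F\in\{f(\cdot,e_i),\frac{\partial f}{\partial x}(\cdot,e_i),\frac{\partial f}{\partial u}(\cdot,e_i)\}$, $\|F(t_1,x_1,u_1)-F(t_2,x_2,u_2)\|\le L(|t_1-t_2|+\|x_1-x_2\|_2+\|u_1-u_2\|_2)$ for all $t_1,t_2\in[0,1]$, $x_1,x_2\in\mathbb R^n$, $u_1,u_2\in U$ (2-norm, resp. induced matrix 2-norm). For $d\in\mathbb R^q$ set $f(t,x,u,d)=\sum_{i=1}^q d_if(t,x,u,e_i)$. For $\xi=(u,d)\in\mathcal X_r$, $x^{(\xi)}$ is the unique solution of $\dot x(t)=f(t,x(t),u(t),d(t))$, $x(0)=x_0$ on $[0,1]$, and $\phi_t(\xi)=x^{(\xi)}(t)$. Cost and constraints. $h_0,h_j:\mathbb R^n\to\mathbb R$ ($j\in\mathcal J$) are differentiable, and they and their derivatives are Lipschitz with constant $L$. For $\xi\in\mathcal X_r$: $J(\xi)=h_0(\phi_1(\xi))$, $\psi_{j,t}(\xi)=h_j(\phi_t(\xi))$, $\Psi(\xi)=\max_{j\in\mathcal J,t\in[0,1]}\psi_{j,t}(\xi)$. The Switched System Optimal Control Problem is $\min_{\xi\in\mathcal X_p}\{J(\xi):\Psi(\xi)\le0\}$. Optimality function. $\mathrm DG(\xi;\eta)=\lim_{\lambda\downarrow0}\frac{G(\xi+\lambda\eta)-G(\xi)}\lambda$. Fix $\gamma>0$. For $\xi,\xi'\in\mathcal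 X_r$ let $\zeta(\xi,\xi')=\max\{\mathrm DJ(\xi;\xi'-\xi),\ \max_{j\in\mathcal J,t\in[0,1]}\mathrm D\psi_{j,t}(\xi;\xi'-\xi)+\gamma\Psi(\xi)\}+\|\xi'-\xi\|_{\mathcal X}$ if $\Psi(\xi)\le0$, and $\zeta(\xi,\xi')=\max\{\mathrm DJ(\xi;\xi'-\xi)-\Psi(\xi),\ \max_{j\in\mathcal J,t\in[0,1]}\mathrm D\psi_{j,t}(\xi;\xi'-\xi)\}+\|\xi'-\xi\|_{\mathcal X}$ if $\Psi(\xi)>0$. For $\xi\in\mathcal X_p$, $\theta(\xi)=\min_{\xi'\in\mathcal X_r}\zeta(\xi,\xi')$. Discretization. For $N\in\mathbb N$, $\mathcal T_N$ is the set of finite sequences $\tau=(\tau_0,\dots,\tau_{|\tau|})$ with $0=\tau_0\le\tau_1\le\dots\le\tau_{|\tau|}=1$ and $|\tau_i-\tau_{i-1}|\le2^{-N}$ for all $i$ (so $|\tau|$ is the number of subintervals). $\mathcal X_{\tau,r}$ (resp. $\mathcal X_{\tau,p}$) is the set of $(u,d)\in\mathcal X_r$ (resp. $\mathcal X_p$) such that $u$ and $d$ are constant on each $[\tau_k,\tau_{k+1})$, $k\in\{0,\dots,|\tau|-1\}$; the values at $t=1$ are the left limits. For $\xi=(u,d)\in\mathcal X_{\tau,r}$, $z_\tau^{(\xi)}(\tau_0)=x_0$, $z_\tau^{(\xi)}(\tau_{k+1})=z_\tau^{(\xi)}(\tau_k)+(\tau_{k+1}-\tau_k)f(\tau_k,z_\tau^{(\xi)}(\tau_k),u(\tau_k),d(\tau_k))$,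 and $z_\tau^{(\xi)}$ is extended to $[0,1]$ by linear interpolation. Put $\phi_{\tau,t}(\xi)=z_\tau^{(\xi)}(t)$, $J_\tau(\xi)=h_0(\phi_{\tau,1}(\xi))$, $\psi_{\tau,j,t}(\xi)=h_j(\phi_{\tau,t}(\xi))$, $\Psi_\tau(\xi)=\max_{j\in\mathcal J,k\in\{0,\dots,|\tau|\}}\psi_{\tau,j,\tau_k}(\xi)$. The Discretized Relaxed Switched System Optimal Control Problem is $\min_{\xi\in\mathcal X_{\tau,r}}\{J_\tau(\xi):\Psi_\tau(\xi)\le0\}$. For $\xi,\xi'\in\mathcal X_{\tau,r}$ let $\zeta_\tau(\xi,\xi')=\max\{\mathrm DJ_\tau(\xi;\xi'-\xi),\ \max_{j,k}\mathrm D\psi_{\tau,j,\tau_k}(\xi;\xi'-\xi)+\gamma\Psi_\tau(\xi)\}+\|\xi'-\xi\|_{\mathcal X}$ if $\Psi_\tau(\xi)\le0$, and $\zeta_\tau(\xi,\xi')=\max\{\mathrm DJ_\tau(\xi;\xi'-\xi)-\Psi_\tau(\xi),\ \max_{j,k}\mathrm D\psi_{\tau,j,\tau_k}(\xi;\xi'-\xi)\}+\|\xi'-\xi\|_{\mathcal X}$ if $\Psi_\tau(\xi)>0$ (maxima over $j\in\mathcal J$, $k\in\{0,\dots,|\tau|\}$). For $\xi\in\mathcal X_{\tau,p}$, $\theta_\tau(\xi)=\min_{\xi'\in\mathcal X_{\tau,r}}\zeta_\tau(\xi,\xi')$. ''Consistent approximation'' means precisely that the displayed limit holds for all such sequences $\{\tau_i\}$,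 $\{\xi_i\}$. *)

(* Defs.v *)
From HB Require Import structures.
From mathcomp Require Export all_boot all_order all_algebra.
From mathcomp Require Export all_classical all_reals all_analysis.

Set Implicit Arguments.
Unset Strict Implicit.
Unset Printing Implicit Defensive.

Export Order.TTheory GRing.Theory Num.Theory.
Export numFieldNormedType.Exports.

Local Open Scope classical_set_scope.
Local Open Scope ring_scope.

(* The library's norm on 'rV[R]_k is the sup norm. It is used here only through
   the notions it shares with the Euclidean norm (boundedness, limits,
   differentiability); every quantitative estimate uses [norm2]. *)
Definition norm2 (R : realType) (k : nat) (v : 'rV[R]_k) : R :=
  Num.sqrt (\sum_i v 0 i ^+ 2).

(* Induced 2-norm. Vectors are rows, so that A acts by v |-> v *m A; this is the
   convention of the library's Jacobian 'J. *)
Definition opnorm2 (R : realType) (k l : nat) (A : 'M[R]_(k, l)) : R :=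
  sup [set norm2 (v *m A) | v in [set v : 'rV[R]_k | norm2 v <= 1]].

Definition grad (R : realType) (k : nat) (h : 'rV[R]_k -> R) (x : 'rV[R]_k) :
    'rV[R]_k :=
  \row_i 'd h x (delta_mx 0 i).

Definition dir_deriv (R : realType) (V : lmodType R) (G : V -> R)
    (xi eta : V) : R :=
  lim ((G (xi + l *: eta) - G xi) / l @[l --> 0^'+]).

Definition simplex_r (R : realType) (q : nat) : set 'rV[R]_q :=
  [set d | (forall i, 0 <= d 0 i <= 1) /\ \sum_i d 0 i = 1].

Definition simplex_p (R : realType) (q : nat) : set 'rV[R]_q :=
  [set d | exists i, d = delta_mx 0 i].

(* Functions on [0, 1] are represented by functions on R whose values outside
   [0, 1] are irrelevant. *)
Definition norm_L2 (R : realType) (k : nat) (w : R -> 'rV[R]_k) : R :=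
  Num.sqrt (\int[lebesgue_measure]_(t in `[0, 1]) (norm2 (w t) ^+ 2)).

Definition in_L2 (R : realType) (k : nat) (w : R -> 'rV[R]_k) : Prop :=
  (forall i, measurable_fun (`[0, 1] : set R) (fun t => w t 0 i)) /\
  (@lebesgue_measure R).-integrable `[0, 1]
    (fun t => (norm2 (w t) ^+ 2)%:E).

Definition in_BV (R : realType) (k : nat) (w : R -> 'rV[R]_k) : Prop :=
  forall i, bounded_variation 0 1 (fun t => w t 0 i).

Definition L2BV (R : realType) (k : nat) (S : set 'rV[R]_k) :
    set (R -> 'rV[R]_k) :=
  [set w | [/\ in_L2 w, in_BV w & forall t, 0 <= t <= 1 -> S (w t)]].

Notation control R m q := ((R -> 'rV[R]_m) * (R -> 'rV[R]_q))%type.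

Definition norm_X (R : realType) (m q : nat) (xi : control R m q) : R :=
  norm_L2 xi.1 + norm_L2 xi.2.

Definition X_r (R : realType) (m q : nat) (U : set 'rV[R]_m) :
    set (control R m q) :=
  [set xi | L2BV U xi.1 /\ L2BV (@simplex_r R q) xi.2].

Definition X_p (R : realType) (m q : nat) (U : set 'rV[R]_m) :
    set (control R m q) :=
  [set xi | L2BV U xi.1 /\ L2BV (@simplex_p R q) xi.2].

(* Lipschitz continuity in (t, x, u) on [0, 1] * R^n * U, with respect to the
   norm N on the target. *)
Definition lipschitz_txu (R : realType) (n m : nat) (U : set 'rV[R]_m) (L : R)
    (V : zmodType) (N : V -> R) (F : R -> 'rV[R]_n -> 'rV[R]_m -> V) : Prop :=
  forall t1 t2 x1 x2 u1 u2, 0 <= t1 <= 1 -> 0 <= t2 <= 1 -> U u1 -> U u2 ->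
    N (F t1 x1 u1 - F t2 x2 u2) <=
      L * (`|t1 - t2| + norm2 (x1 - x2) + norm2 (u1 - u2)).

Definition lipschitz_x (R : realType) (n : nat) (L : R)
    (V : zmodType) (N : V -> R) (F : 'rV[R]_n -> V) : Prop :=
  forall x1 x2, N (F x1 - F x2) <= L * norm2 (x1 - x2).

(* [f i] stands for the vector field f(., ., ., e_i). *)
Definition dynamics_hyp (R : realType) (n m q : nat) (U : set 'rV[R]_m) (L : R)
    (f : 'I_q -> R -> 'rV[R]_n -> 'rV[R]_m -> 'rV[R]_n) : Prop :=
  forall i,
    [/\ forall t x u, differentiable (fun y => f i t y u) x,
        forall t x u, differentiable (fun v => f i t x v) u,
        lipschitz_txu U L (@norm2 R n) (f i),
        lipschitz_txu U L (@opnorm2 R n n)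
          (fun t x u => 'J (fun y => f i t y u) x) &
        lipschitz_txu U L (@opnorm2 R m n)
          (fun t x u => 'J (fun v => f i t x v) u)].

Definition cost_hyp (R : realType) (n : nat) (L : R)
    (h : 'rV[R]_n -> R) : Prop :=
  [/\ forall x, differentiable h x,
      lipschitz_x L Num.norm h &
      lipschitz_x L (@norm2 R n) (grad h)].

Section Problem.
Variables (R : realType) (n m q Nc : nat).
Variables (f : 'I_q -> R -> 'rV[R]_n -> 'rV[R]_m -> 'rV[R]_n).
Variables (x0 : 'rV[R]_n) (U : set 'rV[R]_m).
Variables (h0 : 'rV[R]_n -> R) (h : 'I_Nc -> 'rV[R]_n -> R) (gamma : R).

Definition vfield (t : R) (x : 'rV[R]_n) (u : 'rV[R]_m) (d : 'rV[R]_q) :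
    'rV[R]_n :=
  \sum_i d 0 i *: f i t x u.

(* Absolute continuity on [0, 1], in the form: each coordinate is an indefinite
   Lebesgue integral. *)
Definition absolutely_continuous01 (x : R -> 'rV[R]_n) : Prop :=
  forall i, exists2 g : R -> R,
    (@lebesgue_measure R).-integrable `[0, 1] (EFin \o g) &
    forall t, 0 <= t <= 1 ->
      x t 0 i = x 0 0 i + \int[lebesgue_measure]_(s in `[0, t]) g s.

(* Caratheodory solutions: the controls may be discontinuous, so the
   differential equation can only be required almost everywhere. *)
Definition is_trajectory (xi : control R m q) (x : R -> 'rV[R]_n) : Prop :=
  [/\ x 0 = x0,
      absolutely_continuous01 x &
      {ae @lebesgue_measure R, forall t : R, 0 < t < 1 ->
        is_derive t 1 x (vfield t (x t) (xi.1 t) (xi.2 t))}].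

(* For xi in X_r the trajectory is unique on [0, 1]. *)
Definition trajectory (xi : control R m q) : R -> 'rV[R]_n :=
  get [set x | is_trajectory xi x].

Definition phi (t : R) (xi : control R m q) : 'rV[R]_n := trajectory xi t.

Definition J (xi : control R m q) : R := h0 (phi 1 xi).

Definition psi (j : 'I_Nc) (t : R) (xi : control R m q) : R := h j (phi t xi).

(* The suprema over j and t are maxima, by continuity in t. The minima over
   controls need not be attained and are read as infima. *)
Definition Psi (xi : control R m q) : R :=
  sup [set y | exists j t, 0 <= t <= 1 /\ y = psi j t xi].

Definition zeta (xi xi' : control R m q) : R :=
  let DJ := dir_deriv J xi (xi' - xi) in
  let Dpsi := sup [set y | exists j t,
                0 <= t <= 1 /\ y = dir_deriv (psi j t) xi (xi' - xi)] in
  (if Psi xi <= 0 then Num.max DJ (Dpsi + gamma * Psi xi)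
   else Num.max (DJ - Psi xi) Dpsi) + norm_X (xi' - xi).

Definition theta (xi : control R m q) : R :=
  inf [set zeta xi xi' | xi' in X_r U].

(* A partition tau_0, ..., tau_|tau| is a sequence, with |tau| = (size tau).-1. *)
Definition grid (N : nat) : set (seq R) :=
  [set tau | [/\ tau`_0 = 0, tau`_(size tau).-1 = 1,
      forall k, (k < (size tau).-1)%N -> tau`_k <= tau`_k.+1 &
      forall k, (k < (size tau).-1)%N -> `|tau`_k.+1 - tau`_k| <= 2 ^- N]].

Definition piecewise_constant (tau : seq R) (k : nat) (w : R -> 'rV[R]_k) :
    Prop :=
  (forall i, (i < (size tau).-1)%N -> forall s t,
     tau`_i <= s < tau`_i.+1 -> tau`_i <= t < tau`_i.+1 -> w s = w t) /\
  w t @[t --> 1^'-] --> w 1.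

Definition X_tau_r (tau : seq R) : set (control R m q) :=
  [set xi | [/\ X_r U xi, piecewise_constant tau xi.1 &
                piecewise_constant tau xi.2]].

Definition X_tau_p (tau : seq R) : set (control R m q) :=
  [set xi | [/\ X_p U xi, piecewise_constant tau xi.1 &
                piecewise_constant tau xi.2]].

Fixpoint euler (tau : seq R) (xi : control R m q) (k : nat) : 'rV[R]_n :=
  if k is k'.+1 then
    let z := euler tau xi k' in
    z + (tau`_k'.+1 - tau`_k') *: vfield tau`_k' z (xi.1 tau`_k') (xi.2 tau`_k')
  else x0.

(* For 0 <= t < 1, k is the unique index such that tau_k <= t < tau_(k+1). *)
Definition phi_tau (tau : seq R) (t : R) (xi : control R m q) : 'rV[R]_n :=
  let z := euler tau xi in
  if t < 1 then
    let k := (find (fun s => t < s) tau).-1 in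
    z k + ((t - tau`_k) / (tau`_k.+1 - tau`_k)) *: (z k.+1 - z k)
  else z (size tau).-1.

Definition J_tau (tau : seq R) (xi : control R m q) : R :=
  h0 (phi_tau tau 1 xi).

Definition psi_tau (tau : seq R) (j : 'I_Nc) (t : R) (xi : control R m q) : R :=
  h j (phi_tau tau t xi).

Definition Psi_tau (tau : seq R) (xi : control R m q) : R :=
  sup [set y | exists j k, (k <= (size tau).-1)%N /\
                           y = psi_tau tau j tau`_k xi].

Definition zeta_tau (tau : seq R) (xi xi' : control R m q) : R :=
  let DJ := dir_deriv (J_tau tau) xi (xi' - xi) in
  let Dpsi := sup [set y | exists j k, (k <= (size tau).-1)%N /\
                y = dir_deriv (psi_tau tau j tau`_k) xi (xi' - xi)] in
  (if Psi_tau tau xi <= 0 then Num.max DJ (Dpsi + gamma * Psi_tau tau xi)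
   else Num.max (DJ - Psi_tau tau xi) Dpsi) + norm_X (xi' - xi).

Definition theta_tau (tau : seq R) (xi : control R m q) : R :=
  inf [set zeta_tau tau xi xi' | xi' in X_tau_r tau].

End Problem.

(* Main.v *)
Require Import Defs.
From mathcomp Require Import ring lra measurable_realfun.

(** The two optimality functions are infima of expressions of the same shape, built from
values of the costs, from their directional derivatives and from the distance to the
competing control. So it is enough to compare these ingredients, uniformly in the grid
and in the controls; the proof gives the rate C 2^-N for grids of mesh 2^-N
([theta_close]).

Merge the input u and the mode weights d into one control c. The derivative of the
trajectory x in a direction p is the solution y of the variational equation
y' = yA + pB ([flow_expansion]), where A and B are the partial derivatives of the field
along x; the derivative y_k of the Euler iterates z_k solves the linearized recursion
([eul_expansion]). The field and its derivatives are Lipschitz and the control is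
constant on every cell of the grid, so that Gronwall estimates bound x(tau_k) - z_k
([euler_error]) and then y(tau_k) - y_k ([euler_sensitivity_error]) by a multiple of the
mesh. Since z and y enter the optimality functions in a Lipschitz way, also when the sign
of the constraint changes ([zeta_cases_close]), the two descent functions are close.

Any control on the grid also competes in the continuous problem, which gives one inequality.
The other one is less obvious: the infimum over all relaxed controls involves functions
whose variation is not bounded, and these are not uniformly close in L2 to functions
that are constant on the cells. But the variational equation is driven by p, up to the
mesh, only through the averages of p over the cells, because B is Lipschitz on each of
them; and replacing a control by its cell averages does not increase its L2 distance to a
control that is itself constant on the cells. So the averaged control is as good
a competitor ([step_approximation]). If U is not closed, the averages may leave U; they
are replaced by points of U that nearly minimize the distance to them ([near_mean]).

Trajectories are Caratheodory solutions: they are constructed by Picard iteration, and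
identified with the solutions of the integral equation by Lebesgue differentiation
([get_caratheodory]). *)

Set Implicit Arguments.
Unset Strict Implicit.
Unset Printing Implicit Defensive.

Local Open Scope classical_set_scope.
Local Open Scope ring_scope.

(** * Norms *)

Section Norms.
Variable R : realType.

Lemma rV_normP k (v : 'rV[R]_k) (c : R) :
  0 <= c -> (forall i, `|v 0 i| <= c) -> `|v| <= c.
Proof.
move=> c0 vc; rewrite /Num.norm/= mx_normrE.
by apply: bigmax_le => // -[i j] _ /=; rewrite ord1.
Qed.

Lemma rV_norm_coord k (v : 'rV[R]_k) i : `|v 0 i| <= `|v|.
Proof.
rewrite [leRHS]/Num.norm/= mx_normrE.
exact: (le_bigmax _ (fun ij : 'I_1 * 'I_k => `|v ij.1 ij.2|) (0, i)).
Qed.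

Lemma sum_ord_le k (F : 'I_k -> R) c :
  (forall i, F i <= c) -> \sum_i F i <= k%:R * c.
Proof.
move=> Fc; rewrite (le_trans (ler_sum _ (fun i _ => Fc i)))//.
by rewrite sumr_const card_ord mulr_natl.
Qed.

Lemma norm2_ge0 k (v : 'rV[R]_k) : 0 <= norm2 v.
Proof. exact: sqrtr_ge0. Qed.

Lemma sqr_norm2 k (v : 'rV[R]_k) : norm2 v ^+ 2 = \sum_i v 0 i ^+ 2.
Proof. by rewrite sqr_sqrtr// sumr_ge0// => i _; exact: sqr_ge0. Qed.

Lemma norm_le_norm2 k (v : 'rV[R]_k) : `|v| <= norm2 v.
Proof.
apply: rV_normP => [|i]; first exact: norm2_ge0.
rewrite -sqrtr_sqr; apply: ler_wsqrtr.
by rewrite (bigD1 i)//= lerDl sumr_ge0// => j _; exact: sqr_ge0.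
Qed.

Lemma norm2_le_norm k (v : 'rV[R]_k) : norm2 v <= k%:R * `|v|.
Proof.
rewrite -(@ler_pXn2r _ 2) ?nnegrE ?norm2_ge0 ?mulr_ge0//.
rewrite sqr_norm2 (@le_trans _ _ (k%:R * `|v| ^+ 2))//.
  apply: sum_ord_le => i.
  by rewrite -real_normK ?num_real// lerXn2r ?nnegrE// rV_norm_coord.
rewrite exprMn ler_wpM2r ?sqr_ge0//.
by rewrite -natrX ler_nat; case: k {v} => // k; rewrite expnS expn1 leq_pmulr.
Qed.

Lemma norm2Z k (a : R) (v : 'rV[R]_k) : norm2 (a *: v) = `|a| * norm2 v.
Proof.
rewrite /norm2 -sqrtr_sqr -sqrtrM ?sqr_ge0//; congr Num.sqrt.
by rewrite mulr_sumr; apply: eq_bigr => i _; rewrite mxE exprMn.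
Qed.

Lemma norm2_0 k : norm2 (0 : 'rV[R]_k) = 0.
Proof. by rewrite -(scale0r 0) norm2Z normr0 mul0r. Qed.

Lemma norm_mulmx_le k l (v : 'rV[R]_k) (A : 'M[R]_(k, l)) :
  `|v *m A| <= (k%:R * `|A|) * `|v|.
Proof.
apply: rV_normP => [|j]; first by rewrite !mulr_ge0.
rewrite mxE (le_trans (ler_norm_sum _ _ _))//.
rewrite -mulrA; apply: sum_ord_le => i; rewrite normrM mulrC ler_pM ?rV_norm_coord//.
rewrite [leRHS]/Num.norm/= mx_normrE.
exact: (le_bigmax _ (fun ij : 'I_k * 'I_l => `|A ij.1 ij.2|) (i, j)).
Qed.

Definition dot k (u v : 'rV[R]_k) : R := \sum_i u 0 i * v 0 i.

Lemma norm_dot_le k (u v : 'rV[R]_k) : `|dot u v| <= k%:R * `|v| * `|u|.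
Proof.
rewrite (le_trans (ler_norm_sum _ _ _))// -mulrA; apply: sum_ord_le => i.
by rewrite normrM mulrC; apply: ler_pM => //; exact: rV_norm_coord.
Qed.

(** The supremum defining the induced norm is finite, so that it bounds the
action of the matrix. *)
Lemma opnorm2_bound k l (v : 'rV[R]_k) (A : 'M[R]_(k, l)) :
  norm2 (v *m A) <= opnorm2 A * norm2 v.
Proof.
have ub : has_ubound [set norm2 (w *m A) | w in [set w : 'rV[R]_k | norm2 w <= 1]].
  exists (l%:R * (k%:R * `|A|)) => _ [w/= w1 <-].
  rewrite (le_trans (norm2_le_norm _))// ler_wpM2l//.
  rewrite (le_trans (norm_mulmx_le _ _))// ler_piMr ?mulr_ge0//.
  exact: le_trans (norm_le_norm2 _) w1.
have [v0|vn0] := eqVneq (norm2 v) 0.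
  have -> : v = 0.
    by apply/eqP; rewrite -normr_le0 -[leRHS]v0 norm_le_norm2.
  by rewrite mul0mx !norm2_0 mulr0.
have vp : 0 < norm2 v by rewrite lt_neqAle eq_sym vn0 norm2_ge0.
rewrite -ler_pdivrMr// mulrC -[X in X * _]ger0_norm ?invr_ge0 ?norm2_ge0//.
rewrite -norm2Z scalemxAl; apply: ub_le_sup => //.
exists ((norm2 v)^-1 *: v) => //=.
by rewrite norm2Z ger0_norm ?invr_ge0 ?norm2_ge0// mulVf.
Qed.

Lemma norm_const_rV1 (a : R) : `|(const_mx a : 'rV[R]_1)| = `|a|.
Proof.
apply/eqP; rewrite eq_le; apply/andP; split.
  by apply: rV_normP => // i; rewrite mxE.
by have := rV_norm_coord (const_mx a : 'rV[R]_1) 0; rewrite mxE.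
Qed.

Lemma norm_row_mxl a b (u : 'rV[R]_a) (v : 'rV[R]_b) : `|u| <= `|row_mx u v|.
Proof.
apply: rV_normP => // i; rewrite -(row_mxEl u v); exact: rV_norm_coord.
Qed.

Lemma norm_row_mxr a b (u : 'rV[R]_a) (v : 'rV[R]_b) : `|v| <= `|row_mx u v|.
Proof.
apply: rV_normP => // i; rewrite -(row_mxEr u v); exact: rV_norm_coord.
Qed.

Lemma norm_row_mx_le a b (u : 'rV[R]_a) (v : 'rV[R]_b) c : 0 <= c ->
  `|u| <= c -> `|v| <= c -> `|row_mx u v| <= c.
Proof.
move=> c0 uc vc; apply: rV_normP => // i; case: (split_ordP i) => j ->.
  by rewrite row_mxEl (le_trans (rV_norm_coord _ _)).
by rewrite row_mxEr (le_trans (rV_norm_coord _ _)).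
Qed.

End Norms.

(** * Measurability along measurable curves *)

Section Measurability.
Variable R : realType.

(** A function that is Lipschitz with respect to a measurable vector map p
depends only on p. Rounding p to the lattice of mesh 1/(N+1), and evaluating the
function at a point chosen in each nonempty cell, gives functions with
countably many values on measurable sets; they converge uniformly. The range
of p may be any set: controls take values in a convex set that need not be Borel. *)
Lemma measurable_fun_lipschitz_comp k (D : set R) (p : R -> 'rV[R]_k)
    (g : R -> R) (L : R) :
  measurable D -> (forall i, measurable_fun D (fun t => p t 0 i)) ->
  (forall s t, D s -> D t -> `|g s - g t| <= L * `|p s - p t|) ->
  measurable_fun D g.
Proof.
move=> mD mp gL.
pose cell N t : 'rV[int]_k := \row_i Num.floor (N.+1%:R * p t 0 i).
pose rep N c : R := xget 0 [set s | D s /\ cell N s = c].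
pose gN N t := g (rep N (cell N t)).
have mcell N c : measurable (D `&` [set t | cell N t = c]).
  rewrite (_ : _ `&` _ = D `&` \bigcap_(i in [set: 'I_k])
      (D `&` (fun t => p t 0 i) @^-1`
         `[(c 0 i)%:~R / N.+1%:R, ((c 0 i + 1)%:~R / N.+1%:R)[)); last first.
    apply/seteqP; split=> t /=.
      move=> [Dt <-]; split=> // i _; split=> //=.
      rewrite in_itv/= mxE ler_pdivrMr// ltr_pdivlMr// mulrC.
      by rewrite floor_le// floorD1_gt.
    move=> [Dt H]; split=> //; apply/rowP => i; rewrite mxE.
    have [_] := H i I; rewrite /= in_itv/= ler_pdivrMr// ltr_pdivlMr// mulrC.
    by move=> ?; apply/floor_def.
  apply: measurableI => //; apply: fin_bigcap_measurable => // i _.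
  by apply: mp => //; exact: measurable_itv.
have mgN N : measurable_fun D (gN N).
  move=> _ Y mY.
  rewrite (_ : _ `&` _ = \bigcup_(c in [set: 'rV[int]_k])
     (if g (rep N c) \in Y then D `&` [set t | cell N t = c] else set0)); last first.
    apply/seteqP; split=> t /=.
      by move=> [Dt Yt]; exists (cell N t) => //=; rewrite mem_set.
    move=> [c _]; case: ifPn => // /set_mem Yc [Dt tc]; split=> //.
    by rewrite /gN tc.
  apply: countable_bigcupT_measurable => // c; case: ifPn => // _.
apply: (measurable_fun_cvg mgN) => t Dt.
apply/cvgrPdist_le => e e0.
have L1 : 0 < `|L| + 1 by rewrite ltr_wpDl.
have eL : 0 < e / (`|L| + 1) by rewrite divr_gt0.
near=> N.
have [Dr rE] : D (rep N (cell N t)) /\ cell N (rep N (cell N t)) = cell N t.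
  by have := @xgetI _ 0 [set s | D s /\ cell N s = cell N t] t (conj Dt erefl).
rewrite /gN (le_trans (gL _ _ Dt Dr))//.
have pd : `|p t - p (rep N (cell N t))| <= N.+1%:R^-1.
  apply: rV_normP => // i; rewrite !mxE.
  move/rowP/(_ i) : rE; rewrite !mxE => rE.
  have := floor_itv (N.+1%:R * p t 0 i).
  have := floor_itv (N.+1%:R * p (rep N (cell N t)) 0 i).
  rewrite rE intrD => /andP[h1 h2] /andP[h3 h4].
  have N0 : 0 < N.+1%:R :> R by [].
  rewrite -(ler_pM2l N0) divff ?gt_eqF// -[X in X * _]gtr0_norm// -normrM.
  rewrite mulrBr ler_norml; apply/andP; split; lra.
rewrite (@le_trans _ _ ((`|L| + 1) * N.+1%:R^-1))//.
  by rewrite (@le_trans _ _ ((`|L| + 1) * `|p t - p (rep N (cell N t))|)) ?ler_wpM2l//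
    ?(ltW L1)// ler_wpM2r// (le_trans (ler_norm L))// lerDl.
rewrite mulrC -ler_pdivlMr//; apply: ltW; near: N.
exact: near_infty_natSinv_lt (PosNum eL).
Unshelve. all: by end_near. Qed.

End Measurability.

(** * Integrals of vector functions *)

Section VectorIntegral.
Variable R : realType.
Notation mu := (@lebesgue_measure R).
Notation integrable01 g := (mu.-integrable `[0, 1] (EFin \o g)).

Let mitv (i : interval R) :
  measurable ([set` i] : set (g_sigma_algebraType (R.-ocitv.-measurable))).
Proof. exact: measurable_itv. Qed.

Definition vint n (a b : R) (f : R -> 'rV[R]_n) : 'rV[R]_n :=
  \row_i \int[mu]_(s in `[a, b]) f s 0 i.

Definition vintegrable n (f : R -> 'rV[R]_n) : Prop :=
  forall i, integrable01 (fun s => f s 0 i).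

(** The class of the integrands that come from controls and trajectories. It is stable under
the operations that occur, and implies integrability. *)
Definition vbm n (f : R -> 'rV[R]_n) : Prop :=
  (forall i, measurable_fun (`[0, 1] : set R) (fun s => f s 0 i)) /\
  exists C, forall t, 0 <= t <= 1 -> `|f t| <= C.

Lemma integrable01_bounded (g : R -> R) C :
  measurable_fun (`[0, 1] : set R) g -> (forall t, 0 <= t <= 1 -> `|g t| <= C) ->
  integrable01 g.
Proof.
move=> mg gC; apply: measurable_bounded_integrable => //.
  rewrite [X in (X < _)%E](_ : _ = mu `[0, 1]%classic)// lebesgue_measure_itv/=.
  by rewrite lte_fin ltr01 -EFinB ltry.
exists C; split; first exact: num_real.
by move=> c Cc t /=; rewrite in_itv/= => /gC h; exact: le_trans h (ltW Cc).
Qed.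

Lemma vbm_integrable n (f : R -> 'rV[R]_n) : vbm f -> vintegrable f.
Proof.
move=> [mf [C fC]] i; apply: (@integrable01_bounded _ C) => // t t01.
exact: le_trans (rV_norm_coord _ _) (fC _ t01).
Qed.

Lemma integrable01_sub (g : R -> R) (a b : R) : 0 <= a -> b <= 1 ->
  integrable01 g -> mu.-integrable `[a, b] (EFin \o g).
Proof.
move=> a0 b1; apply: integrableS => //; apply: subset_itv; rewrite bnd_simp//.
Qed.

Lemma integrable01_cst (c : R) : integrable01 (fun=> c).
Proof.
apply: (@integrable01_bounded _ `|c|) => //.
Qed.

Lemma vintegrableB n (f g : R -> 'rV[R]_n) : vintegrable f -> vintegrable g ->
  vintegrable (fun s => f s - g s).
Proof.
move=> hf hg i; have := integrableB (mitv _) (hf i) (hg i).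
by apply: eq_integrable => // s _; rewrite /= !mxE EFinB.
Qed.

Lemma vintegrableD n (f g : R -> 'rV[R]_n) : vintegrable f -> vintegrable g ->
  vintegrable (fun s => f s + g s).
Proof.
move=> hf hg i; have := integrableD (mitv _) (hf i) (hg i).
by apply: eq_integrable => // s _; rewrite /= !mxE EFinD.
Qed.

Lemma vintegrable_cst n (v : 'rV[R]_n) : vintegrable (fun=> v).
Proof. by move=> i; exact: integrable01_cst. Qed.

Lemma integrable01_sum k (g : 'I_k -> R -> R) : (forall i, integrable01 (g i)) ->
  integrable01 (fun s => \sum_i g i s).
Proof.
move=> hg; have := @integrable_sum _ _ _ mu _ (mitv _) _
  (index_enum 'I_k) xpredT (fun i => EFin \o g i) (fun i _ => hg i).
by apply: eq_integrable => // s _; rewrite /= -sumEFin.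
Qed.

Lemma integrable01Zr (g : R -> R) c : integrable01 g ->
  integrable01 (fun s => g s * c).
Proof.
move=> /(integrableZl (mitv _) c).
by apply: eq_integrable => // s _; rewrite /= -EFinM mulrC.
Qed.

Lemma vintegrable_mulmx n k (f : R -> 'rV[R]_n) (A : 'M[R]_(n, k)) :
  vintegrable f -> vintegrable (fun s => f s *m A).
Proof.
move=> hf j.
have := @integrable01_sum _ (fun i s => f s 0 i * A i j)
  (fun i => integrable01Zr _ (hf i)).
by apply: eq_integrable => // s _; rewrite /= mxE.
Qed.

Lemma vintB n (a b : R) (f g : R -> 'rV[R]_n) : 0 <= a -> b <= 1 ->
  vintegrable f -> vintegrable g ->
  vint a b (fun s => f s - g s) = vint a b f - vint a b g.
Proof.
move=> a0 b1 hf hg; apply/rowP => i; rewrite !mxE -RintegralB//; first last.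
- exact: integrable01_sub.
- exact: integrable01_sub.
by apply: eq_Rintegral => s _; rewrite !mxE.
Qed.

Lemma vintD n (a b : R) (f g : R -> 'rV[R]_n) : 0 <= a -> b <= 1 ->
  vintegrable f -> vintegrable g ->
  vint a b (fun s => f s + g s) = vint a b f + vint a b g.
Proof.
move=> a0 b1 hf hg; apply/rowP => i; rewrite !mxE -RintegralD//; first last.
- exact: integrable01_sub.
- exact: integrable01_sub.
by apply: eq_Rintegral => s _; rewrite !mxE.
Qed.

Lemma Rintegral_sum k (a b : R) (g : 'I_k -> R -> R) :
  0 <= a -> b <= 1 -> (forall i, integrable01 (g i)) ->
  \int[mu]_(s in `[a, b]) (\sum_i g i s) = \sum_i \int[mu]_(s in `[a, b]) g i s.
Proof.
move=> a0 b1 hg.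
elim: k g hg => [|k IH] g hg.
  under eq_Rintegral do rewrite big_ord0.
  by rewrite big_ord0 Rintegral_cst// mul0r.
under eq_Rintegral do rewrite big_ord_recl.
rewrite RintegralD//; last 2 first.
- exact: integrable01_sub.
- by apply: integrable01_sub => //; exact: integrable01_sum.
by rewrite IH// big_ord_recl.
Qed.

Lemma vint_mulmx n k (a b : R) (f : R -> 'rV[R]_n) (A : 'M[R]_(n, k)) :
  0 <= a -> b <= 1 -> vintegrable f ->
  vint a b (fun s => f s *m A) = vint a b f *m A.
Proof.
move=> a0 b1 hf; apply/rowP => j; rewrite !mxE.
under eq_Rintegral do rewrite mxE.
rewrite Rintegral_sum//; last by move=> i; exact: integrable01Zr.
apply: eq_bigr => i _; rewrite mxE RintegralZr//.
exact: integrable01_sub.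
Qed.

Lemma vintZ n (a b l : R) (f : R -> 'rV[R]_n) : 0 <= a -> b <= 1 ->
  vintegrable f -> vint a b (fun s => l *: f s) = l *: vint a b f.
Proof.
move=> a0 b1 hf; apply/rowP => i; rewrite !mxE -RintegralZl//; last first.
  exact: integrable01_sub.
by apply: eq_Rintegral => s _; rewrite !mxE.
Qed.

Lemma vintegrableZ n l (f : R -> 'rV[R]_n) : vintegrable f ->
  vintegrable (fun s => l *: f s).
Proof.
move=> hf i; have := integrable01Zr l (hf i).
by apply: eq_integrable => // s _; rewrite /= !mxE mulrC.
Qed.

Lemma Rintegral_itv_cst (a b c : R) : a <= b ->
  \int[mu]_(s in `[a, b]) c = (b - a) * c.
Proof.
move=> ab; rewrite Rintegral_cst//= lebesgue_measure_itv/= lte_fin.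
case: ltgtP ab => // [_|->] _; first by rewrite -EFinB mulrC.
by rewrite subrr mulr0 mul0r.
Qed.

Lemma vint_cst n (a b : R) (v : 'rV[R]_n) : a <= b ->
  vint a b (fun=> v) = (b - a) *: v.
Proof. by move=> ab; apply/rowP => i; rewrite !mxE Rintegral_itv_cst. Qed.

Lemma eq_vint n (a b : R) (f g : R -> 'rV[R]_n) :
  (forall s, a <= s <= b -> f s = g s) -> vint a b f = vint a b g.
Proof.
move=> fg; apply/rowP => i; rewrite !mxE; apply: eq_Rintegral => s.
by rewrite inE/= in_itv/= => /fg ->.
Qed.

Lemma vintxx n (a : R) (f : R -> 'rV[R]_n) : vint a a f = 0.
Proof. by apply/rowP => i; rewrite !mxE set_itv1 Rintegral_set1. Qed.

Lemma Rintegral_chasles (g : R -> R) (a b : R) : 0 <= a -> a <= b -> b <= 1 ->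
  integrable01 g ->
  \int[mu]_(s in `[0, b]) g s =
  \int[mu]_(s in `[0, a]) g s + \int[mu]_(s in `[a, b]) g s.
Proof.
move=> a0 ab b1 hg.
have i0b : mu.-integrable `[0, b] (EFin \o g) by exact: integrable01_sub.
have /= := Rintegral_itvB (x := a) i0b; rewrite !bnd_simp => /(_ a0 ab) h.
rewrite -(@Rintegral_itv_obnd_cbnd _ a); last first.
  by apply: integrableS i0b => //; apply: subset_itv; rewrite bnd_simp.
by rewrite -h// addrC subrK.
Qed.

Lemma vint_chasles n (f : R -> 'rV[R]_n) (a b : R) : 0 <= a -> a <= b -> b <= 1 ->
  vintegrable f -> vint 0 b f = vint 0 a f + vint a b f.
Proof.
by move=> a0 ab b1 hf; apply/rowP => i; rewrite !mxE -Rintegral_chasles.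
Qed.

(** The bound is only required on the half-open interval, and almost everywhere:
a piecewise constant control jumps at the right end of a cell, and
a trajectory solves its equation almost everywhere. *)
Lemma Rintegral_norm_le (g phi : R -> R) (a b : R) : 0 <= a -> b <= 1 ->
  integrable01 g -> integrable01 phi ->
  (forall s, 0 <= s <= 1 -> 0 <= phi s) ->
  {ae mu, forall s, a <= s < b -> `|g s| <= phi s} ->
  `|\int[mu]_(s in `[a, b]) g s| <= \int[mu]_(s in `[a, b]) phi s.
Proof.
move=> a0 b1 hg hphi phi0 gphi.
have ig := integrable01_sub a0 b1 hg.
have iphi := integrable01_sub a0 b1 hphi.
rewrite (le_trans (le_normr_Rintegral _ ig))//.
have sub : `[a, b[ `<=` `[a, b] by apply: subset_itv; rewrite bnd_simp.
have ig' := integrableS (mitv _) (mitv _) sub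
  (integrable_norm ig).
have iphi' := integrableS (mitv _) (mitv _) sub iphi.
rewrite -!Rintegral_itv_bndo_bndc//.
apply: fine_le; [exact: integrable_fin_num|exact: integrable_fin_num|].
apply: ae_ge0_le_integral => //.
- by case/integrableP : ig'.
- move=> x /=; rewrite in_itv/= => /andP[ax xb].
  by rewrite lee_fin phi0// (le_trans a0 ax) (le_trans (ltW xb) b1).
- by case/integrableP : iphi'.
Qed.

Lemma vint_norm_le n (f : R -> 'rV[R]_n) (phi : R -> R) (a b : R) :
  0 <= a -> b <= 1 -> vintegrable f -> integrable01 phi ->
  (forall s, 0 <= s <= 1 -> 0 <= phi s) ->
  {ae mu, forall s, a <= s < b -> `|f s| <= phi s} ->
  `|vint a b f| <= \int[mu]_(s in `[a, b]) phi s.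
Proof.
move=> a0 b1 hf hphi phi0 fphi; apply: rV_normP => [|i].
  apply: Rintegral_ge0 => x /=; rewrite in_itv/= => /andP[ax xb].
  by rewrite phi0// (le_trans a0 ax) (le_trans xb b1).
rewrite mxE; apply: Rintegral_norm_le => //.
move: fphi; apply: filterS; first exact: (ae_filter_ringOfSetsType mu).
by move=> s h /h; exact: le_trans (rV_norm_coord _ _).
Qed.

Lemma vint_norm_le_cst n (f : R -> 'rV[R]_n) (a b c : R) :
  0 <= a -> a <= b -> b <= 1 -> vintegrable f -> 0 <= c ->
  (forall s, a <= s < b -> `|f s| <= c) -> `|vint a b f| <= (b - a) * c.
Proof.
move=> a0 ab b1 hf c0 fc; rewrite -Rintegral_itv_cst//.
by apply: vint_norm_le => //; [exact: integrable01_cst|exact: aeW].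
Qed.

Lemma integrable01_exp (K : R) : 0 <= K -> integrable01 (fun s => expR (K * s)).
Proof.
move=> K0; apply: (@integrable01_bounded _ (expR K)).
  by apply: nondecreasing_measurable => // s t st; rewrite ler_expR ler_wpM2l.
move=> t /andP[t0 t1]; rewrite ger0_norm ?expR_ge0// ler_expR.
by rewrite ler_piMr.
Qed.

Lemma Rintegral_exp (K t : R) : 0 < K -> 0 <= t ->
  \int[mu]_(s in `[0, t]) expR (K * s) = (expR (K * t) - 1) / K.
Proof.
move=> K0; rewrite le_eqVlt => /predU1P[<-|t0].
  by rewrite set_itv1 Rintegral_set1 mulr0 expR0 subrr mul0r.
have dF (x : R) : is_derive x 1 (fun s => expR (K * s) / K) (expR (K * x)).
  apply: is_derive_eq; rewrite /GRing.scale/=.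
  by field; rewrite gt_eqF.
have cF : continuous (fun s : R => expR (K * s) / K).
  move=> x; apply: differentiable_continuous; apply/derivable1_diffP.
  by have [] := dF x.
rewrite /Rintegral (@continuous_FTC2 _ _ (fun s => expR (K * s) / K))//.
- by rewrite /= mulr0 expR0 -mulrBl.
- apply: continuous_subspaceT => x.
  apply: (@continuous_comp _ _ _ (fun s : R => K * s) expR); last exact: continuous_expR.
  exact: mulrl_continuous.
- split.
  + by move=> x _; have [] := dF x.
  + exact/cvg_at_right_filter/cF.
  + exact/cvg_at_left_filter/cF.
- by move=> x _; rewrite derive1E; have [_ ->] := dF x.
Qed.

End VectorIntegral.

(** * A Gronwall inequality *)

Section Gronwall.
Variable R : realType.
Notation mu := (@lebesgue_measure R).
Notation integrable01 g := (mu.-integrable `[0, 1] (EFin \o g)).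

(** Against the weight exp(2Ks), integration over [0, t] gains a factor 1/2.
This is the one estimate behind uniqueness, the a priori bounds, the dependence on
the control and the convergence of Picard iteration. *)
Lemma vint_norm_le_exp n (f : R -> 'rV[R]_n) (K S c t : R) :
  0 < K -> 0 <= S -> 0 <= c -> 0 <= t <= 1 -> vintegrable f ->
  {ae mu, forall s, 0 <= s < 1 -> `|f s| <= S * K * expR (2 * K * s) + c} ->
  `|vint 0 t f| <= S / 2 * expR (2 * K * t) + c.
Proof.
move=> K0 S0 c0 /andP[t0 t1] hf fS.
have K20 : 0 < 2 * K by rewrite mulr_gt0.
have iE := integrable01_exp (ltW K20).
have iE' : integrable01 (fun s => S * K * expR (2 * K * s)).
  have := integrable01Zr (S * K) iE.
  by apply: eq_integrable => // s _; rewrite /= mulrC.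
have ic := integrable01_cst c.
have iphi : integrable01 (fun s => S * K * expR (2 * K * s) + c).
  have := integrableD _ iE' ic; apply: (fun h => h _) => //.
rewrite (@le_trans _ _ (\int[mu]_(s in `[0, t]) (S * K * expR (2 * K * s) + c)))//.
  apply: vint_norm_le => //.
    by move=> s _; rewrite addr_ge0// !mulr_ge0 ?expR_ge0// ltW.
  move: fS; apply: filterS; first exact: (ae_filter_ringOfSetsType mu).
  by move=> s h /andP[s0 st]; apply: h; rewrite s0 (lt_le_trans st t1).
rewrite RintegralD//; [|exact: integrable01_sub..].
rewrite RintegralZl//; last exact: integrable01_sub.
rewrite Rintegral_exp// Rintegral_itv_cst// subr0.
have -> : S * K * ((expR (2 * K * t) - 1) / (2 * K)) =
    S / 2 * expR (2 * K * t) - S / 2 by field; rewrite gt_eqF.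
have : t * c <= c by rewrite ler_piMl.
have : 0 <= S / 2 by rewrite divr_ge0.
lra.
Qed.

Lemma vint_bounded n (f : R -> 'rV[R]_n) : vintegrable f ->
  exists C, forall t, 0 <= t <= 1 -> `|vint 0 t f| <= C.
Proof.
move=> hf.
have i1 : integrable01 (fun s => \sum_i `|f s 0 i|).
  by apply: (@integrable01_sum _ _ (fun i s => `|f s 0 i|)) => i; exact: integrable_norm (hf i).
exists (\int[mu]_(s in `[0, 1]) (\sum_i `|f s 0 i|)) => t /andP[t0 t1].
rewrite (@le_trans _ _ (\int[mu]_(s in `[0, t]) (\sum_i `|f s 0 i|)))//.
  apply: vint_norm_le => //; first by move=> s _; exact: sumr_ge0.
  apply: aeW => s _; apply: rV_normP => [|i]; first exact: sumr_ge0.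
  by rewrite (bigD1 i)//= lerDl sumr_ge0.
rewrite [leRHS](@Rintegral_chasles _ _ t)// lerDl.
by apply: Rintegral_ge0 => s _; exact: sumr_ge0.
Qed.

(** The supremum S of the weighted distance between x and z satisfies S <= S / 2 + c. It is
finite because primitives of integrable functions are bounded. Stated for densities a and
b, it serves for Caratheodory solutions, for expansions and for constants alike. *)
Lemma gronwall n (K c : R) (x0 : 'rV[R]_n) (x z a b : R -> 'rV[R]_n) :
  0 < K -> 0 <= c -> vintegrable a -> vintegrable b ->
  (forall t, 0 <= t <= 1 -> x t = x0 + vint 0 t a) ->
  (forall t, 0 <= t <= 1 -> z t = x0 + vint 0 t b) ->
  {ae mu, forall s, 0 <= s < 1 -> `|a s - b s| <= K * `|x s - z s| + c} ->
  forall t, 0 <= t <= 1 -> `|x t - z t| <= 2 * c * expR (2 * K).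
Proof.
move=> K0 c0 ia ib xE zE ab.
have eE t : 0 <= t <= 1 -> x t - z t = vint 0 t (fun s => a s - b s).
  move=> /[dup] t01 /andP[t0 t1].
  by rewrite xE// zE// vintB// opprD addrACA subrr add0r.
have iab := vintegrableB ia ib.
pose w t := `|x t - z t| * expR (- (2 * K * t)).
have wK t : `|x t - z t| = w t * expR (2 * K * t).
  by rewrite /w -mulrA -expRD addNr expR0 mulr1.
pose A := [set w t | t in [set t | 0 <= t <= 1]].
have A0 : A !=set0 by exists (w 0), 0 => //=; rewrite lexx ler01.
have ubA : has_ubound A.
  have [C hC] := vint_bounded iab; exists C => _ [t /= /[dup] t01 /andP[t0 t1] <-].
  rewrite (le_trans _ (hC t t01))// -eE// /w ler_piMr//.
  by rewrite -expR0 ler_expR oppr_le0 !mulr_ge0// ltW.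
pose S := sup A.
have wS t : 0 <= t <= 1 -> w t <= S.
  by move=> t01; apply: ub_le_sup => //; exists t.
have S0 : 0 <= S.
  by apply: le_trans (wS 0 _); rewrite ?lexx ?ler01// mulr_ge0 ?expR_ge0.
have step t : 0 <= t <= 1 -> w t <= S / 2 + c.
  move=> /[dup] t01 /andP[t0 t1].
  have := @vint_norm_le_exp _ _ K S c t K0 S0 c0 t01 iab.
  rewrite -eE// wK => h.
  have E1 : 1 <= expR (2 * K * t) by rewrite -expR0 ler_expR !mulr_ge0// ltW.
  have E0 : 0 < expR (2 * K * t) by exact: expR_gt0.
  rewrite -(ler_pM2r E0) (@le_trans _ _ (S / 2 * expR (2 * K * t) + c))//.
    apply: h; move: ab; apply: filterS; first exact: (ae_filter_ringOfSetsType mu).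
    move=> s h /[dup] s01 /andP[s0 s1]; rewrite (le_trans (h s01))// lerD2r.
    rewrite wK mulrA [S * K]mulrC ler_pM2r ?expR_gt0// ler_pM2l//.
    by apply: wS; rewrite s0 ltW.
  by rewrite [leRHS]mulrDl lerD// ler_peMr.
have S2c : S <= 2 * c.
  have : S <= S / 2 + c by apply: ge_sup => // _ [t /= t01 <-]; exact: step.
  lra.
move=> t /[dup] t01 /andP[t0 t1]; rewrite wK ler_pM ?mulr_ge0 ?expR_ge0//.
  exact: le_trans (wS _ t01) S2c.
by rewrite ler_expR ler_piMr// mulr_ge0// ltW.
Qed.

End Gronwall.

(** * Picard iteration *)

Section Picard.
Variable R : realType.
Notation mu := (@lebesgue_measure R).

Lemma le0_of_le_half_expn (a C : R) : (forall k, a <= C / 2 ^+ k) -> a <= 0.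
Proof.
move=> aC; rewrite leNgt; apply/negP => a0.
have C0 : 0 < C by have := aC 0%N; rewrite expr0 divr1; exact: lt_le_trans.
have aC0 : 0 < a / C by rewrite divr_gt0.
have [k _ /(_ k (leqnn k))/=] := near_infty_natSinv_expn_lt (PosNum aC0).
rewrite ltr_pdivlMr// mulrC mul1r => h.
by have := le_lt_trans (aC k) h; rewrite ltxx.
Qed.

(** The intervals of center u k and radius 2M/2^k are nested. *)
Lemma geometric_cauchy (u : nat -> R) (M : R) :
  (forall k, `|u k.+1 - u k| <= M / 2 ^+ k) ->
  exists l, forall k, `|u k - l| <= 2 * M / 2 ^+ k.
Proof.
move=> uM.
have M2 k : 2 * M / 2 ^+ k.+1 = M / 2 ^+ k :> R.
  by rewrite exprS invfM mulrACA divff// mul1r.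
have M2' k : 2 * M / 2 ^+ k = M / 2 ^+ k + M / 2 ^+ k :> R.
  by rewrite -mulrA mulr_natl mulr2n.
pose v k := u k - 2 * M / 2 ^+ k; pose w k := u k + 2 * M / 2 ^+ k.
have vS : {homo v : i j / (i <= j)%N >-> i <= j}.
  apply: homo_leq => [//|y x z|k]; first exact: le_trans.
  by rewrite /v M2 M2'; have := uM k; rewrite ler_norml => /andP[]; lra.
have wS : {homo w : i j / (i <= j)%N >-> j <= i}.
  apply: (@homo_leq _ _ (fun x y => y <= x)) => [//|y x z xy yz|k].
    exact: le_trans yz xy.
  by rewrite /w M2 M2'; have := uM k; rewrite ler_norml => /andP[]; lra.
have M0 : 0 <= M.
  by have := le_trans (normr_ge0 _) (uM 0%N); rewrite expr0 divr1.
have vw k : v k <= w k.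
  rewrite /v /w; have : 0 <= 2 * M / 2 ^+ k by rewrite divr_ge0 ?mulr_ge0// exprn_ge0.
  lra.
have vwij i j : v i <= w j.
  have [ij|/ltnW ji] := leqP i j; first exact: le_trans (vS _ _ ij) (vw j).
  exact: le_trans (vw i) (wS _ _ ji).
exists (sup (range v)) => k.
have h1 : v k <= sup (range v).
  apply: ub_le_sup; last by exists k.
  by exists (w 0%N) => _ [j _ <-]; exact: vwij.
have h2 : sup (range v) <= w k.
  apply: ge_sup; first by exists (v 0%N), 0%N.
  by move=> _ [j _ <-]; exact: vwij.
by rewrite ler_norml; move: h1 h2; rewrite /v /w => *; apply/andP; split; lra.
Qed.

Lemma measurable_lipschitz (g : R -> R) L :
  (forall s t, 0 <= s <= 1 -> 0 <= t <= 1 -> `|g s - g t| <= L * `|s - t|) ->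
  measurable_fun (`[0, 1] : set R) g.
Proof.
move=> gL.
apply: (@measurable_fun_lipschitz_comp _ 1 _ (fun t => const_mx t) _ L) => //.
  move=> i; rewrite (_ : (fun t => _) = id).
    by apply: measurable_id.
  by apply/funext => t; rewrite mxE.
move=> s t; rewrite /= !in_itv/= => s01 t01.
rewrite (le_trans (gL _ _ s01 t01))//.
rewrite -(norm_const_rV1 (s - t)) (_ : const_mx (s - t) = const_mx s - const_mx t)//.
by apply/rowP => i; rewrite !mxE.
Qed.

Lemma vint_lipschitz n (f : R -> 'rV[R]_n) C s t : vintegrable f -> 0 <= C ->
  (forall t, 0 <= t <= 1 -> `|f t| <= C) -> 0 <= s <= 1 -> 0 <= t <= 1 ->
  `|vint 0 s f - vint 0 t f| <= C * `|s - t|.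
Proof.
move=> hf C0 fC; wlog st : s t / t <= s.
  move=> H s01 t01; have [st|/ltW st] := leP t s; first exact: H.
  by rewrite distrC [X in _ * X]distrC; exact: H.
move=> /andP[s0 s1] /andP[t0 t1].
rewrite (@vint_chasles _ _ _ t s)// addrAC subrr add0r mulrC.
rewrite (ger0_norm (x := s - t)) ?subr_ge0//; apply: vint_norm_le_cst => // r.
by move=> /andP[tr rs]; apply: fC; rewrite (le_trans t0 tr)/= ltW// (lt_le_trans rs).
Qed.

Lemma vbm_primitive n (x0 : 'rV[R]_n) (f : R -> 'rV[R]_n) :
  vbm f -> vbm (fun t => x0 + vint 0 t f).
Proof.
move=> hf; have [_ [C0 fC0]] := hf; pose C := Num.max 0 C0.
have fC t : 0 <= t <= 1 -> `|f t| <= C.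
  by move=> /fC0; rewrite /C le_max => ->; rewrite orbT.
have C_ge0 : 0 <= C by rewrite /C le_max lexx.
have iF := vbm_integrable hf; split.
  move=> i; apply: (@measurable_lipschitz _ C) => s t s01 t01.
  rewrite (le_trans _ (vint_lipschitz iF C_ge0 fC s01 t01))//.
  have := rV_norm_coord (vint 0 s f - vint 0 t f) i.
  by rewrite !mxE opprD addrACA subrr add0r.
have [D hD] := vint_bounded iF; exists (`|x0| + D) => t t01.
by rewrite (le_trans (ler_normD _ _))// lerD// hD.
Qed.

Lemma vbm_cst n (v : 'rV[R]_n) : vbm (fun=> v).
Proof. by split=> [i|]; [exact: measurable_cst|exists `|v|]. Qed.

(** Caratheodory existence. The increments of Picard iteration, measured with the
weight exp(2Kt), are halved at each step. *)
Lemma picard n (F : R -> 'rV[R]_n -> 'rV[R]_n) (K : R) (x0 : 'rV[R]_n) :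
  0 < K ->
  (forall s x y, 0 <= s <= 1 -> `|F s x - F s y| <= K * `|x - y|) ->
  (forall x, vbm x -> vbm (fun s => F s (x s))) ->
  exists2 x, vbm x & forall t, 0 <= t <= 1 ->
    x t = x0 + vint 0 t (fun s => F s (x s)).
Proof.
move=> K0 Flip Fbm.
pose X := fix X k t := if k is k'.+1 then x0 + vint 0 t (fun s => F s (X k' s))
  else x0.
have Xbm k : vbm (X k).
  by elim: k => [|k IH]; [exact: vbm_cst|exact/vbm_primitive/Fbm].
have FXi k : vintegrable (fun s => F s (X k s)) by exact/vbm_integrable/Fbm.
have [C hC] := vint_bounded (FXi 0%N).
have C0 : 0 <= C by apply: le_trans (hC 0 _); rewrite ?lexx ?ler01.
have dX k t : 0 <= t <= 1 ->
    `|X k.+1 t - X k t| <= C / 2 ^+ k * expR (2 * K * t).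
  elim: k t => [|k IH] t /[dup] t01 /andP[t0 t1].
    rewrite /= addrC addKr expr0 divr1 (le_trans (hC t t01))//.
    by rewrite ler_peMr// -expR0 ler_expR !mulr_ge0// ltW.
  have -> : X k.+2 t - X k.+1 t = vint 0 t (fun s => F s (X k.+1 s) - F s (X k s)).
    by rewrite vintB// [LHS]/= opprD addrACA subrr add0r.
  have := @vint_norm_le_exp _ _ (fun s => F s (X k.+1 s) - F s (X k s)) K
    (C / 2 ^+ k) 0 t K0 _ (lexx 0) t01 (vintegrableB (FXi _) (FXi _)).
  rewrite addr0 exprSr invfM mulrA; apply.
    by rewrite divr_ge0// exprn_ge0.
  apply: aeW => s /andP[s0 /ltW s1]; have s01 : 0 <= s <= 1 by rewrite s0.
  rewrite addr0 (le_trans (Flip _ _ _ s01))//.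
  have -> : C / 2 ^+ k * K * expR (2 * K * s) = K * (C / 2 ^+ k * expR (2 * K * s)).
    by ring.
  by rewrite ler_pM2l//; exact: IH.
pose M := C * expR (2 * K).
have dX' k t : 0 <= t <= 1 -> `|X k.+1 t - X k t| <= M / 2 ^+ k.
  move=> /[dup] t01 /andP[t0 t1]; rewrite (le_trans (dX _ _ t01))//.
  rewrite /M mulrAC ler_wpM2r ?invr_ge0 ?exprn_ge0// ler_wpM2l// ler_expR.
  by rewrite ler_piMr// mulr_ge0// ltW.
have M0 : 0 <= M by rewrite mulr_ge0 ?expR_ge0.
have /choice[x hx] : forall t, exists v : 'rV[R]_n, 0 <= t <= 1 ->
    forall k, `|X k t - v| <= 2 * M / 2 ^+ k.
  move=> t; have [t01|] := pselect (0 <= t <= 1); last by exists 0.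
  have /choice[l hl] : forall i, exists l : R,
      forall k, `|X k t 0 i - l| <= 2 * M / 2 ^+ k.
    move=> i; apply: geometric_cauchy => k; rewrite (le_trans _ (dX' k t t01))//.
    by have := rV_norm_coord (X k.+1 t - X k t) i; rewrite !mxE.
  exists (\row_i l i) => _ k; apply: rV_normP => [|i].
    by rewrite divr_ge0 ?mulr_ge0// exprn_ge0.
  by rewrite !mxE; exact: hl.
have xbm : vbm x.
  split.
    move=> i; apply: (measurable_fun_cvg (fun k => (Xbm k).1 i)) => t.
    rewrite /= in_itv/= => t01; apply/cvgrPdist_le => e e0.
    have eM : 0 < e / (2 * M + 1) by rewrite divr_gt0// ltr_wpDl// mulr_ge0.
    near=> k; rewrite distrC.
    have := le_trans (rV_norm_coord (X k t - x t) i) (hx t t01 k).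
    rewrite !mxE => h; rewrite (le_trans h)//.
    have : 1 / 2 ^+ k < e / (2 * M + 1).
      by near: k; exact: near_infty_natSinv_expn_lt (PosNum eM).
    rewrite ltr_pdivlMr ?ltr_wpDl ?mulr_ge0// => /ltW; apply: le_trans.
    by rewrite mulrC mul1r ler_wpM2l ?invr_ge0 ?exprn_ge0// lerDl.
  exists (`|x0| + 2 * M) => t t01.
  have := hx t t01 0%N; rewrite expr0 divr1 /= => h.
  by rewrite -[x t](subKr x0) (le_trans (ler_normB _ _))// lerD2l.
exists x => // t /[dup] t01 /andP[t0 t1].
apply/eqP; rewrite -subr_eq0 -normr_le0.
apply: (@le0_of_le_half_expn _ (M + K * (2 * M))) => k.
have -> : x t - (x0 + vint 0 t (fun s => F s (x s))) =
    (x t - X k.+1 t) + vint 0 t (fun s => F s (X k s) - F s (x s)).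
  rewrite vintB//; last exact/vbm_integrable/Fbm.
  by rewrite [X k.+1 t]/=; apply/rowP => i; rewrite !mxE; ring.
rewrite (le_trans (ler_normD _ _))// mulrDl lerD//.
  rewrite distrC (le_trans (hx t t01 _))// exprS invfM mulrACA divff// mul1r//.
have P0 : 0 <= K * (2 * M / 2 ^+ k).
  by apply: mulr_ge0; [exact: ltW|rewrite divr_ge0 ?mulr_ge0// exprn_ge0].
rewrite (@le_trans _ _ ((t - 0) * (K * (2 * M / 2 ^+ k))))//.
  apply: vint_norm_le_cst => //.
  - apply: vintegrableB => //; exact/vbm_integrable/Fbm.

  move=> s /andP[s0 st]; have s01 : 0 <= s <= 1 by rewrite s0 ltW// (lt_le_trans st).
  by rewrite (le_trans (Flip _ _ _ s01))// ler_pM2l//; exact: hx.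
by rewrite subr0 -[leRHS]mulrA ler_piMl.
Unshelve. all: by end_near. Qed.

End Picard.

(** * Caratheodory solutions *)

Section Caratheodory.
Variable R : realType.
Notation mu := (@lebesgue_measure R).
Notation integrable01 g := (mu.-integrable `[0, 1] (EFin \o g)).

(** Lebesgue differentiation, for g cut off outside [0, 1]. *)
Lemma is_derive_primitive (g : R -> R) : integrable01 g ->
  {ae mu, forall t : R, 0 < t < 1 ->
    is_derive t 1 (fun t => \int[mu]_(s in `[0, t]) g s) (g t)}.
Proof.
move=> ig.
have := lebesgue_differentiation (integrable_locally_restrict (measurable_itv _) ig).
apply: filterS; first exact: (ae_filter_ringOfSetsType mu).
move=> t lt /andP[t0 t1].
have ig' : mu.-integrable `[0, 1] (EFin \o (g \_ `[0, 1])).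
  by rewrite -restrict_EFin; apply/integrable_restrict => //=; rewrite setIid.
have /= [|d dE] := @FTC1_lebesgue_pt _ _ (BLeft 0) t 1 t1 ig' _ lt.
  by rewrite lte_fin.
have gE : (g \_ `[0, 1]) t = g t.
  by rewrite patchE mem_set//= in_itv/= !ltW.
have dd : is_derive t 1 (fun y => \int[mu]_(s in `[0, y]) (g \_ `[0, 1]) s) (g t).
  by split=> //; rewrite -derive1E dE gE.
apply: near_eq_is_derive dd; near=> y.
apply: eq_Rintegral => s; rewrite inE/= in_itv/= => /andP[s0 sy].
rewrite patchE mem_set//= in_itv/= s0 (le_trans sy)// ltW//.
near: y; exact: lt_nbhsl.
Unshelve. all: by end_near. Qed.

Lemma is_derive_coord n (x : R -> 'rV[R]_n) (t : R) (v : 'rV[R]_n) :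
  is_derive t 1 x v <-> forall i, is_derive t 1 (fun t => x t 0 i) (v 0 i).
Proof.
split=> [[dx <-] i|h].
  split; first by move/derivable_mxP : dx; exact.
  by rewrite derive_mx// mxE.
have dx : derivable x t 1.
  by apply/derivable_mxP => i j; rewrite (ord1 i); case: (h j).
split=> //; rewrite derive_mx//; apply/rowP => i; rewrite mxE.
by case: (h i).
Qed.

Variables (n : nat) (F : R -> 'rV[R]_n -> 'rV[R]_n) (K : R) (x0 : 'rV[R]_n).
Hypothesis K0 : 0 < K.
Hypothesis Flip : forall s x y, 0 <= s <= 1 -> `|F s x - F s y| <= K * `|x - y|.
Hypothesis Fbm : forall x, vbm x -> vbm (fun s => F s (x s)).

Definition caratheodory (x : R -> 'rV[R]_n) : Prop :=
  [/\ x 0 = x0, absolutely_continuous01 x &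
      {ae mu, forall t : R, 0 < t < 1 -> is_derive t 1 x (F t (x t))}].

Definition integral_solution (x : R -> 'rV[R]_n) : Prop :=
  vbm x /\ forall t, 0 <= t <= 1 -> x t = x0 + vint 0 t (fun s => F s (x s)).

Lemma caratheodory_of_integral x : integral_solution x -> caratheodory x.
Proof.
move=> [xbm xE].
have iF : vintegrable (fun s => F s (x s)) by exact/vbm_integrable/Fbm.
have x0E : x 0 = x0 by rewrite xE ?lexx ?ler01// vintxx addr0.
split=> //.
  move=> i; exists (fun s => F s (x s) 0 i); first exact: iF.
  by move=> t t01; rewrite x0E xE// !mxE.
have : {ae mu, forall (t : R) (i : 'I_n), 0 < t < 1 ->
    is_derive t 1 (fun t => \int[mu]_(s in `[0, t]) F s (x s) 0 i) (F t (x t) 0 i)}.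
  apply: filter_forall => i; exact: is_derive_primitive (iF i).
apply: filterS; first exact: (ae_filter_ringOfSetsType mu).
move=> t h t01; apply/is_derive_coord => i.
have := @is_deriveD _ _ _ _ _ _ _ _ _ (is_derive_cst (x0 0 i) t 1) (h i t01).
have /andP[t0 t1] := t01.
rewrite add0r; apply: near_eq_is_derive; near=> y.
rewrite xE; first by rewrite !mxE.
apply/andP; split; apply: ltW.
  by near: y; exact: lt_nbhsr.
by near: y; exact: lt_nbhsl.
Unshelve. all: by end_near. Qed.

(** Almost everywhere the density of x is F(t, x(t)), so that uniqueness reduces to the
Gronwall estimate for the densities. *)
Lemma caratheodory_unique x y : caratheodory x -> integral_solution y ->
  forall t, 0 <= t <= 1 -> x t = y t.
Proof.
move=> [x0E acx dx] [ybm yE] t t01.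
have /choice[g hg] : forall i, exists g : R -> R, integrable01 g /\
    forall t, 0 <= t <= 1 -> x t 0 i = x 0 0 i + \int[mu]_(s in `[0, t]) g s.
  by move=> i; have [g ig gE] := acx i; exists g.
pose a s := \row_i g i s.
have ia : vintegrable a.
  move=> i; have [+ _] := hg i; apply: eq_integrable => // s _.
  by rewrite /= mxE.
have xE s : 0 <= s <= 1 -> x s = x0 + vint 0 s a.
  move=> s01; apply/rowP => i; have [_ ->//] := hg i.
  by rewrite x0E !mxE; congr (_ + _); apply: eq_Rintegral => r _; rewrite mxE.
apply/eqP; rewrite -subr_eq0 -normr_le0.
have := @gronwall _ _ K 0 x0 x y a _ K0 (lexx 0) ia (vbm_integrable (Fbm ybm)) xE yE.
rewrite mulr0 mul0r; apply => //.
have h0 : {ae mu, forall (t : R) (i : 'I_n), 0 < t < 1 ->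
    is_derive t 1 (fun t => \int[mu]_(s in `[0, t]) g i s) (g i t)}.
  by apply: filter_forall => i; apply: is_derive_primitive; have [] := hg i.
have h1 : {ae mu, forall s : R, s <> 0}.
  exists [set 0]; split; [exact: measurable_set1|exact: lebesgue_measure_set1|].
  by move=> s /= /contrapT.
move: h1 h0 dx; apply: filterS3; first exact: (ae_filter_ringOfSetsType mu).
move=> s /eqP sn0 hs dxs /andP[s0 s1].
have s01 : 0 < s < 1 by rewrite lt_neqAle eq_sym sn0 s0.
suff -> : a s = F s (x s) by rewrite addr0; apply: Flip; rewrite s0 ltW.
apply/rowP => i; rewrite mxE.
have /is_derive_coord/(_ i)[_ <-] := dxs s01.
have := @is_deriveD _ _ _ _ _ _ _ _ _ (is_derive_cst (x0 0 i) s 1) (hs i s01).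
rewrite add0r => h; apply/esym.
suff: is_derive s 1 (fun t => x t 0 i) (g i s) by case.
have /andP[s0' s1'] := s01.
move: h; apply: near_eq_is_derive; near=> r.
rewrite xE; first by rewrite !mxE; congr (_ + _); apply: eq_Rintegral => r' _; rewrite mxE.
apply/andP; split; apply: ltW.
  by near: r; exact: lt_nbhsr.
by near: r; exact: lt_nbhsl.
Unshelve. all: by end_near. Qed.

(** Whatever trajectory is chosen, it agrees on [0, 1] with the one built by Picard
iteration. *)
Lemma get_caratheodory : integral_solution (get [set x | caratheodory x]).
Proof.
have [y ybm yE] := @picard _ _ F K x0 K0 Flip Fbm.
have cy : caratheodory y by exact: caratheodory_of_integral.
have cx : caratheodory (get [set x | caratheodory x]).
  by have := @xgetI _ point [set x | caratheodory x] y cy.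
set x := get _ in cx *.
have xy t : 0 <= t <= 1 -> x t = y t by exact: caratheodory_unique.
split; last first.
  move=> t /[dup] t01 /andP[t0 t1]; rewrite xy// yE//; congr (_ + _).
  apply: eq_vint => s /andP[s0 st]; rewrite xy// s0/=; exact: le_trans st t1.
have [my [C hC]] := ybm; split.
  move=> i; apply: eq_measurable_fun (my i) => s.
  by rewrite inE/= in_itv/= => /xy ->.
by exists C => t t01; rewrite xy// hC.
Qed.

End Caratheodory.

(** * Control systems: trajectories and sensitivities *)

(** A vector field g with a single control c, and matrices A and B that play the role of
its partial derivatives in x and in c. Merging the continuous control and the mode weights
into c makes the field jointly smooth; the weight 1 + |x| is what survives of global
Lipschitz continuity, since the field is multiplied by the mode weights. *)
Record control_system (R : realType) (n k : nat) (C : set 'rV[R]_k)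
    (g : R -> 'rV[R]_n -> 'rV[R]_k -> 'rV[R]_n)
    (A : R -> 'rV[R]_n -> 'rV[R]_k -> 'M[R]_n)
    (B : R -> 'rV[R]_n -> 'rV[R]_k -> 'M[R]_(k, n)) (K : R) : Prop := {
  cs_gt0 : 0 < K;
  cs_bounded : forall c, C c -> `|c| <= K;
  cs_lip_x : forall t x x' c, 0 <= t <= 1 -> C c ->
    `|g t x c - g t x' c| <= K * `|x - x'|;
  cs_growth : forall t x c, 0 <= t <= 1 -> C c -> `|g t x c| <= K * (1 + `|x|);
  cs_lip : forall t t' x x' c c', 0 <= t <= 1 -> 0 <= t' <= 1 -> C c -> C c' ->
    `|g t x c - g t' x' c'| <=
      K * (1 + `|x|) * (`|t - t'| + `|x - x'| + `|c - c'|);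
  cs_lipA : forall (v : 'rV_n) t t' x x' c c', 0 <= t <= 1 -> 0 <= t' <= 1 -> C c -> C c' ->
    `|v *m A t x c - v *m A t' x' c'| <=
      K * (1 + `|x|) * (`|t - t'| + `|x - x'| + `|c - c'|) * `|v|;
  cs_lipB : forall (v : 'rV_k) t t' x x' c c', 0 <= t <= 1 -> 0 <= t' <= 1 -> C c -> C c' ->
    `|v *m B t x c - v *m B t' x' c'| <=
      K * (1 + `|x|) * (`|t - t'| + `|x - x'| + `|c - c'|) * `|v|;
  cs_A : forall (v : 'rV_n) t x c, 0 <= t <= 1 -> C c ->
    `|v *m A t x c| <= K * (1 + `|x|) * `|v|;
  cs_B : forall (v : 'rV_k) t x c, 0 <= t <= 1 -> C c ->
    `|v *m B t x c| <= K * (1 + `|x|) * `|v|;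
  cs_taylor : forall t x x' c c', 0 <= t <= 1 -> C c -> C c' ->
    `|g t x' c' - g t x c - ((x' - x) *m A t x c + (c' - c) *m B t x c)| <=
      K * (`|x' - x| + `|c' - c|) ^+ 2 }.

Section Flow.
Variables (R : realType) (n k : nat) (C : set 'rV[R]_k).
Variables (g : R -> 'rV[R]_n -> 'rV[R]_k -> 'rV[R]_n).
Variables (A : R -> 'rV[R]_n -> 'rV[R]_k -> 'M[R]_n).
Variables (B : R -> 'rV[R]_n -> 'rV[R]_k -> 'M[R]_(k, n)) (K : R).
Hypothesis S : control_system C g A B K.
Variable x0 : 'rV[R]_n.

Notation mu := (@lebesgue_measure R).

Let K_gt0 : 0 < K := cs_gt0 S.
Let K_ge0 : 0 <= K := ltW K_gt0.

Definition admissible (c : R -> 'rV[R]_k) : Prop :=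
  (forall i, measurable_fun (`[0, 1] : set R) (fun t => c t 0 i)) /\
  forall t, 0 <= t <= 1 -> C (c t).

Definition flow (c : R -> 'rV[R]_k) : (R -> 'rV[R]_n) -> Prop :=
  integral_solution (fun s x => g s x (c s)) x0.

(** A priori bound for trajectories and for Euler iterates alike, from the comparison with
the constant x0. *)
Definition state_bound : R := `|x0| + 2 * (K * (1 + `|x0|)) * expR (2 * K).

(** The field and its linearization are bounded and Lipschitz with this constant on the ball
of radius [state_bound]. *)
Definition ball_const : R := K * (1 + state_bound).

Definition sens_bound : R := 2 * (2 * K * ball_const) * expR (2 * ball_const).
Definition sens_lip : R := ball_const * sens_bound + 2 * K * ball_const.

Lemma state_bound_ge0 : 0 <= state_bound.
Proof. by rewrite /state_bound addr_ge0// !mulr_ge0 ?expR_ge0// addr_ge0. Qed.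

Lemma ball_const_gt0 : 0 < ball_const.
Proof. by apply: mulr_gt0 => //; apply: ltr_pwDl => //; exact: state_bound_ge0. Qed.
Let ball_const_ge0 : 0 <= ball_const := ltW ball_const_gt0.

Lemma le_ball_const : K <= ball_const.
Proof. by rewrite /ball_const ler_peMr// lerDl state_bound_ge0. Qed.

Lemma sens_bound_ge0 : 0 <= sens_bound.
Proof.
by rewrite /sens_bound; move: ball_const ball_const_ge0 => M M0; rewrite !mulr_ge0 ?expR_ge0.
Qed.

Lemma sens_lip_ge0 : 0 <= sens_lip.
Proof.
rewrite /sens_lip; move: ball_const ball_const_ge0 sens_bound sens_bound_ge0 => M M0 Y Y0.
by rewrite addr_ge0// !mulr_ge0.
Qed.

Lemma weight_le_ball_const (x : 'rV[R]_n) : `|x| <= state_bound -> K * (1 + `|x|) <= ball_const.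
Proof. by move=> h; rewrite ler_pM2l// lerD2l. Qed.

Let K2_ge0 : 0 <= 2 * K. Proof. by rewrite mulr_ge0. Qed.
Let KM_ge0 : 0 <= 2 * K * ball_const. Proof. exact: mulr_ge0. Qed.

Lemma admissible_vbm c : admissible c -> vbm c.
Proof.
by move=> [mc Cc]; split=> //; exists K => t /Cc; exact: (cs_bounded S).
Qed.

(** Used for the field and for its linearization. The constant D may grow with the state,
because a given curve is bounded. *)
Lemma vbm_lipschitz_comp l (H : R -> 'rV[R]_n -> 'rV[R]_k -> 'rV[R]_l) (x : R -> 'rV[R]_n) c
    (D : R -> R) :
  vbm x -> admissible c ->
  (forall r, 0 <= D r) -> {homo D : r r' / r <= r'} ->
  (forall t t' x x' c c', 0 <= t <= 1 -> 0 <= t' <= 1 -> C c -> C c' ->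
    `|H t x c - H t' x' c'| <= D `|x| * (`|t - t'| + `|x - x'| + `|c - c'|)) ->
  vbm (fun s => H s (x s) (c s)).
Proof.
move=> [mx [X hX]] [mc Cc] D0 Dh HD.
have HX s t : 0 <= s <= 1 -> 0 <= t <= 1 ->
    `|H s (x s) (c s) - H t (x t) (c t)| <=
    D X * (`|s - t| + `|x s - x t| + `|c s - c t|).
  move=> s01 t01; rewrite (le_trans (HD _ _ _ _ _ _ s01 t01 (Cc _ s01) (Cc _ t01)))//.
  by rewrite ler_wpM2r ?addr_ge0//; exact/Dh/hX.
split.
  move=> i.
  apply: (@measurable_fun_lipschitz_comp _ (1 + n + k)%N _
    (fun s => row_mx (row_mx (const_mx s) (x s)) (c s)) _ (D X * 3)) => //.
    move=> j /=; case: (split_ordP j) => j' ->; last first.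
      rewrite (_ : (fun t => _) = (fun t => c t 0 j')); first exact: mc.
      by apply/funext => t; exact: row_mxEr.
    rewrite (_ : (fun t => _) =
      (fun t => row_mx (const_mx t : 'rV_1) (x t) 0 j')); last first.
      by apply/funext => t; exact: row_mxEl.
    case: (split_ordP j') => j'' ->.
      rewrite (_ : (fun t => _) = id); first by apply: measurable_id.
      by apply/funext => t; rewrite row_mxEl mxE.
    rewrite (_ : (fun t => _) = (fun t => x t 0 j'')); first exact: mx.
    by apply/funext => t; exact: row_mxEr.
  move=> s t; rewrite /= !in_itv/= => s01 t01.
  have := rV_norm_coord (H s (x s) (c s) - H t (x t) (c t)) i.
  rewrite !mxE => h; rewrite (le_trans h)// (le_trans (HX _ _ s01 t01))//.
  rewrite -mulrA ler_wpM2l// !opp_row_mx !add_row_mx.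
  set w := row_mx (row_mx _ _) _.
  have h1 : `|s - t| <= `|w|.
    apply: le_trans (norm_row_mxl _ _); apply: le_trans (norm_row_mxl _ _).
    rewrite -norm_const_rV1 [in leRHS](_ : const_mx s + _ = const_mx (s - t))//.
    by apply/rowP => r; rewrite !mxE.
  have h2 : `|x s - x t| <= `|w|.
    by apply: le_trans (norm_row_mxl _ _); exact: norm_row_mxr.
  have h3 : `|c s - c t| <= `|w| by exact: norm_row_mxr.
  lra.
have o01 : 0 <= (0 : R) <= 1 by rewrite lexx ler01.
exists (`|H 0 (x 0) (c 0)| + D X * (1 + (X + X) + (K + K))) => t t01.
rewrite -[H t _ _](subrK (H 0 (x 0) (c 0))) addrC (le_trans (ler_normD _ _))//.
rewrite lerD2l (le_trans (HX _ _ t01 o01))// ler_wpM2l// !lerD//.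
- by rewrite subr0 ger0_norm; case/andP: t01.
- by rewrite (le_trans (ler_normB _ _))// lerD// hX.
- by rewrite (le_trans (ler_normB _ _))// lerD//; apply: (cs_bounded S); exact: Cc.
Qed.

Lemma flow_rhs_vbm c x : admissible c -> vbm x -> vbm (fun s => g s (x s) (c s)).
Proof.
move=> ac bx.
apply: (@vbm_lipschitz_comp _ _ _ _ (fun r => K * (1 + Num.max 0 r))) => //.
- by move=> r; rewrite mulr_ge0// addr_ge0// le_max lexx.
- by move=> r r' rr'; rewrite ler_pM2l// lerD2l ge_max !le_max lexx rr' orbT.
move=> *; rewrite (max_idPr _)//; exact: (cs_lip S).
Qed.

Lemma flow_rhs_lip c : admissible c -> forall s x y, 0 <= s <= 1 ->
  `|g s x (c s) - g s y (c s)| <= K * `|x - y|.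
Proof. by move=> [_ Cc] s x y s01; apply: (cs_lip_x S) => //; exact: Cc. Qed.

Lemma flow_integrable c x : admissible c -> flow c x ->
  vintegrable (fun s => g s (x s) (c s)).
Proof. by move=> ac [bx _]; exact/vbm_integrable/flow_rhs_vbm. Qed.

Lemma flow_bound c x t : admissible c -> flow c x -> 0 <= t <= 1 -> `|x t| <= state_bound.
Proof.
move=> ac fx t01; have [bx xE] := fx.
have h : forall t, 0 <= t <= 1 -> `|x t - x0| <= 2 * (K * (1 + `|x0|)) * expR (2 * K).
  apply: (@gronwall _ _ K _ x0 x (fun=> x0) _ (fun=> 0) _ _ (flow_integrable ac fx)) => //.
  - by rewrite mulr_ge0// addr_ge0.
  - exact: vintegrable_cst.
  - by move=> s /andP[s0 s1]; rewrite vint_cst// scaler0 addr0.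
  apply: aeW => s /andP[s0 /ltW s1]; have s01 : 0 <= s <= 1 by rewrite s0.
  rewrite subr0 (le_trans (cs_growth S _ s01 (ac.2 _ s01)))// -mulrDr ler_pM2l//.
  have := ler_normD (x s - x0) x0; rewrite subrK; lra.
rewrite -[x t](subrK x0) addrC (le_trans (ler_normD _ _))// lerD2l; exact: h.
Qed.

Lemma flow_lipschitz c x s t : admissible c -> flow c x -> 0 <= s <= 1 ->
  0 <= t <= 1 -> `|x s - x t| <= ball_const * `|s - t|.
Proof.
move=> ac fx s01 t01; have [bx xE] := fx.
rewrite !xE// opprD addrACA subrr add0r.
apply: vint_lipschitz => //; first exact: flow_integrable.
move=> r r01; rewrite (le_trans (cs_growth S _ r01 (ac.2 _ r01)))//.
exact/weight_le_ball_const/(flow_bound ac fx).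
Qed.

(** The variational equation along the trajectory x, in the direction p. *)
Definition sensitivity (c : R -> 'rV[R]_k) (x : R -> 'rV[R]_n) (p : R -> 'rV[R]_k) :
    (R -> 'rV[R]_n) -> Prop :=
  integral_solution
    (fun s y => y *m A s (x s) (c s) + p s *m B s (x s) (c s)) 0.

Lemma vbmD l (f h : R -> 'rV[R]_l) : vbm f -> vbm h -> vbm (fun s => f s + h s).
Proof.
move=> [mf [D1 h1]] [mh [D2 h2]]; split.
  move=> i; rewrite (_ : (fun s => _) = (fun s => f s 0 i) \+ (fun s => h s 0 i)).
    exact: measurable_funD.
  by apply/funext => s; rewrite /= mxE.
exists (D1 + D2) => t t01; rewrite (le_trans (ler_normD _ _))// lerD//.
  exact: h1.
exact: h2.
Qed.

Lemma vbm_mulmx a b (y : R -> 'rV[R]_a) (N : R -> 'M[R]_(a, b)) :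
  vbm y -> (forall v, vbm (fun s => v *m N s)) -> vbm (fun s => y s *m N s).
Proof.
move=> [my [D hD]] hN.
have NE s i j : N s i j = ((delta_mx 0 i : 'rV_a) *m N s) 0 j.
  by rewrite -rowE mxE.
split.
  move=> j; rewrite (_ : (fun s => _) = (fun s => \sum_i y s 0 i * N s i j)); last first.
    by apply/funext => s; rewrite /= mxE.
  apply: measurable_sum => i; apply: measurable_funM; first exact: my.
  rewrite (_ : (fun s => _) = (fun s => ((delta_mx 0 i : 'rV_a) *m N s) 0 j)).
    exact: (hN _).1.
  by apply/funext => s; rewrite NE.
have /choice[E hE] : forall i : 'I_a, exists E, forall t, 0 <= t <= 1 ->
    `|(delta_mx 0 i : 'rV_a) *m N t| <= E.
  by move=> i; have [_ []] := hN (delta_mx 0 i : 'rV_a) => E; exists E.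
have o01 : 0 <= (0 : R) <= 1 by rewrite lexx ler01.
have D0 : 0 <= D by exact: le_trans (hD 0 o01).
have E0 i : 0 <= E i by exact: le_trans (hE i 0 o01).
exists (\sum_i D * E i) => t t01; apply: rV_normP => [|j].
  by apply: sumr_ge0 => i _; rewrite mulr_ge0.
rewrite mxE (le_trans (ler_norm_sum _ _ _))//; apply: ler_sum => i _.
rewrite normrM ler_pM//; first exact: le_trans (rV_norm_coord _ _) (hD _ t01).
by rewrite NE (le_trans (rV_norm_coord _ _))// hE.
Qed.

Lemma linearization_vbm c x : admissible c -> vbm x ->
  (forall v, vbm (fun s => v *m A s (x s) (c s))) /\
  (forall v, vbm (fun s => v *m B s (x s) (c s))).
Proof.
move=> ac bx; split=> v.
all: apply: (@vbm_lipschitz_comp _ (fun t x c => v *m _ t x c) _ _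
  (fun r => K * (1 + Num.max 0 r) * `|v|)) => //.
- by move=> r; rewrite !mulr_ge0// addr_ge0// le_max lexx.
- by move=> r r' rr'; rewrite ler_wpM2r// ler_pM2l// lerD2l ge_max !le_max lexx rr' orbT.
- by move=> *; rewrite (max_idPr _)// mulrAC; exact: (cs_lipA S).
- by move=> r; rewrite !mulr_ge0// addr_ge0// le_max lexx.
- by move=> r r' rr'; rewrite ler_wpM2r// ler_pM2l// lerD2l ge_max !le_max lexx rr' orbT.
- by move=> *; rewrite (max_idPr _)// mulrAC; exact: (cs_lipB S).
Qed.

Section Along.
Variables (c : R -> 'rV[R]_k) (x : R -> 'rV[R]_n).
Hypotheses (ac : admissible c) (fx : flow c x).
Variable p : R -> 'rV[R]_k.
Hypotheses (bp : vbm p) (pK : forall t, 0 <= t <= 1 -> `|p t| <= 2 * K).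

Let xr t : 0 <= t <= 1 -> `|x t| <= state_bound. Proof. exact: flow_bound ac fx. Qed.

Lemma along_A (v : 'rV_n) t : 0 <= t <= 1 -> `|v *m A t (x t) (c t)| <= ball_const * `|v|.
Proof.
move=> t01; rewrite (le_trans (cs_A S _ _ t01 (ac.2 _ t01)))// ler_wpM2r//.
exact/weight_le_ball_const/xr.
Qed.

Lemma along_B (v : 'rV_k) t : 0 <= t <= 1 -> `|v *m B t (x t) (c t)| <= ball_const * `|v|.
Proof.
move=> t01; rewrite (le_trans (cs_B S _ _ t01 (ac.2 _ t01)))// ler_wpM2r//.
exact/weight_le_ball_const/xr.
Qed.

Lemma sensitivity_rhs_vbm y : vbm y ->
  vbm (fun s => y s *m A s (x s) (c s) + p s *m B s (x s) (c s)).
Proof.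
have [hA hB] := linearization_vbm ac fx.1.
by move=> ?; apply: vbmD; apply: vbm_mulmx.
Qed.

Lemma sensitivity_exists : exists y, sensitivity c x p y.
Proof.
have [s v w s01|w|y h1 h2] := @picard _ _
  (fun s y => y *m A s (x s) (c s) + p s *m B s (x s) (c s)) ball_const 0 ball_const_gt0.
- by rewrite opprD addrACA subrr addr0 -mulmxBl; exact: along_A.
- exact: sensitivity_rhs_vbm.
by exists y.
Qed.

Variable y : R -> 'rV[R]_n.
Hypothesis sy : sensitivity c x p y.

Lemma sensitivity_integrable :
  vintegrable (fun s => y s *m A s (x s) (c s) + p s *m B s (x s) (c s)).
Proof. exact/vbm_integrable/sensitivity_rhs_vbm/sy.1. Qed.

Lemma sensitivity_rhs_le t : 0 <= t <= 1 ->
  `|y t *m A t (x t) (c t) + p t *m B t (x t) (c t)| <= ball_const * `|y t| + 2 * K * ball_const.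
Proof.
move=> t01; rewrite (le_trans (ler_normD _ _))// lerD ?along_A//.
by rewrite (le_trans (along_B _ t01))// mulrC ler_wpM2r// pK.
Qed.

Lemma sensitivity_bound t : 0 <= t <= 1 -> `|y t| <= sens_bound.
Proof.
move=> t01; have [by_ yE] := sy.
rewrite -[y t]subr0; move: t t01.
apply: (@gronwall _ _ ball_const _ 0 y (fun=> 0) _ (fun=> 0) ball_const_gt0 _ sensitivity_integrable) => //.
- exact: vintegrable_cst.
- by move=> s /andP[s0 s1]; rewrite vint_cst// scaler0 addr0.
apply: aeW => s /andP[s0 /ltW s1]; rewrite !subr0.
by apply: sensitivity_rhs_le; rewrite s0.
Qed.

Lemma sensitivity_lipschitz s t : 0 <= s <= 1 -> 0 <= t <= 1 ->
  `|y s - y t| <= sens_lip * `|s - t|.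
Proof.
move=> s01 t01; have [by_ yE] := sy; rewrite !yE// !add0r.
apply: vint_lipschitz => //; first exact: sensitivity_integrable.
  exact: sens_lip_ge0.
move=> r r01; rewrite (le_trans (sensitivity_rhs_le r01))// lerD2r ler_wpM2l//.
exact: sensitivity_bound.
Qed.

(** The sensitivity is the derivative of the trajectory with respect to the control,
with a quadratic remainder: two Gronwall estimates, of first and of second order. *)
Lemma flow_expansion : exists D, forall l z, 0 <= l <= 1 ->
  admissible (fun s => c s + l *: p s) -> flow (fun s => c s + l *: p s) z ->
  forall t, 0 <= t <= 1 -> `|z t - (x t + l *: y t)| <= D * l ^+ 2.
Proof.
pose D1 := 2 * (ball_const * (2 * K)) * expR (2 * ball_const).
pose D2 := K * (D1 + 2 * K) ^+ 2.
exists (2 * D2 * expR (2 * ball_const)) => l z /andP[l0 l1] acl fz.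
have iz := flow_integrable acl fz; have ix := flow_integrable ac fx.
have lp s : 0 <= s <= 1 -> `|l *: p s| <= l * (2 * K).
  by move=> s01; rewrite normrZ ger0_norm// ler_wpM2l// pK.
have first t : 0 <= t <= 1 -> `|z t - x t| <= D1 * l.
  have -> : D1 * l = 2 * (ball_const * (l * (2 * K))) * expR (2 * ball_const) by rewrite /D1; ring.
  move: t; apply: (@gronwall _ _ ball_const _ x0 z x _ _ ball_const_gt0 _ iz ix _ fx.2).
  - exact: mulr_ge0 ball_const_ge0 (mulr_ge0 l0 K2_ge0).
  - exact: fz.2.
  apply: aeW => s /andP[s0 /ltW s1]; have s01 : 0 <= s <= 1 by rewrite s0.
  rewrite -(subrKA (g s (x s) (c s + l *: p s))) (le_trans (ler_normD _ _))// lerD//.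
    rewrite (le_trans (cs_lip_x S _ _ s01 (acl.2 _ s01)))// ler_wpM2r// le_ball_const//.
  rewrite (le_trans (cs_lip S _ _ s01 s01 (acl.2 _ s01) (ac.2 _ s01)))//.
  rewrite !subrr !normr0 !add0r addrAC subrr add0r.
  apply: ler_pM; rewrite ?mulr_ge0 ?addr_ge0//; last exact: lp.
  exact/weight_le_ball_const/xr.
have -> : 2 * D2 * expR (2 * ball_const) * l ^+ 2 = 2 * (D2 * l ^+ 2) * expR (2 * ball_const) by ring.
have isy := sensitivity_integrable.
apply: (@gronwall _ _ ball_const _ x0 z (fun t => x t + l *: y t) _ _ ball_const_gt0 _ iz
  (vintegrableD ix (vintegrableZ l isy))).
- by rewrite mulr_ge0 ?sqr_ge0// mulr_ge0 ?sqr_ge0.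
- exact: fz.2.
- move=> t /[dup] t01 /andP[t0 t1]; rewrite vintD//; last exact: vintegrableZ.
  by rewrite vintZ// fx.2// sy.2// add0r addrA.
apply: aeW => s /andP[s0 /ltW s1]; have s01 : 0 <= s <= 1 by rewrite s0.
have := cs_taylor S (x s) (z s) s01 (ac.2 _ s01) (acl.2 _ s01).
rewrite (addrC (c s)) addrK => T.
set a := g s (z s) _ in T *; set b := g s (x s) _ in T *.
have -> : a - (b + l *: (y s *m A s (x s) (c s) + p s *m B s (x s) (c s))) =
   (z s - (x s + l *: y s)) *m A s (x s) (c s) +
   (a - b - ((z s - x s) *m A s (x s) (c s) + (l *: p s) *m B s (x s) (c s))).
  rewrite !mulmxBl !mulmxDl -!scalemxAl scalerDr.
  by apply/rowP => i; rewrite !mxE; ring.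
rewrite (le_trans (ler_normD _ _))// lerD ?along_A//.
rewrite (le_trans T)// /D2 -mulrA -exprMn ler_pM2l//.
have h : `|z s - x s| + `|l *: p s| <= (D1 + 2 * K) * l.
  by rewrite mulrDl; apply: lerD; [exact: first|rewrite [leRHS]mulrC; exact: lp].
have h0 : 0 <= `|z s - x s| + `|l *: p s| by rewrite addr_ge0.
by apply: lerXn2r => //; rewrite nnegrE// (le_trans h0 h).
Qed.

End Along.
End Flow.

(** * The Euler scheme *)

Section Grid.
Variables (R : realType) (tau : seq R) (N : nat).
Hypothesis gtau : grid N tau.
Notation T := (size tau).-1.
Notation h := (2 ^- N : R).

Lemma grid_step k : (k < T)%N -> tau`_k <= tau`_k.+1.
Proof. by case: gtau => _ _ + _; exact. Qed.

Lemma grid_mesh k : (k < T)%N -> tau`_k.+1 - tau`_k <= h.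
Proof. by case: gtau => _ _ _ H kT; exact: le_trans (ler_norm _) (H _ kT). Qed.

Lemma grid_mono i j : (i <= j)%N -> (j <= T)%N -> tau`_i <= tau`_j.
Proof.
move=> ij jT; elim: j ij jT => [|j IH]; first by rewrite leqn0 => /eqP ->.
rewrite leq_eqVlt => /predU1P[->//|ij] jT.
exact: le_trans (IH ij (ltnW jT)) (grid_step jT).
Qed.

Lemma grid_in01 k : (k <= T)%N -> 0 <= tau`_k <= 1.
Proof.
move=> kT; case: (gtau) => t0 t1 _ _; apply/andP; split.
  by rewrite -[leLHS]t0; exact: grid_mono.
by rewrite -[leRHS]t1; exact: grid_mono.
Qed.

Lemma mesh_ge0 : 0 <= h.
Proof. by rewrite invr_ge0 exprn_ge0. Qed.

Lemma grid_near t : 0 <= t <= 1 -> exists2 k, (k <= T)%N & `|t - tau`_k| <= h.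
Proof.
move=> /andP[t0 t1].
have H j : (j <= T)%N -> t <= tau`_j -> exists2 k, (k <= T)%N & `|t - tau`_k| <= h.
  elim: j => [|j IH] jT tj.
    exists 0%N => //; case: gtau => e0 _ _ _; rewrite e0 in tj *.
    have -> : t = 0 by apply/eqP; rewrite eq_le tj.
    by rewrite subrr normr0 mesh_ge0.
  have [tj'|tj'] := leP t tau`_j; first exact: IH (ltnW jT) tj'.
  exists j; first exact: ltnW.
  rewrite ger0_norm ?subr_ge0 ?(ltW tj')//.
  by apply: le_trans (grid_mesh jT); rewrite lerD2r.
by apply: (H T) => //; case: gtau => _ -> _ _.
Qed.

(** The bound proved by induction carries the factor tau_k, which makes it vanish at the
start; one step is absorbed by 1 + Md <= exp(Md). *)
Lemma discrete_gronwall (e : nat -> R) (M b : R) : 0 <= M -> 0 <= b ->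
  e 0%N <= 0 ->
  (forall k, (k < T)%N -> e k.+1 <= e k + (tau`_k.+1 - tau`_k) * (M * e k + b)) ->
  forall k, (k <= T)%N -> e k <= b * expR M.
Proof.
move=> M0 b0 e0 eS.
have H k : (k <= T)%N -> e k <= b * tau`_k * expR (M * tau`_k).
  elim: k => [|k IH] kT.
    by case: gtau => -> _ _ _; rewrite mulr0 mul0r.
  rewrite (le_trans (eS _ kT))//.
  set d := tau`_k.+1 - tau`_k.
  have d0 : 0 <= d by rewrite subr_ge0 grid_step.
  have dE : tau`_k.+1 = tau`_k + d by rewrite addrC subrK.
  have [tk0 _] := andP (grid_in01 (ltnW kT)).
  have E1 : 1 + M * d <= expR (M * d) by exact: expR_ge1Dx.
  have Md0 : 0 <= M * d by rewrite mulr_ge0.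
  rewrite dE [M * (_ + _)]mulrDr expRD.
  have := IH (ltnW kT); set E := expR (M * tau`_k); set t := tau`_k in tk0 * => IHk.
  set E' := expR _ in E1 *.
  have EE1 : 1 <= E by rewrite -expR0 ler_expR mulr_ge0.
  have h1 : (1 + M * d) * e k <= (1 + M * d) * (b * t * E).
    by rewrite ler_wpM2l// addr_ge0.
  have h2 : (1 + M * d) * (b * t * E) <= E' * (b * t * E).
    by rewrite ler_wpM2r// !mulr_ge0// (le_trans ler01).
  have h3 : d * b <= d * b * (E * E').
    rewrite ler_peMr ?mulr_ge0// -[leLHS]mulr1 ler_pM//.
    by apply: le_trans E1; rewrite lerDl.
  have -> : e k + d * (M * e k + b) = (1 + M * d) * e k + d * b by ring.
  have -> : b * (t + d) * (E * E') = E' * (b * t * E) + d * b * (E * E') by ring.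
  by rewrite lerD// (le_trans h1).
move=> k kT; have /andP[t0 t1] := grid_in01 kT.
rewrite (le_trans (H k kT))// ler_pM ?mulr_ge0 ?expR_ge0// ?ler_piMr//.
by rewrite ler_expR ler_piMr.
Qed.

End Grid.

Section Euler.
Variables (R : realType) (n k : nat) (C : set 'rV[R]_k).
Variables (g : R -> 'rV[R]_n -> 'rV[R]_k -> 'rV[R]_n).
Variables (A : R -> 'rV[R]_n -> 'rV[R]_k -> 'M[R]_n).
Variables (B : R -> 'rV[R]_n -> 'rV[R]_k -> 'M[R]_(k, n)) (K : R).
Hypothesis S : control_system C g A B K.
Variable x0 : 'rV[R]_n.
Variables (tau : seq R) (N : nat).
Hypothesis gtau : grid N tau.
Notation T := (size tau).-1.
Notation h := (2 ^- N : R).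
Notation state_bound := (state_bound K x0).
Notation ball_const := (ball_const K x0).
Notation sens_bound := (sens_bound K x0).
Notation sens_lip := (sens_lip K x0).

Let K_gt0 : 0 < K := cs_gt0 S.
Let K_ge0 : 0 <= K := ltW K_gt0.
Let ball_const_ge0 : 0 <= ball_const := ltW (ball_const_gt0 S x0).
Let h_ge0 : 0 <= h := mesh_ge0 R N.

Fixpoint eul (c : R -> 'rV[R]_k) (i : nat) : 'rV[R]_n :=
  if i is i'.+1 then
    eul c i' + (tau`_i - tau`_i') *: g tau`_i' (eul c i') (c tau`_i')
  else x0.

Fixpoint eul_sens (c p : R -> 'rV[R]_k) (i : nat) : 'rV[R]_n :=
  if i is i'.+1 then
    eul_sens c p i' + (tau`_i - tau`_i') *:
      (eul_sens c p i' *m A tau`_i' (eul c i') (c tau`_i') +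
       p tau`_i' *m B tau`_i' (eul c i') (c tau`_i'))
  else 0.

Lemma eul_bound c i : (forall t, 0 <= t <= 1 -> C (c t)) -> (i <= T)%N ->
  `|eul c i| <= state_bound.
Proof.
move=> Cc iT.
have b0 : 0 <= K * (1 + `|x0|) by rewrite mulr_ge0// addr_ge0.
have : `|eul c i - x0| <= K * (1 + `|x0|) * expR K.
  move: i iT; apply: (discrete_gronwall gtau) => //.
    by rewrite /= subrr normr0.
  move=> i iT; rewrite /= addrAC (le_trans (ler_normD _ _))// lerD2l normrZ.
  have d0 : 0 <= tau`_i.+1 - tau`_i by rewrite subr_ge0 (grid_step gtau).
  rewrite ger0_norm// ler_wpM2l//.
  have t01 := grid_in01 gtau (ltnW iT).
  rewrite (le_trans (cs_growth S _ t01 (Cc _ t01)))// -mulrDr ler_pM2l//.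
  have := ler_normD (eul c i - x0) x0; rewrite subrK; lra.
move=> H; rewrite -[eul c i](subrK x0) addrC (le_trans (ler_normD _ _))//.
rewrite /state_bound lerD2l (le_trans H)//.
rewrite -[leLHS]mul1r -[leRHS]mulrA ler_pM ?mulr_ge0 ?expR_ge0 ?ler1n//.
by rewrite ler_wpM2l// ler_expR ler_peMl ?ler1n.
Qed.

Section Differentiation.
Variables (c p : R -> 'rV[R]_k).
Hypothesis Cc : forall t, 0 <= t <= 1 -> C (c t).
Hypothesis pK : forall t, 0 <= t <= 1 -> `|p t| <= 2 * K.

Lemma eul_A (v : 'rV_n) i : (i <= T)%N ->
  `|v *m A tau`_i (eul c i) (c tau`_i)| <= ball_const * `|v|.
Proof.
move=> iT; have t01 := grid_in01 gtau iT.
rewrite (le_trans (cs_A S _ _ t01 (Cc t01)))// ler_wpM2r//.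
exact/(weight_le_ball_const S)/eul_bound.
Qed.

Lemma eul_B (v : 'rV_k) i : (i <= T)%N ->
  `|v *m B tau`_i (eul c i) (c tau`_i)| <= ball_const * `|v|.
Proof.
move=> iT; have t01 := grid_in01 gtau iT.
rewrite (le_trans (cs_B S _ _ t01 (Cc t01)))// ler_wpM2r//.
exact/(weight_le_ball_const S)/eul_bound.
Qed.

Lemma eul_sens_bound i : (i <= T)%N -> `|eul_sens c p i| <= sens_bound.
Proof.
move=> iT.
have b0 : 0 <= 2 * K * ball_const by apply: mulr_ge0 => //; rewrite mulr_ge0.
have H : `|eul_sens c p i| <= 2 * K * ball_const * expR ball_const.
  move: i iT; apply: (discrete_gronwall gtau) => //.
    by rewrite /= normr0.
  move=> i iT; rewrite /= (le_trans (ler_normD _ _))// lerD2l normrZ.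
  have d0 : 0 <= tau`_i.+1 - tau`_i by rewrite subr_ge0 (grid_step gtau).
  rewrite ger0_norm// ler_wpM2l// (le_trans (ler_normD _ _))//.
  apply: lerD; first exact: eul_A (ltnW iT).
  rewrite (le_trans (eul_B _ (ltnW iT)))// mulrC ler_wpM2r//.
  by apply: pK; exact: (grid_in01 gtau (ltnW iT)).
rewrite (le_trans H)// /sens_bound -[leLHS]mul1r -[leRHS]mulrA.
rewrite ler_pM ?(mulr_ge0 b0) ?expR_ge0 ?ler1n//.
by rewrite ler_wpM2l// ler_expR ler_peMl ?ler1n.
Qed.

(** The constants may depend on the grid: only the limit of the difference quotient is
needed here. *)
Lemma eul_expansion i : (i <= T)%N -> exists2 D, 0 <= D & forall l, 0 <= l <= 1 ->
  (forall t, 0 <= t <= 1 -> C (c t + l *: p t)) ->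
  `|eul (fun s => c s + l *: p s) i - (eul c i + l *: eul_sens c p i)| <= D * l ^+ 2.
Proof.
elim: i => [|i IH] iT.
  by exists 0 => // l _ _; rewrite /= scaler0 addr0 subrr normr0 mul0r.
have [D D0 hD] := IH (ltnW iT).
pose Y := `|eul_sens c p i|.
exists (D + (K * (D + Y + 2 * K) ^+ 2 + ball_const * D)).
  rewrite addr_ge0// addr_ge0//; first by rewrite mulr_ge0// sqr_ge0.
  exact: mulr_ge0.
move=> l /[dup] l01 /andP[l0 l1] Cl; have := hD l l01 Cl.
have t01 := grid_in01 gtau (ltnW iT).
rewrite /=; set z := eul (fun s => _) i; set x := eul c i; set y := eul_sens c p i in Y *.
set t := tau`_i in t01 *; set d := _ - t => zxy.
have d0 : 0 <= d by rewrite subr_ge0 (grid_step gtau).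
have d1 : d <= 1.
  have /andP[_ ?] := grid_in01 gtau iT; have /andP[? _] := t01.
  by rewrite /d; lra.
have Tay := cs_taylor S x z t01 (Cc t01) (Cl t t01).
rewrite (addrC (c t)) addrK in Tay.
set r := _ - (_ + _) in Tay.
have -> : z + d *: g t z (c t + l *: p t) - (x + d *: g t x (c t) +
    l *: (y + d *: (y *m A t x (c t) + p t *m B t x (c t)))) =
    (z - (x + l *: y)) + d *: (r + (z - (x + l *: y)) *m A t x (c t)).
  rewrite /r [l *: p t + c t]addrC !mulmxBl !mulmxDl -!scalemxAl.
  by apply/rowP => j; rewrite !mxE; ring.
rewrite (le_trans (ler_normD _ _))// mulrDl lerD// normrZ ger0_norm//.
rewrite (@le_trans _ _ `|r + (z - (x + l *: y)) *m A t x (c t)|)//.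
  by rewrite ler_piMl.
rewrite (le_trans (ler_normD _ _))// mulrDl lerD//; last first.
  by rewrite (le_trans (eul_A _ (ltnW iT)))// -[leRHS]mulrA ler_wpM2l.
rewrite (le_trans Tay)// -[leRHS]mulrA -exprMn ler_pM2l//.
have H : `|z - x| + `|l *: p t| <= (D + Y + 2 * K) * l.
  rewrite mulrDl lerD//.
    have -> : z - x = (z - (x + l *: y)) + l *: y by rewrite opprD addrA subrK.
    rewrite (le_trans (ler_normD _ _))// mulrDl lerD//.
      rewrite (le_trans zxy)// ler_wpM2l// expr2 ler_piMr//.
    by rewrite normrZ ger0_norm// mulrC.
  by rewrite normrZ ger0_norm// mulrC ler_wpM2r// pK.
have h0 : 0 <= `|z - x| + `|l *: p t| by rewrite addr_ge0.
by apply: lerXn2r => //; rewrite nnegrE// (le_trans h0 H).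
Qed.

End Differentiation.

Definition euler_rate : R := ball_const * (1 + ball_const) * expR ball_const.
Definition sens_rate : R :=
  (ball_const * sens_lip + ball_const * (1 + ball_const + euler_rate) * (sens_bound + 2 * K) + ball_const) * expR ball_const.

Lemma euler_rate_ge0 : 0 <= euler_rate.
Proof.
rewrite /euler_rate; move: ball_const ball_const_ge0 => M M0.
by rewrite !mulr_ge0 ?expR_ge0// addr_ge0.
Qed.

Lemma sens_rate_ge0 : 0 <= sens_rate.
Proof.
rewrite /sens_rate; move: ball_const ball_const_ge0 sens_lip (sens_lip_ge0 S x0) sens_bound (sens_bound_ge0 S x0).
move: euler_rate euler_rate_ge0.
move=> cx cx0 M M0 yl yl0 ys ys0.
by rewrite mulr_ge0 ?expR_ge0// !addr_ge0 ?mulr_ge0 ?addr_ge0 ?mulr_ge0.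
Qed.

Section Consistency.
Variables (c : R -> 'rV[R]_k) (x : R -> 'rV[R]_n).
Hypotheses (ac : admissible C c) (fx : flow g x0 c x).
Hypothesis pc : forall i, (i < T)%N -> forall s, tau`_i <= s < tau`_i.+1 ->
  c s = c tau`_i.

Lemma cell_in01 i s : (i < T)%N -> tau`_i <= s < tau`_i.+1 -> 0 <= s <= 1.
Proof.
move=> iT /andP[h1 h2]; have /andP[a0 _] := grid_in01 gtau (ltnW iT).
have /andP[_ b1] := grid_in01 gtau iT.
by rewrite (le_trans a0 h1) (le_trans (ltW h2) b1).
Qed.

Lemma cell_dist i s : (i < T)%N -> tau`_i <= s < tau`_i.+1 -> `|s - tau`_i| <= h.
Proof.
move=> iT /andP[h1 h2]; rewrite ger0_norm ?subr_ge0//.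
apply: le_trans (grid_mesh gtau iT); rewrite lerD2r; exact: ltW.
Qed.

Lemma cell_state i s : (i < T)%N -> tau`_i <= s < tau`_i.+1 ->
  `|x s - eul c i| <= ball_const * h + `|x tau`_i - eul c i|.
Proof.
move=> iT hs; rewrite -[x s - _](subrKA (x tau`_i)) (le_trans (ler_normD _ _))//.
rewrite lerD2r (le_trans (flow_lipschitz S ac fx (cell_in01 iT hs)
  (grid_in01 gtau (ltnW iT))))// ler_wpM2l//; exact: cell_dist.
Qed.

(** Global error of the Euler scheme. The control is constant on each cell, so that the
integrand is Lipschitz there although it jumps from cell to cell. *)
Lemma euler_error i : (i <= T)%N -> `|x tau`_i - eul c i| <= euler_rate * h.
Proof.
move: i.
have -> : euler_rate * h = ball_const * (1 + ball_const) * h * expR ball_const by rewrite /euler_rate; ring.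
apply: (discrete_gronwall gtau) => //.
- by apply: mulr_ge0 => //; apply: mulr_ge0 => //; exact: addr_ge0.
- case: (gtau) => -> _ _ _; rewrite (fx.2 0) ?lexx ?ler01//.
  by rewrite vintxx addr0 subrr normr0.
move=> i iT.
have /andP[a0 a1] := grid_in01 gtau (ltnW iT).
have /andP[b0 b1] := grid_in01 gtau iT.
have ab := grid_step gtau iT.
have ig := flow_integrable S ac fx.
set a := tau`_i in a0 a1 ab *; set b := tau`_i.+1 in b0 b1 ab *.
have xab : x b = x a + vint a b (fun s => g s (x s) (c s)).
  by rewrite fx.2 ?b0// (@vint_chasles _ _ _ a b)// addrA -fx.2// a0.
pose G := fun _ : R => g a (eul c i) (c a).
rewrite xab /= -/a -/b -(vint_cst _ ab) -/G.
have -> : x a + vint a b (fun s => g s (x s) (c s)) - (eul c i + vint a b G) =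
   (x a - eul c i) + vint a b (fun s => g s (x s) (c s) - G s).
  rewrite vintB//; last exact: vintegrable_cst.
  by apply/rowP => j; rewrite !mxE; ring.
rewrite (le_trans (ler_normD _ _))// lerD2l.
apply: vint_norm_le_cst => //.
- apply: vintegrableB => //; exact: vintegrable_cst.
- apply: addr_ge0; first exact: mulr_ge0.
  by apply: mulr_ge0 => //; apply: mulr_ge0 => //; exact: addr_ge0.
move=> s hs; have s01 := cell_in01 iT hs.
rewrite /G (pc iT hs) -/a.
have a01 : 0 <= a <= 1 by rewrite a0.
rewrite (le_trans (cs_lip S _ _ s01 a01 (ac.2 _ a01) (ac.2 _ a01)))//.
rewrite subrr normr0 addr0.
rewrite (@le_trans _ _ (ball_const * (h + (ball_const * h + `|x a - eul c i|))))//.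
  apply: ler_pM; rewrite ?mulr_ge0 ?addr_ge0//.
    exact/(weight_le_ball_const S)/(flow_bound S ac fx s01).
  by apply: lerD; [exact: cell_dist|exact: cell_state].
by rewrite [leRHS](_ : _ = ball_const * (h + (ball_const * h + `|x a - eul c i|)))//; ring.
Qed.

Variables (p p' : R -> 'rV[R]_k) (y : R -> 'rV[R]_n) (e : R).
Hypotheses (bp : vbm p) (pK : forall t, 0 <= t <= 1 -> `|p t| <= 2 * K).
Hypothesis sy : sensitivity A B c x p y.
Hypothesis e0 : 0 <= e.

(** The linearized equation is driven by p only through its integrals over the cells,
up to the mesh. So the discrete scheme may be driven by any p' with nearly the same cell
averages: this is what lets piecewise constant directions compete with all of them,
without any bound on the variation of p. *)
Hypothesis pp' : forall i, (i < T)%N ->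
  `|vint tau`_i tau`_i.+1 p - (tau`_i.+1 - tau`_i) *: p' tau`_i|
    <= (tau`_i.+1 - tau`_i) * e.

Lemma euler_sensitivity_error i : (i <= T)%N ->
  `|y tau`_i - eul_sens c p' i| <= sens_rate * (h + e).
Proof.
pose C1 := ball_const * sens_lip + ball_const * (1 + ball_const + euler_rate) * (sens_bound + 2 * K).
have C10 : 0 <= C1.
  have [? ? ?] := And3 (sens_lip_ge0 S x0) (sens_bound_ge0 S x0) euler_rate_ge0.
  apply: addr_ge0; first exact: mulr_ge0.
  by apply: mulr_ge0; [apply: mulr_ge0 => //; rewrite !addr_ge0|rewrite addr_ge0// mulr_ge0].
have he0 : 0 <= h + e by rewrite addr_ge0.
move: i.
have -> : sens_rate * (h + e) = (C1 + ball_const) * (h + e) * expR ball_const.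
  by rewrite /sens_rate -/C1; ring.
apply: (discrete_gronwall gtau) => //.
- by apply: mulr_ge0 => //; exact: addr_ge0.
- case: (gtau) => -> _ _ _; rewrite (sy.2 0) ?lexx ?ler01//.
  by rewrite vintxx addr0 subrr normr0.
move=> i iT.
have a01 := grid_in01 gtau (ltnW iT).
have b01 := grid_in01 gtau iT.
have /andP[a0 a1] := a01; have /andP[b0 b1] := b01.
have ab := grid_step gtau iT.
have iy := sensitivity_integrable S ac fx bp sy.
have ip := vbm_integrable bp.
have er := euler_error (ltnW iT).
have := pp' iT; set a := tau`_i in a0 a1 a01 ab er *; set b := tau`_i.+1 in b0 b1 b01 ab *.
move=> ppi.
have yab : y b = y a + vint a b (fun s => y s *m A s (x s) (c s) + p s *m B s (x s) (c s)).
  by rewrite sy.2// (@vint_chasles _ _ _ a b)// addrA -sy.2// a0.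
rewrite yab /= -/a -/b.
set z := eul c i in er *; set Y := eul_sens c p' i.
set Ai := A a z (c a); set Bi := B a z (c a).
have iG : vintegrable (fun s => Y *m Ai + p s *m Bi).
  by apply: vintegrableD; [exact: vintegrable_cst|exact: vintegrable_mulmx].
have -> : y a + vint a b (fun s => y s *m A s (x s) (c s) + p s *m B s (x s) (c s)) -
    (Y + (b - a) *: (Y *m Ai + p' a *m Bi)) =
    (y a - Y) + (vint a b (fun s => y s *m A s (x s) (c s) + p s *m B s (x s) (c s) -
       (Y *m Ai + p s *m Bi)) + (vint a b p - (b - a) *: p' a) *m Bi).
  rewrite vintB// [vint a b (fun s => Y *m Ai + _)]vintD//;
    [|exact: vintegrable_cst|exact: vintegrable_mulmx].
  rewrite vint_cst// vint_mulmx// mulmxBl -scalemxAl.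
  by apply/rowP => j; rewrite !mxE; ring.
rewrite (le_trans (ler_normD _ _))// lerD2l (le_trans (ler_normD _ _))//.
have -> : (b - a) * (ball_const * `|y a - Y| + (C1 + ball_const) * (h + e)) =
    (b - a) * (ball_const * `|y a - Y| + (C1 * h + (C1 * e + ball_const * h))) +
    (b - a) * (ball_const * e) by ring.
apply: lerD; last first.
  rewrite (le_trans (eul_B ac.2 _ (ltnW iT)))// mulrCA ler_wpM2l//.
apply: vint_norm_le_cst => //.
- exact: vintegrableB.
- apply: addr_ge0; [exact: mulr_ge0|apply: addr_ge0; first exact: mulr_ge0].
  by apply: addr_ge0; exact: mulr_ge0.
move=> s hs; have s01 := cell_in01 iT hs.
have xs : `|x s - z| <= ball_const * h + euler_rate * h.
  by rewrite (le_trans (cell_state iT hs))// lerD2l.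
have ys : `|y s - Y| <= sens_lip * h + `|y a - Y|.
  rewrite -[y s - _](subrKA (y a)) (le_trans (ler_normD _ _))//.
  rewrite lerD2r (le_trans (sensitivity_lipschitz S ac fx bp pK sy s01 a01))//.
  rewrite ler_wpM2l ?(sens_lip_ge0 S x0)//; exact: cell_dist.
have wM : K * (1 + `|x s|) <= ball_const by exact/(weight_le_ball_const S)/(flow_bound S ac fx s01).
have lip : K * (1 + `|x s|) * (`|s - a| + `|x s - z| + `|c s - c a|) <=
    ball_const * (1 + ball_const + euler_rate) * h.
  rewrite (pc iT hs) -/a subrr normr0 addr0 -[leRHS]mulrA; apply: ler_pM => //.
    by rewrite mulr_ge0// addr_ge0.
  rewrite !mulrDl mul1r -[leRHS]addrA lerD//; exact: cell_dist.
have -> : y s *m A s (x s) (c s) + p s *m B s (x s) (c s) - (Y *m Ai + p s *m Bi) =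
    (y s - Y) *m Ai + ((y s *m A s (x s) (c s) - y s *m Ai) +
    (p s *m B s (x s) (c s) - p s *m Bi)).
  by rewrite mulmxBl; apply/rowP => j; rewrite !mxE; ring.
rewrite (le_trans (ler_normD _ _))//.
have h1 : `|(y s - Y) *m Ai| <= ball_const * (sens_lip * h + `|y a - Y|).
  by rewrite (le_trans (eul_A ac.2 _ (ltnW iT)))// ler_wpM2l.
have L0 : 0 <= ball_const * (1 + ball_const + euler_rate) * h.
  by apply: mulr_ge0 => //; apply: mulr_ge0 => //; rewrite !addr_ge0// euler_rate_ge0.
have h2 : `|y s *m A s (x s) (c s) - y s *m Ai| <= ball_const * (1 + ball_const + euler_rate) * h * sens_bound.
  rewrite (le_trans (cs_lipA S _ _ _ s01 a01 (ac.2 _ s01) (ac.2 _ a01)))//.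
  apply: ler_pM => //.
    by rewrite mulr_ge0 ?addr_ge0// mulr_ge0// addr_ge0.
  exact: (sensitivity_bound S ac fx bp pK sy s01).
have h3 : `|p s *m B s (x s) (c s) - p s *m Bi| <= ball_const * (1 + ball_const + euler_rate) * h * (2 * K).
  rewrite (le_trans (cs_lipB S _ _ _ s01 a01 (ac.2 _ s01) (ac.2 _ a01)))//.
  apply: ler_pM => //; last exact: pK.
  by rewrite mulr_ge0 ?addr_ge0// mulr_ge0// addr_ge0.
have h4 := ler_normD (y s *m A s (x s) (c s) - y s *m Ai)
  (p s *m B s (x s) (c s) - p s *m Bi).
have h5 : 0 <= C1 * e + ball_const * h by apply: addr_ge0; exact: mulr_ge0.
have C1E : C1 * h = ball_const * (sens_lip * h) + ball_const * (1 + ball_const + euler_rate) * h * sens_bound +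
  ball_const * (1 + ball_const + euler_rate) * h * (2 * K) by rewrite /C1; ring.
rewrite mulrDr in h1; lra.
Qed.

End Consistency.
End Euler.

(** * The switched system as a control system *)

Section ConvexAndMeanValue.
Variable R : realType.

(** Convexity in the form used along increments; it is applied to U and to the simplex
of relaxed mode weights. *)
Definition segment_closed k (U : set 'rV[R]_k) : Prop :=
  forall u v s, U u -> U v -> 0 <= s <= 1 -> U (u + s *: (v - u)).

Lemma convex_segment_closed k (U : set 'rV[R]_k) :
  convex_set U -> segment_closed U.
Proof.
move=> cU u v s Uu Uv /andP[s0 s1].
have := cU v u (Itv01 s0 s1) (mem_set Uv) (mem_set Uu).
move=> /set_mem; congr U.
rewrite /conv/= /unstable.onem scalerBl scale1r scalerBr.
by rewrite addrCA addrA.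
Qed.

Lemma simplex_segment_closed q : segment_closed (@simplex_r R q).
Proof.
move=> u v s [u01 u1] [v01 v1] /andP[s0 s1]; split.
  move=> i; rewrite !mxE; have /andP[a0 a1] := u01 i; have /andP[b0 b1] := v01 i.
  have -> : u 0 i + s * (v 0 i - u 0 i) = (1 - s) * u 0 i + s * v 0 i by ring.
  apply/andP; split; first by rewrite addr_ge0// mulr_ge0// subr_ge0.
  rewrite -[leRHS](subrK s) lerD// ?ler_piMr// subr_ge0//.
under eq_bigr do rewrite !mxE.
by rewrite big_split/= -mulr_sumr sumrB u1 v1 subrr mulr0 addr0.
Qed.

(** The mean value theorem along a segment, coordinate by coordinate: the intermediate
point depends on the coordinate, which is harmless for Lipschitz Jacobians. *)
Lemma mean_value a b (phi : 'rV[R]_a -> 'rV[R]_b) (x v : 'rV[R]_a) (j : 'I_b) :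
  (forall y, differentiable phi y) ->
  exists2 s, 0 <= s <= 1 &
    (phi (x + v) - phi x) 0 j = (v *m 'J phi (x + s *: v)) 0 j.
Proof.
move=> dphi.
pose psi (s : R) := phi (x + s *: v) 0 j.
have dpsi (s : R) : is_derive s 1 psi ((v *m 'J phi (x + s *: v)) 0 j).
  have dseg : is_diff s (fun s : R => x + s *: v) (fun s : R => s *: v).
    have -> : (fun s : R => s *: v) = (cst 0 : R -> 'rV[R]_a) + ( *:%R ^~ v).
      by apply/funext => r /=; rewrite add0r.
    exact: is_diffD.
  have dcomp : differentiable (phi \o (fun s : R => x + s *: v)) s.
    by apply: differentiable_comp => //; exact: dphi.
  have := is_derive_coord (phi \o (fun s : R => x + s *: v)) s (v *m 'J phi (x + s *: v)).
  move=> [H _]; apply: H; split; first exact: diff_derivable.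
  rewrite deriveE// diff_comp//=.
  rewrite (_ : 'd (fun s : R => x + s *: v) s 1 = v); last first.
    by have [_ ->] := dseg; rewrite scale1r.
  by rewrite -deriveE// deriveEjacobian.
have cpsi : {within `[0, 1], continuous psi}.
  apply: continuous_subspaceT => s; apply: differentiable_continuous.
  by apply/derivable1_diffP; have [] := dpsi s.
have [s + E] := MVT_segment ler01 (fun s _ => dpsi s) cpsi.
rewrite in_itv/= => s01; exists s => //.
by rewrite subr0 mulr1 in E; rewrite -E /psi scale1r scale0r addr0 !mxE.
Qed.

Lemma norm_sum_weighted q l (e : 'rV[R]_q) (w : 'I_q -> 'rV[R]_l) b : 0 <= b ->
  (forall i, `|w i| <= b) -> `|\sum_i e 0 i *: w i| <= q%:R * `|e| * b.
Proof.
move=> b0 wb; rewrite (le_trans (ler_norm_sum _ _ _))// -mulrA.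
apply: sum_ord_le => i; rewrite normrZ; apply: ler_pM => //; exact: rV_norm_coord.
Qed.

Lemma norm_average q l (d : 'rV[R]_q) (w : 'I_q -> 'rV[R]_l) b :
  simplex_r d -> (forall i, `|w i| <= b) -> `|\sum_i d 0 i *: w i| <= b.
Proof.
move=> [d01 d1] wb; rewrite (le_trans (ler_norm_sum _ _ _))//.
rewrite -[leRHS]mul1r -d1 mulr_suml; apply: ler_sum => i _.
have /andP[d0 _] := d01 i.
by rewrite normrZ ger0_norm// ler_wpM2l.
Qed.

Lemma norm_eq1 l (a a' : 'rV[R]_l) z : a = a' -> `|a'| <= z -> `|a| <= z.
Proof. by move=> ->. Qed.

Lemma norm_eq2 l (a a' b b' : 'rV[R]_l) z : a = a' -> b = b' ->
  `|a' - b'| <= z -> `|a - b| <= z.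
Proof. by move=> -> ->. Qed.

Lemma norm_add_sub l (a b a' b' : 'rV[R]_l) y z : `|a - a'| <= y -> `|b - b'| <= z ->
  `|a + b - (a' + b')| <= y + z.
Proof. by move=> h1 h2; rewrite opprD addrACA (le_trans (ler_normD _ _))// lerD. Qed.

(** The Taylor remainders of the vectors, and a cross term in which the change
of the weights multiplies the change of the vectors: both are of second order. *)
Lemma average_increment q l (d d' : 'rV[R]_q) (w w' a b : 'I_q -> 'rV[R]_l) :
  \sum_i d' 0 i *: w' i - \sum_i d 0 i *: w i -
    (\sum_i d 0 i *: a i + (\sum_i d 0 i *: b i + \sum_i (d' - d) 0 i *: w i)) =
  \sum_i d 0 i *: (w' i - w i - (a i + b i)) + \sum_i (d' - d) 0 i *: (w' i - w i).
Proof.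
rewrite -sumrB -2!big_split -sumrB -big_split/=; apply: eq_bigr => i _.
by apply/rowP => j; rewrite !mxE; ring.
Qed.

(** Change first the vectors, then the weights. *)
Lemma norm_average_sub q l (d d' : 'rV[R]_q) (w w' : 'I_q -> 'rV[R]_l) a b :
  simplex_r d' -> 0 <= b -> (forall i, `|w i - w' i| <= a) -> (forall i, `|w i| <= b) ->
  `|\sum_i d 0 i *: w i - \sum_i d' 0 i *: w' i| <= a + q%:R * `|d - d'| * b.
Proof.
move=> sd' b0 wa wb.
have -> : \sum_i d 0 i *: w i - \sum_i d' 0 i *: w' i =
    \sum_i d' 0 i *: (w i - w' i) + \sum_i (d - d') 0 i *: w i.
  rewrite -sumrB -big_split/=; apply: eq_bigr => i _.
  by apply/rowP => j; rewrite !mxE; ring.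
rewrite (le_trans (ler_normD _ _))// lerD//; first exact: norm_average.
exact: norm_sum_weighted.
Qed.

End ConvexAndMeanValue.

Section MergedControl.
Variables (R : realType) (n m q : nat).
Variables (f : 'I_q -> R -> 'rV[R]_n -> 'rV[R]_m -> 'rV[R]_n) (U : set 'rV[R]_m).
Variables (L : R).
Hypotheses (U_bounded : bounded_set U) (U_convex : convex_set U) (U_neq0 : U !=set0).
Hypotheses (L_gt0 : 0 < L) (hf : dynamics_hyp U L f).

Definition control_values : set 'rV[R]_(m + q) :=
  [set c | U (lsubmx c) /\ simplex_r (rsubmx c)].

Definition merged_field (t : R) (x : 'rV[R]_n) (c : 'rV[R]_(m + q)) : 'rV[R]_n :=
  vfield f t x (lsubmx c) (rsubmx c).

Definition merged_dx (t : R) (x : 'rV[R]_n) (c : 'rV[R]_(m + q)) : 'M[R]_n :=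
  \sum_i rsubmx c 0 i *: 'J (fun y => f i t y (lsubmx c)) x.

Definition merged_dc (t : R) (x : 'rV[R]_n) (c : 'rV[R]_(m + q)) : 'M[R]_(m + q, n) :=
  col_mx (\sum_i rsubmx c 0 i *: 'J (fun u => f i t x u) (lsubmx c))
         (\matrix_(i, j) f i t x (lsubmx c) 0 j).

Lemma mulmx_merged_dx (v : 'rV_n) t x c : v *m merged_dx t x c =
  \sum_i rsubmx c 0 i *: (v *m 'J (fun y => f i t y (lsubmx c)) x).
Proof. by rewrite mulmx_sumr; apply: eq_bigr => i _; rewrite scalemxAr. Qed.

Lemma mulmx_merged_dc (v : 'rV_(m + q)) t x c : v *m merged_dc t x c =
  \sum_i rsubmx c 0 i *: (lsubmx v *m 'J (fun u => f i t x u) (lsubmx c)) +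
  \sum_i rsubmx v 0 i *: f i t x (lsubmx c).
Proof.
rewrite -[v in LHS]hsubmxK mul_row_col mulmx_sumr; congr (_ + _).
  by apply: eq_bigr => i _; rewrite scalemxAr.
by apply/rowP => j; rewrite mxE summxE; apply: eq_bigr => i _; rewrite !mxE.
Qed.

Lemma norm_lsub (c : 'rV[R]_(m + q)) : `|lsubmx c| <= `|c|.
Proof. by rewrite -[c in leRHS]hsubmxK norm_row_mxl. Qed.

Lemma norm_rsub (c : 'rV[R]_(m + q)) : `|rsubmx c| <= `|c|.
Proof. by rewrite -[c in leRHS]hsubmxK norm_row_mxr. Qed.

(** Passing from the Euclidean norm to the sup norm costs only dimensional factors. All
estimates of the dynamics are then made in the sup norm, coordinate by coordinate. *)
Lemma mode_lipschitz : exists2 K1 : R, 0 < K1 &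
  forall i (t t' : R) (x x' : 'rV[R]_n) (u u' : 'rV[R]_m),
  0 <= t <= 1 -> 0 <= t' <= 1 -> U u -> U u' ->
  let D := `|t - t'| + `|x - x'| + `|u - u'| in
  [/\ `|f i t x u - f i t' x' u'| <= K1 * D,
      forall v : 'rV[R]_n, `|v *m 'J (fun y => f i t y u) x -
                  v *m 'J (fun y => f i t' y u') x'| <= K1 * D * `|v| &
      forall v : 'rV[R]_m, `|v *m 'J (fun w => f i t x w) u -
                  v *m 'J (fun w => f i t' x' w) u'| <= K1 * D * `|v| ].
Proof.
pose P : R := (1 + n + m)%:R.
have P1 : 1 <= P by rewrite /P ler1n.
have P0 : 0 <= P by exact: le_trans P1.
have nP : n%:R <= P by rewrite ler_nat -addnA addnCA leq_addr.
have mP : m%:R <= P by rewrite ler_nat leq_addl.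
exists (L * P * P); first by rewrite !mulr_gt0// (lt_le_trans ltr01).
move=> i t t' x x' u u' t01 t'01 Uu Uu' D.
have D0 : 0 <= D by rewrite !addr_ge0.
have DP : `|t - t'| + norm2 (x - x') + norm2 (u - u') <= P * D.
  rewrite /D !mulrDr !lerD//.
  - by rewrite ler_peMl.
  - by rewrite (le_trans (norm2_le_norm _))// ler_wpM2r.
  - by rewrite (le_trans (norm2_le_norm _))// ler_wpM2r.
have [_ _ l1 l2 l3] := hf i.
have LPD0 : 0 <= L * (P * D) by rewrite mulr_ge0 ?(ltW L_gt0)// mulr_ge0.
split=> [|v|v].
- rewrite (le_trans (norm_le_norm2 _))//.
  rewrite (le_trans (l1 _ _ _ _ _ _ t01 t'01 Uu Uu'))//.
  rewrite -2!mulrA ler_pM2l// (le_trans DP)// ler_peMl// mulr_ge0//.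
- have -> : L * P * P * D * `|v| = L * (P * D) * (P * `|v|) by ring.
  rewrite -mulmxBr (le_trans (norm_le_norm2 _))// (le_trans (opnorm2_bound _ _))//.
  apply: (le_trans (ler_wpM2r (norm2_ge0 v) (l2 _ _ _ _ _ _ t01 t'01 Uu Uu'))).
  apply: ler_pM; rewrite ?norm2_ge0 ?ler_pM2l//.
    by rewrite mulr_ge0 ?(ltW L_gt0)// !addr_ge0 ?norm2_ge0.
  by rewrite (le_trans (norm2_le_norm _))// ler_wpM2r.
- have -> : L * P * P * D * `|v| = L * (P * D) * (P * `|v|) by ring.
  rewrite -mulmxBr (le_trans (norm_le_norm2 _))// (le_trans (opnorm2_bound _ _))//.
  apply: (le_trans (ler_wpM2r (norm2_ge0 v) (l3 _ _ _ _ _ _ t01 t'01 Uu Uu'))).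
  apply: ler_pM; rewrite ?norm2_ge0 ?ler_pM2l//.
    by rewrite mulr_ge0 ?(ltW L_gt0)// !addr_ge0 ?norm2_ge0.
  by rewrite (le_trans (norm2_le_norm _))// ler_wpM2r.
Qed.

Lemma bounded_values : exists2 D : R, 0 <= D & forall u : 'rV[R]_m, U u -> `|u| <= D.
Proof.
have [M [_ hM]] := U_bounded; exists (`|M| + 1); first by rewrite addr_ge0.
by move=> u Uu; apply: hM => //=; rewrite (le_lt_trans (ler_norm M))// ltrDl.
Qed.

(** Everything is Lipschitz and U is bounded: compare with the values at (0, 0, u0) for
some u0 in U. *)
Lemma mode_growth : exists2 G : R, 0 < G &
  forall i (t : R) (x : 'rV[R]_n) (u : 'rV[R]_m), 0 <= t <= 1 -> U u ->
  [/\ `|f i t x u| <= G * (1 + `|x|),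
      forall v : 'rV[R]_n, `|v *m 'J (fun y => f i t y u) x| <= G * (1 + `|x|) * `|v| &
      forall v : 'rV[R]_m, `|v *m 'J (fun w => f i t x w) u| <= G * (1 + `|x|) * `|v| ].
Proof.
have [K1 K1_gt0 hK] := mode_lipschitz.
have [D D0 hD] := bounded_values.
have [u0 Uu0] := U_neq0.
have o01 : 0 <= (0 : R) <= 1 by rewrite lexx ler01.
pose F0 := \sum_i `|f i 0 0 u0|.
pose A0 := \sum_i n%:R * `|'J (fun y => f i 0 y u0) 0|.
pose B0 := \sum_i m%:R * `|'J (fun w => f i 0 0 w) u0|.
have F00 : 0 <= F0 by apply: sumr_ge0.
have A00 : 0 <= A0 by apply: sumr_ge0 => i _; rewrite mulr_ge0.
have B00 : 0 <= B0 by apply: sumr_ge0 => i _; rewrite mulr_ge0.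
exists (F0 + A0 + B0 + K1 * (1 + (D + D))).
  by rewrite ltr_wpDl ?addr_ge0// mulr_gt0// ltr_pwDl// addr_ge0.
move=> i t x u t01 Uu.
set G := _ + K1 * _.
have [h1 h2 h3] := hK i t 0 x 0 u u0 t01 o01 Uu Uu0.
have dist : K1 * (`|t - 0| + `|x - 0| + `|u - u0|) <= K1 * (1 + (D + D)) * (1 + `|x|).
  rewrite -mulrA ler_pM2l// !subr0 ger0_norm; last by case/andP: t01.
  have hu : `|u - u0| <= D + D by rewrite (le_trans (ler_normB _ _))// lerD// hD.
  have : t <= 1 by case/andP: t01.
  have : 0 <= (D + D) * `|x| by rewrite mulr_ge0// addr_ge0.
  lra.
have GE a : 0 <= a -> a <= F0 + A0 + B0 -> a + K1 * (1 + (D + D)) * (1 + `|x|) <= G * (1 + `|x|).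
  by move=> a0 aG; rewrite [leRHS]mulrDl lerD2r (le_trans aG)// ler_peMr ?addr_ge0// lerDl.
have sum1 (E : 'I_q -> R) : (forall i, 0 <= E i) -> E i <= \sum_i E i.
  by move=> E0; rewrite (bigD1 i)//= lerDl sumr_ge0.
split=> [|v|v].
- rewrite -[f i t x u](subrK (f i 0 0 u0)) addrC (le_trans (ler_normD _ _))//.
  apply: (le_trans _ (GE _ (normr_ge0 (f i 0 0 u0)) _)); last first.
    have := sum1 (fun i => `|f i 0 0 u0|) (fun i => normr_ge0 _); rewrite -/F0; lra.
  by rewrite lerD2l (le_trans h1).
- rewrite -[v *m _](subrK (v *m 'J (fun y => f i 0 y u0) 0)) addrC.
  rewrite (le_trans (ler_normD _ _))//.
  have := sum1 (fun i => n%:R * `|'J (fun y => f i 0 y u0) 0|)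
    (fun i => mulr_ge0 (ler0n _ _) (normr_ge0 _)); rewrite -/A0 => hA.
  apply: (@le_trans _ _ ((n%:R * `|'J (fun y => f i 0 y u0) 0| +
      K1 * (1 + (D + D)) * (1 + `|x|)) * `|v|)).
    rewrite mulrDl lerD ?norm_mulmx_le// (le_trans (h2 v))// ler_wpM2r//.
  by rewrite ler_wpM2r// GE ?mulr_ge0//; lra.
- rewrite -[v *m _](subrK (v *m 'J (fun w => f i 0 0 w) u0)) addrC.
  rewrite (le_trans (ler_normD _ _))//.
  have := sum1 (fun i => m%:R * `|'J (fun w => f i 0 0 w) u0|)
    (fun i => mulr_ge0 (ler0n _ _) (normr_ge0 _)); rewrite -/B0 => hB.
  apply: (@le_trans _ _ ((m%:R * `|'J (fun w => f i 0 0 w) u0| +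
      K1 * (1 + (D + D)) * (1 + `|x|)) * `|v|)).
    rewrite mulrDl lerD ?norm_mulmx_le// (le_trans (h3 v))// ler_wpM2r//.
  by rewrite ler_wpM2r// GE ?mulr_ge0//; lra.
Qed.

(** Move x first and then u. The segment between two points of U stays in U, where the
Jacobians are Lipschitz. *)
Lemma mode_taylor : exists2 K1 : R, 0 < K1 &
  forall i (t : R) (x x' : 'rV[R]_n) (u u' : 'rV[R]_m),
  0 <= t <= 1 -> U u -> U u' ->
  `|f i t x' u' - f i t x u - ((x' - x) *m 'J (fun y => f i t y u) x +
      (u' - u) *m 'J (fun w => f i t x w) u)| <= K1 * (`|x' - x| + `|u' - u|) ^+ 2.
Proof.
have [K1 K1_gt0 hK] := mode_lipschitz; exists K1 => // i t x x' u u' t01 Uu Uu'.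
have [dx du _ _ _] := hf i.
apply: rV_normP => [|j]; first by rewrite mulr_ge0 ?sqr_ge0// ltW.
have [s s01 Es] := mean_value x (x' - x) j (fun y => dx t y u').
have [r r01 Er] := mean_value u (u' - u) j (fun w => du t x w).
have E : forall (a b c d e : 'rV[R]_n), (a - b - (d + e)) 0 j =
    (a - c) 0 j - d 0 j + ((c - b) 0 j - e 0 j).
  by move=> *; rewrite !mxE; ring.
rewrite (E _ _ (f i t x u')).
rewrite (addrC x) subrK in Es; rewrite (addrC u) subrK in Er; rewrite Es Er.
have F (a b : 'rV[R]_n) : a 0 j - b 0 j = (a - b) 0 j by rewrite !mxE.
rewrite !F (le_trans (ler_normD _ _))//.
have Ur : U (u + r *: (u' - u)) by exact: (convex_segment_closed U_convex).
have [_ h2 _] := hK i t t (x + s *: (x' - x)) x u' u t01 t01 Uu' Uu.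
have [_ _ h3] := hK i t t x x (u + r *: (u' - u)) u t01 t01 Ur Uu.
have {h2}k2 := le_trans (rV_norm_coord _ j) (h2 (x' - x)).
have {h3}k3 := le_trans (rV_norm_coord _ j) (h3 (u' - u)).
rewrite (le_trans (lerD k2 k3))//.
rewrite !subrr !normr0 !add0r ![_ + _ *: _ - _]addrAC !subrr !add0r !normrZ.
have /andP[s0 s1] := s01; have /andP[r0 r1] := r01.
rewrite (ger0_norm s0) (ger0_norm r0) expr2 -!mulrA -mulrDr ler_pM2l//.
set a := `|x' - x|; set b := `|u' - u|.
have a0 : 0 <= a by exact: normr_ge0.
have b0 : 0 <= b by exact: normr_ge0.
have h1 : s * (a * a) <= a * a by rewrite ler_piMl// mulr_ge0.
have h2 : r * (b * b) <= b * b by rewrite ler_piMl// mulr_ge0.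
have h3 : 0 <= a * b by rewrite mulr_ge0.
lra.
Qed.



(** Each bound is the bound for the modes, plus the effect of the change of the weights,
which is at most q times that change times the size of the modes. *)
Lemma control_system_vfield :
  exists K, control_system control_values merged_field merged_dx merged_dc K.
Proof.
have [K1 K1_gt0 hK1] := mode_lipschitz.
have [G G_gt0 hG] := mode_growth.
have [K2 K2_gt0 hK2] := mode_taylor.
have [D D_ge0 hD] := bounded_values.
pose E := K1 + G + K2.
have E_gt0 : 0 < E by rewrite !addr_gt0.
have K1E : K1 <= E by rewrite /E -addrA lerDl addr_ge0 ?ltW.
have GE : G <= E by rewrite /E addrAC lerDr addr_ge0 ?ltW.
have K2E : K2 <= E by rewrite /E lerDr addr_ge0 ?ltW.
have E_ge0 := ltW E_gt0.
have q0 : 0 <= q%:R :> R by [].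
pose K := (1 + 2 * q%:R) * E + D + 1.
have EK : (1 + 2 * q%:R) * E <= K by rewrite /K -addrA lerDl addr_ge0.
have KE0 : 0 <= (1 + 2 * q%:R) * E by rewrite mulr_ge0// addr_ge0// mulr_ge0.
have E1K : E <= K by apply: le_trans EK; rewrite ler_peMl// lerDl mulr_ge0.
have EqK : E + q%:R * E <= K.
  by apply: le_trans EK; have : 0 <= q%:R * E by [rewrite mulr_ge0]; lra.
have w1 (x : 'rV[R]_n) : 1 <= 1 + `|x| by rewrite lerDl.
have w0 (x : 'rV[R]_n) : 0 <= 1 + `|x| by rewrite (le_trans ler01 (w1 x)).
have qn0 (d : 'rV[R]_q) : 0 <= q%:R * `|d| by rewrite mulr_ge0.
have lsubB (c c' : 'rV[R]_(m + q)) : lsubmx c - lsubmx c' = lsubmx (c - c').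
  by apply/rowP => i; rewrite !mxE.
have rsubB (c c' : 'rV[R]_(m + q)) : rsubmx c - rsubmx c' = rsubmx (c - c').
  by apply/rowP => i; rewrite !mxE.
have dist (t t' : R) (x x' : 'rV[R]_n) (c c' : 'rV[R]_(m + q)) :
    `|t - t'| + `|x - x'| + `|lsubmx c - lsubmx c'| <= `|t - t'| + `|x - x'| + `|c - c'|.
  by rewrite lerD2l lsubB norm_lsub.
(* the part of the increment caused by the change of the mode weights *)
have weights (x : 'rV[R]_n) (c c' : 'rV[R]_(m + q)) (s z : R) : 0 <= z ->
    `|c - c'| <= s ->
    K1 * s * z + q%:R * `|rsubmx c - rsubmx c'| * (G * (1 + `|x|) * z) <=
    (E + q%:R * E) * (1 + `|x|) * s * z.
  move=> z0 cs; have s0 : 0 <= s := le_trans (normr_ge0 _) cs.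
  have ds : `|rsubmx c - rsubmx c'| <= s by rewrite (le_trans _ cs)// rsubB norm_rsub.
  have -> : (E + q%:R * E) * (1 + `|x|) * s * z =
    E * (1 + `|x|) * (s * z) + q%:R * s * (E * (1 + `|x|) * z) by ring.
  rewrite -[K1 * s * z]mulrA; apply: lerD.
    rewrite ler_wpM2r ?mulr_ge0// (le_trans K1E)// ler_peMr//.
  apply: ler_pM => //; first by rewrite !mulr_ge0// ltW.
    by rewrite ler_wpM2l.
  by rewrite ler_wpM2r// ler_wpM2r.
exists K; split.
- by apply: lt_le_trans E1K.
- move=> c [Uc [d01 _]]; apply: rV_normP => [|i]; first exact: le_trans E1K.
  rewrite -[c]hsubmxK; case: (split_ordP i) => j ->.
    rewrite row_mxEl (le_trans (rV_norm_coord _ _))// (le_trans (hD _ Uc))//.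
    by rewrite /K addrAC lerDr addr_ge0.
  rewrite row_mxEr; have /andP[a0 a1] := d01 j.
  by rewrite ger0_norm// (le_trans a1)// /K lerDr addr_ge0.
- move=> t x x' c t01 [Uc sc]; rewrite /merged_field /vfield -sumrB.
  under eq_bigr do rewrite -scalerBr.
  apply: norm_average => // i.
  have [+ _ _] := hK1 i t t x x' _ _ t01 t01 Uc Uc.
  rewrite !subrr !normr0 add0r addr0 => /le_trans; apply.
  by rewrite ler_wpM2r// (le_trans K1E).
- move=> t x c t01 [Uc sc]; apply: norm_average => // i.
  have [+ _ _] := hG i t x _ t01 Uc; move=> /le_trans; apply.
  by rewrite ler_wpM2r// (le_trans GE).
- move=> t t' x x' c c' t01 t'01 [Uc sc] [Uc' sc'].
  have cs : `|c - c'| <= `|t - t'| + `|x - x'| + `|c - c'| by rewrite lerDr addr_ge0.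
  have := weights x c c' _ 1 ler01 cs; rewrite !mulr1 => W.
  apply: le_trans (le_trans W _); last by rewrite ler_wpM2r ?addr_ge0// ler_wpM2r.
  apply: norm_average_sub => // [|i|i]; first by rewrite mulr_ge0// ltW.
    have [+ _ _] := hK1 i t t' x x' _ _ t01 t'01 Uc Uc'.
    by move=> /le_trans; apply; rewrite ler_pM2l.
  by have [] := hG i t x _ t01 Uc.
- move=> v t t' x x' c c' t01 t'01 [Uc sc] [Uc' sc'].
  have cs : `|c - c'| <= `|t - t'| + `|x - x'| + `|c - c'| by rewrite lerDr addr_ge0.
  have W := weights x c c' _ `|v| (normr_ge0 v) cs.
  apply: (norm_eq2 (mulmx_merged_dx v t x c) (mulmx_merged_dx v t' x' c')).
  apply: le_trans (le_trans W _); last by rewrite ler_wpM2r// ler_wpM2r ?addr_ge0// ler_wpM2r.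
  have b0 : 0 <= G * (1 + `|x|) * `|v| by rewrite !mulr_ge0// ltW.
  apply: (norm_average_sub _ sc' b0) => i.
    have [_ h2 _] := hK1 i t t' x x' _ _ t01 t'01 Uc Uc'.
    by apply: (le_trans (h2 v)); rewrite ler_wpM2r// ler_pM2l.
  by have [_ h2 _] := hG i t x _ t01 Uc; exact: (h2 v).
- move=> v t t' x x' c c' t01 t'01 [Uc sc] [Uc' sc'].
  set s := `|t - t'| + `|x - x'| + `|c - c'|.
  have s0 : 0 <= s by rewrite !addr_ge0.
  have cs : `|c - c'| <= s by rewrite lerDr addr_ge0.
  have W := weights x c c' s `|v| (normr_ge0 v) cs.
  apply: (norm_eq2 (mulmx_merged_dc v t x c) (mulmx_merged_dc v t' x' c')).
  have h1 : q%:R * `|v| * (E * s) <= q%:R * E * (1 + `|x|) * s * `|v|.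
    have -> : q%:R * `|v| * (E * s) = q%:R * E * 1 * (s * `|v|) by ring.
    rewrite -[leRHS]mulrA; apply: ler_wpM2r; first by rewrite mulr_ge0.
    by rewrite ler_wpM2l// mulr_ge0.
  have h2 : (1 + 2 * q%:R) * E * (1 + `|x|) * s * `|v| <= K * (1 + `|x|) * s * `|v|.
    by rewrite ler_wpM2r// ler_wpM2r// ler_wpM2r.
  apply: le_trans h2.
  have -> : (1 + 2 * q%:R) * E * (1 + `|x|) * s * `|v| =
    (E + q%:R * E) * (1 + `|x|) * s * `|v| + q%:R * E * (1 + `|x|) * s * `|v| by ring.
  apply: norm_add_sub.
    apply: le_trans W.
    have b0 : 0 <= G * (1 + `|x|) * `|v| by rewrite !mulr_ge0// ltW.
    apply: (norm_average_sub _ sc' b0) => i.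
      have [_ _ h3] := hK1 i t t' x x' _ _ t01 t'01 Uc Uc'.
      apply: (le_trans (h3 (lsubmx v))); apply: ler_pM => //; last exact: norm_lsub.
        by rewrite mulr_ge0 ?addr_ge0// ltW.
      by rewrite ler_pM2l.
    have [_ _ h3] := hG i t x _ t01 Uc; apply: (le_trans (h3 (lsubmx v))).
    by rewrite ler_wpM2l ?norm_lsub// mulr_ge0// ltW.
  apply: le_trans h1.
  rewrite -sumrB; under eq_bigr do rewrite -scalerBr.
  rewrite (@le_trans _ _ (q%:R * `|rsubmx v| * (E * s)))//; last first.
    by rewrite ler_wpM2r ?mulr_ge0// ler_wpM2l// norm_rsub.
  apply: norm_sum_weighted => [|i]; first by rewrite mulr_ge0.
  have [h3 _ _] := hK1 i t t' x x' _ _ t01 t'01 Uc Uc'.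
  by apply: (le_trans h3); apply: ler_pM => //; rewrite ?(ltW K1_gt0) ?addr_ge0.
- move=> v t x c t01 [Uc sc]; apply: (norm_eq1 (mulmx_merged_dx v t x c)).
  apply: norm_average => // i.
  have [_ h2 _] := hG i t x _ t01 Uc; apply: (le_trans (h2 v)).
  by rewrite ler_wpM2r// ler_wpM2r// (le_trans GE).
- move=> v t x c t01 [Uc sc]; apply: (norm_eq1 (mulmx_merged_dc v t x c)).
  apply: (le_trans (ler_normD _ _)).
  apply: (@le_trans _ _ (E * (1 + `|x|) * `|v| + q%:R * `|v| * (E * (1 + `|x|)))).
    apply: lerD.
      apply: norm_average => // i.
      have [_ _ h3] := hG i t x _ t01 Uc; apply: (le_trans (h3 (lsubmx v))).
      apply: ler_pM => //; [by rewrite mulr_ge0// ltW| |exact: norm_lsub].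
      by rewrite ler_wpM2r.
    apply: (@le_trans _ _ (q%:R * `|rsubmx v| * (E * (1 + `|x|)))); last first.
      by rewrite ler_wpM2r ?mulr_ge0// ler_wpM2l// norm_rsub.
    apply: norm_sum_weighted => [|i]; first by rewrite mulr_ge0.
    have [h3 _ _] := hG i t x _ t01 Uc; apply: (le_trans h3).
    by rewrite ler_wpM2r.
  have -> : E * (1 + `|x|) * `|v| + q%:R * `|v| * (E * (1 + `|x|)) =
    (E + q%:R * E) * (1 + `|x|) * `|v| by ring.
  by rewrite ler_wpM2r// ler_wpM2r.
- move=> t x x' c c' t01 [Uc sc] [Uc' sc'].
  set s := `|x' - x| + `|c' - c|.
  have s0 : 0 <= s by rewrite addr_ge0.
  have us : `|x' - x| + `|lsubmx c' - lsubmx c| <= s by rewrite lerD2l lsubB norm_lsub.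
  have E3 (a b b' d d' : 'rV[R]_n) : b = b' -> d = d' -> a - (b + d) = a - (b' + d').
    by move=> -> ->.
  apply: (norm_eq1 (E3 _ _ _ _ _ (mulmx_merged_dx _ t x c) (mulmx_merged_dc _ t x c))).
  rewrite -lsubB -rsubB.
  apply: (norm_eq1 (average_increment _ _ _ _ _ _)).
  apply: (le_trans (ler_normD _ _)).
  apply: (@le_trans _ _ (E * s ^+ 2 + q%:R * s * (E * s))); last first.
    have -> : E * s ^+ 2 + q%:R * s * (E * s) = (E + q%:R * E) * s ^+ 2 by ring.
    by rewrite ler_wpM2r// sqr_ge0.
  apply: lerD.
    apply: norm_average => // i.
    apply: (le_trans (hK2 i t x x' _ _ t01 Uc Uc')).
    apply: ler_pM => //; first exact: ltW.
    by apply: lerXn2r => //; rewrite nnegrE addr_ge0.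
  apply: (@le_trans _ _ (q%:R * `|rsubmx c' - rsubmx c| * (E * s))); last first.
    rewrite ler_wpM2r ?mulr_ge0// ler_wpM2l// rsubB.
    by rewrite (le_trans (norm_rsub _))// lerDr.
  apply: norm_sum_weighted => [|i]; first by rewrite mulr_ge0.
  have [h1 _ _] := hK1 i t t x' x _ _ t01 t01 Uc' Uc.
  apply: (le_trans h1); rewrite subrr normr0 add0r.
  by apply: ler_pM => //; exact: ltW.
Qed.

End MergedControl.

(** * Directional derivatives along admissible directions *)

Section DirectionalDerivative.
Variable R : realType.

(** A quadratic remainder in the curve is invisible to the derivative of a Lipschitz
function along it. *)
Lemma dir_deriv_expansion (V : lmodType R) n (G : V -> R) (X : V -> 'rV[R]_n)
    (h : 'rV[R]_n -> R) (v eta : V) (y : 'rV[R]_n) (K D : R) :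
  (forall w, G w = h (X w)) -> differentiable h (X v) ->
  (forall a b, `|h a - h b| <= K * `|a - b|) ->
  (forall l, 0 <= l <= 1 -> `|X (v + l *: eta) - (X v + l *: y)| <= D * l ^+ 2) ->
  dir_deriv G v eta = 'd h (X v) y.
Proof.
move=> GE dh hK hX; apply: cvg_lim => //.
have := diff_derivable dh (v := y) => /cvg_ex[/= d hd].
have dE : d = 'd h (X v) y by rewrite -deriveE//; apply/esym/cvg_lim.
rewrite -dE.
have hd' : l^-1 *: (h (l *: y + X v) - h (X v)) @[l --> 0^'+] --> d.
  exact: cvg_dnbhs_at_right hd.
have D0 : 0 <= D.
  have := hX 1; rewrite ler01 lexx expr1n mulr1 => /(_ isT).
  exact: le_trans.
pose M := `|K| * D + 1.
have M0 : 0 < M by rewrite ltr_wpDl// mulr_ge0.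
apply/cvgrPdist_le => e e0.
have e20 : 0 < e / 2 by rewrite divr_gt0.
near=> l.
have l0 : 0 < l by near: l; exact: nbhs_right_gt.
have l1 : l <= 1 by near: l; exact: nbhs_right_le.
have lM : l <= e / 2 / M by near: l; apply: nbhs_right_le; rewrite divr_gt0.
have h1 : `|d - l^-1 *: (h (l *: y + X v) - h (X v))| <= e / 2.
  by near: l; move/cvgrPdist_le : hd'; exact.
rewrite !GE.
have h2 : `|l^-1 * (h (l *: y + X v) - h (X (v + l *: eta)))| <= e / 2.
  rewrite normrM gtr0_norm ?invr_gt0// mulrC ler_pdivrMr//.
  rewrite (le_trans (hK _ _))// distrC (addrC (l *: y)).
  have := hX l; rewrite (ltW l0) l1 => /(_ isT) hXl.
  rewrite (@le_trans _ _ (`|K| * (D * l ^+ 2)))//.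
    by rewrite (le_trans (ler_wpM2r _ (ler_norm K)))// ler_wpM2l.
  have -> : `|K| * (D * l ^+ 2) = `|K| * D * l * l by ring.
  rewrite ler_wpM2r ?(ltW l0)// (@le_trans _ _ (M * l))//.
    by rewrite ler_wpM2r ?(ltW l0)// /M lerDl.
  by rewrite mulrC -ler_pdivlMr.
have -> : d - (h (X (v + l *: eta)) - h (X v)) / l =
    (d - l^-1 *: (h (l *: y + X v) - h (X v))) +
    l^-1 * (h (l *: y + X v) - h (X (v + l *: eta))).
  by rewrite /GRing.scale/=; ring.
by rewrite (le_trans (ler_normD _ _))// [leRHS](splitr e) lerD.
Unshelve. all: by end_near. Qed.

End DirectionalDerivative.

Section Trajectories.
Variables (R : realType) (n m q : nat).
Variables (f : 'I_q -> R -> 'rV[R]_n -> 'rV[R]_m -> 'rV[R]_n) (U : set 'rV[R]_m).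
Variable K : R.
Hypothesis S : control_system (control_values (q := q) U)
  (merged_field f) (merged_dx f) (merged_dc f) K.
Hypothesis U_convex : convex_set U.
Variable x0 : 'rV[R]_n.

Definition ctl (xi : control R m q) (t : R) : 'rV[R]_(m + q) :=
  row_mx (xi.1 t) (xi.2 t).

Lemma merged_field_ctl s x xi : merged_field f s x (ctl xi s) = vfield f s x (xi.1 s) (xi.2 s).
Proof. by rewrite /merged_field /ctl row_mxKl row_mxKr. Qed.

Lemma admissible_ctl xi : X_r U xi -> admissible (control_values U) (ctl xi).
Proof.
move=> [[[mu1 _] _ hu] [[md _] _ hd]]; split.
  move=> i; rewrite /ctl; case: (split_ordP i) => j ->.
    rewrite (_ : (fun t => _) = (fun t => xi.1 t 0 j)); first exact: mu1.
    by apply/funext => t; rewrite row_mxEl.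
  rewrite (_ : (fun t => _) = (fun t => xi.2 t 0 j)); first exact: md.
  by apply/funext => t; rewrite row_mxEr.
by move=> t t01; rewrite /control_values/= /ctl row_mxKl row_mxKr; split; [exact: hu|exact: hd].
Qed.

Lemma trajectory_flow xi : admissible (control_values U) (ctl xi) ->
  flow (merged_field f) x0 (ctl xi) (trajectory f x0 xi).
Proof.
move=> ac.
have E : is_trajectory f x0 xi = caratheodory (fun s x => merged_field f s x (ctl xi s)) x0.
  suff -> : (fun s x => merged_field f s x (ctl xi s)) =
    (fun s x => vfield f s x (xi.1 s) (xi.2 s)) by [].
  by apply/funext => s; apply/funext => x; exact: merged_field_ctl.
rewrite /trajectory E /flow; apply: (get_caratheodory x0 (cs_gt0 S)).
  exact: (flow_rhs_lip S ac).
by move=> x bx; exact: (flow_rhs_vbm S ac bx).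
Qed.

Lemma ctl_line xi xi' l s : ctl (xi + l *: (xi' - xi)) s =
  ctl xi s + l *: (ctl xi' s - ctl xi s).
Proof.
by rewrite /ctl opp_row_mx add_row_mx scale_row_mx add_row_mx.
Qed.

Lemma control_values_line xi xi' l t : X_r U xi -> X_r U xi' -> 0 <= l <= 1 -> 0 <= t <= 1 ->
  control_values U (ctl xi t + l *: (ctl xi' t - ctl xi t)).
Proof.
move=> [[_ _ hu] [_ _ hd]] [[_ _ hu'] [_ _ hd']] l01 t01.
rewrite -ctl_line /control_values/= /ctl row_mxKl row_mxKr; split.
  by apply: (convex_segment_closed U_convex) => //; [exact: hu|exact: hu'].
by apply: simplex_segment_closed => //; [exact: hd|exact: hd'].
Qed.

Lemma admissible_line xi xi' l : X_r U xi -> X_r U xi' -> 0 <= l <= 1 ->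
  admissible (control_values U) (ctl (xi + l *: (xi' - xi))).
Proof.
move=> hx hx' l01; split.
  have [mc _] := admissible_ctl hx; have [mc' _] := admissible_ctl hx'.
  move=> i; rewrite (_ : (fun t => _) =
    (fun t => ctl xi t 0 i) \+ (fun t => l * (ctl xi' t 0 i - ctl xi t 0 i))).
    apply: measurable_funD; first exact: mc.
    apply: measurable_funM; first exact: measurable_cst.
    by apply: measurable_funB; [exact: mc'|exact: mc].
  by apply/funext => t; rewrite ctl_line/= !mxE.
by move=> t t01; rewrite ctl_line; exact: control_values_line.
Qed.

Definition direction (xi xi' : control R m q) (t : R) : 'rV[R]_(m + q) :=
  ctl xi' t - ctl xi t.

Lemma direction_vbm xi xi' : X_r U xi -> X_r U xi' -> vbm (direction xi xi').
Proof.
move=> /admissible_ctl/(admissible_vbm S)[m1 [D1 h1]].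
move=> /admissible_ctl/(admissible_vbm S)[m2 [D2 h2]]; split.
  move=> i; rewrite (_ : (fun t => _) = (fun t => ctl xi' t 0 i) \- (fun t => ctl xi t 0 i)).
    exact: measurable_funB.
  by apply/funext => t; rewrite /direction/= !mxE.
exists (D2 + D1) => t t01; rewrite (le_trans (ler_normB _ _))// lerD//.
  exact: h2.
exact: h1.
Qed.

Lemma direction_le xi xi' t : X_r U xi -> X_r U xi' -> 0 <= t <= 1 ->
  `|direction xi xi' t| <= 2 * K.
Proof.
move=> /admissible_ctl[_ h1] /admissible_ctl[_ h2] t01.
rewrite (le_trans (ler_normB _ _))// mulr_natl mulr2n lerD// (cs_bounded S)//.
  exact: h2.
exact: h1.
Qed.

Lemma dir_deriv_phi xi xi' y (h : 'rV[R]_n -> R) (H : R) t :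
  X_r U xi -> X_r U xi' ->
  sensitivity (merged_dx f) (merged_dc f) (ctl xi) (trajectory f x0 xi) (direction xi xi') y ->
  (forall x, differentiable h x) -> (forall a b, `|h a - h b| <= H * `|a - b|) ->
  0 <= t <= 1 ->
  dir_deriv (fun xi => h (phi f x0 t xi)) xi (xi' - xi) =
    'd h (trajectory f x0 xi t) (y t).
Proof.
move=> hx hx' sy dh hH t01.
have ac := admissible_ctl hx.
have fx := trajectory_flow ac.
have bp := direction_vbm hx hx'.
have pK t' := @direction_le _ _ t' hx hx'.
have [D hD] := flow_expansion S ac fx bp pK sy.
apply: (@dir_deriv_expansion _ _ _ _ (fun xi => trajectory f x0 xi t) h _ _ _ H D) => //.
move=> l l01.
have al := admissible_line hx hx' l01.
have fl := trajectory_flow al.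
have cE : ctl (xi + l *: (xi' - xi)) = (fun s => ctl xi s + l *: direction xi xi' s).
  by apply/funext => s; rewrite ctl_line.
by rewrite cE in al fl; exact: hD.
Qed.

Variables (tau : seq R) (N : nat).
Hypothesis gtau : grid N tau.

Lemma euler_eul xi i : euler f x0 tau xi i = eul (merged_field f) x0 tau (ctl xi) i.
Proof. by elim: i => //= i ->; rewrite merged_field_ctl. Qed.

Lemma dir_deriv_euler xi xi' (h : 'rV[R]_n -> R) (H : R) i :
  X_r U xi -> X_r U xi' ->
  (forall x, differentiable h x) -> (forall a b, `|h a - h b| <= H * `|a - b|) ->
  (i <= (size tau).-1)%N ->
  dir_deriv (fun xi => h (euler f x0 tau xi i)) xi (xi' - xi) =
    'd h (eul (merged_field f) x0 tau (ctl xi) i)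
      (eul_sens (merged_field f) (merged_dx f) (merged_dc f) x0 tau (ctl xi) (direction xi xi') i).
Proof.
move=> hx hx' dh hH iT.
have ac := admissible_ctl hx.
have pK t' := @direction_le _ _ t' hx hx'.
have [D D0 hD] := eul_expansion S x0 gtau ac.2 pK iT.
rewrite -euler_eul.
apply: (@dir_deriv_expansion _ _ _ _ (fun xi => euler f x0 tau xi i) h _ _ _ H D) => //.
move=> l l01; rewrite !euler_eul.
have cE : ctl (xi + l *: (xi' - xi)) = (fun s => ctl xi s + l *: direction xi xi' s).
  by apply/funext => s; rewrite ctl_line.
by rewrite cE; apply: hD => // t t01; exact: control_values_line.
Qed.

Lemma euler_eq xi i j : (i <= j)%N -> (j <= (size tau).-1)%N -> tau`_i = tau`_j ->
  euler f x0 tau xi i = euler f x0 tau xi j.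
Proof.
move=> ij; elim: j ij => [|j IH] ij jT; first by move: ij; rewrite leqn0 => /eqP ->.
move: ij; rewrite leq_eqVlt => /predU1P[->//|ij] tE.
have tij : tau`_i = tau`_j.
  apply/eqP; rewrite eq_le (grid_mono gtau)//= ?(ltnW jT)//.
  by rewrite tE (grid_step gtau).
by rewrite (IH ij (ltnW jT) tij)/= -tE tij subrr scale0r addr0.
Qed.

(** At a repeated grid point the interpolation starts from the last copy; the Euler
iterates agree on all copies because the steps between them vanish. *)
Lemma phi_tau_grid xi i : (i <= (size tau).-1)%N ->
  phi_tau f x0 tau tau`_i xi = euler f x0 tau xi i.
Proof.
move=> iT; have [t0 t1 _ _] := gtau.
rewrite /phi_tau; case: ifPn => [ti1|]; last first.
  rewrite -leNgt => ti1; apply/esym; apply: euler_eq => //.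
  by apply/eqP; rewrite eq_le (grid_mono gtau)// t1.
set j := find _ tau.
have sz : (0 < size tau)%N.
  by case: (tau) t1 => //=; move/eqP; rewrite eq_sym oner_eq0.
have hasj : has (fun s => tau`_i < s) tau.
  apply/hasP; exists (tau`_(size tau).-1); last by rewrite t1.
  by rewrite mem_nth// prednK.
have jsz : (j < size tau)%N by rewrite -has_find.
have ij : (i < j)%N.
  rewrite ltnNge; apply/negP => ji.
  have := nth_find 0 hasj; rewrite -/j => h.
  by have := lt_le_trans h (grid_mono gtau ji iT); rewrite ltxx.
have j1 : (j.-1 < j)%N by rewrite prednK// (leq_ltn_trans _ ij).
have ij1 : (i <= j.-1)%N by rewrite -ltnS prednK// (leq_ltn_trans _ ij).
have j1T : (j.-1 <= (size tau).-1)%N by rewrite -ltnS (prednK sz); exact: ltn_trans j1 jsz.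
have tE : tau`_i = tau`_j.-1.
  apply/eqP; rewrite eq_le (grid_mono gtau)//=.
  by have := before_find 0 j1 => /negbT; rewrite -leNgt.
by rewrite tE subrr mul0r scale0r addr0; apply/esym; exact: euler_eq.
Qed.

End Trajectories.

(** * Comparison of the two descent functions *)

Section CostBounds.
Variables (R : realType) (n : nat).

Lemma diff_grad (h : 'rV[R]_n -> R) x (y : 'rV[R]_n) : differentiable h x ->
  'd h x y = dot y (grad h x).
Proof.
move=> dh; rewrite {1}(row_sum_delta y) linear_sum; apply: eq_bigr => i _.
by rewrite linearZ /= /grad mxE.
Qed.

Lemma norm_dot_sub_le (y z u v : 'rV[R]_n) :
  `|dot y u - dot z v| <= n%:R * `|u - v| * `|y| + n%:R * `|v| * `|y - z|.
Proof.
have -> : dot y u - dot z v = dot y (u - v) + dot (y - z) v.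
  rewrite -sumrB -big_split/=; apply: eq_bigr => i _; rewrite !mxE; ring.
by rewrite (le_trans (ler_normD _ _))// lerD// norm_dot_le.
Qed.

Definition cost_bound (h : 'rV[R]_n -> R) (H : R) : Prop :=
  [/\ forall x, differentiable h x,
      forall a b, `|h a - h b| <= H * `|a - b|,
      forall a, `|h a| <= H * (1 + `|a|),
      forall a y, `|'d h a y| <= H * (1 + `|a|) * `|y| &
      forall a b y z, `|'d h a y - 'd h b z| <=
        H * `|a - b| * `|y| + H * (1 + `|b|) * `|y - z| ].

Lemma cost_bound_le h H H' : H <= H' -> cost_bound h H -> cost_bound h H'.
Proof.
move=> HH' [h1 h2 h3 h4 h5]; split=> // [a b|a|a y|a b y z].
- by rewrite (le_trans (h2 _ _))// ler_wpM2r.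
- by rewrite (le_trans (h3 _))// ler_wpM2r// addr_ge0.
- by rewrite (le_trans (h4 _ _))// ler_wpM2r// ler_wpM2r// addr_ge0.
- rewrite (le_trans (h5 _ _ _ _))// lerD// ler_wpM2r// ler_wpM2r//.
Qed.

Lemma cost_bound_exists (L : R) h : 0 < L -> cost_hyp L h ->
  exists2 H, 0 <= H & cost_bound h H.
Proof.
move=> L0 [dh hL gL].
have n0 : 0 <= n%:R :> R by [].
pose P : R := (1 + n)%:R.
have P1 : 1 <= P by rewrite /P ler1n.
have nP : n%:R <= P by rewrite ler_nat leq_addl.
have P0 : 0 <= P by exact: le_trans P1.
pose Z := `|h 0| + `|grad h 0|.
have Z0 : 0 <= Z by rewrite addr_ge0.
have LP0 : 0 <= L * P by rewrite mulr_ge0// ltW.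
pose H := P * (Z + L * P).
have H0 : 0 <= H by rewrite mulr_ge0// addr_ge0.
have LPH : L * P <= H by rewrite /H (le_trans _ (ler_peMl _ P1)) ?addr_ge0// lerDr.
have nLPH : n%:R * (L * P) <= H by rewrite /H ler_pM// lerDr.
have lip a b : `|h a - h b| <= L * P * `|a - b|.
  rewrite (le_trans (hL _ _))// -mulrA ler_pM2l//.
  by rewrite (le_trans (norm2_le_norm _))// ler_wpM2r.
have glip a b : `|grad h a - grad h b| <= L * P * `|a - b|.
  rewrite (le_trans (norm_le_norm2 _))// (le_trans (gL _ _))// -mulrA ler_pM2l//.
  by rewrite (le_trans (norm2_le_norm _))// ler_wpM2r.
have gbd a : `|grad h a| <= (Z + L * P) * (1 + `|a|).
  rewrite -[grad h a](subrK (grad h 0)) addrC (le_trans (ler_normD _ _))//.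
  have := glip a 0; rewrite subr0 => g1.
  have : `|grad h 0| <= Z by rewrite /Z lerDr.
  have : 0 <= Z * `|a| by rewrite mulr_ge0.
  lra.
exists H => //; split=> // [a b|a|a y|a b y z].
- by rewrite (le_trans (lip _ _))// ler_wpM2r.
- rewrite -[h a](subrK (h 0)) addrC (le_trans (ler_normD _ _))//.
  have := lip a 0; rewrite subr0 => g1.
  have zH : Z + L * P <= H by rewrite /H ler_peMl// addr_ge0.
  apply: le_trans (ler_wpM2r _ zH); last by rewrite addr_ge0.
  have : `|h 0| <= Z by rewrite /Z lerDl.
  have : 0 <= Z * `|a| by rewrite mulr_ge0.
  lra.
- rewrite (diff_grad y (dh a)) (le_trans (norm_dot_le _ _))// ler_wpM2r//.
  rewrite /H -mulrA; apply: ler_pM => //; exact: gbd.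
- have key (u v : R) : u = dot y (grad h a) -> v = dot z (grad h b) ->
      `|u - v| <= H * `|a - b| * `|y| + H * (1 + `|b|) * `|y - z|; last first.
    exact: (key _ _ (diff_grad y (dh a)) (diff_grad z (dh b))).
  move=> -> ->; rewrite (le_trans (norm_dot_sub_le _ _ _ _))// lerD// ler_wpM2r//.
    rewrite (@le_trans _ _ (n%:R * (L * P * `|a - b|)))//; first by rewrite ler_wpM2l.
    by rewrite mulrA ler_wpM2r.
  rewrite /H -mulrA; apply: ler_pM => //; exact: gbd.
Qed.

End CostBounds.

Section SupClose.
Variables (R : realType) (I : Type) (i0 : I) (tau : seq R) (N : nat).
Hypothesis gtau : grid N tau.
Notation T := (size tau).-1.
Variables (a : I -> R -> R) (b : I -> nat -> R) (M eta : R).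
Hypothesis aM : forall i t, 0 <= t <= 1 -> `|a i t| <= M.
Hypothesis bM : forall i k, (k <= T)%N -> `|b i k| <= M.
Hypothesis ab : forall i t k, 0 <= t <= 1 -> (k <= T)%N -> `|t - tau`_k| <= 2 ^- N ->
  `|a i t - b i k| <= eta.

Let A : set R := [set y | exists i t, 0 <= t <= 1 /\ y = a i t].
Let B : set R := [set y | exists i k, (k <= T)%N /\ y = b i k].

(** A time is compared with a nearby grid point, a grid point with itself. *)
Lemma sup_close : [/\ `|sup A| <= M, `|sup B| <= M & `|sup A - sup B| <= eta].
Proof.
have o01 : 0 <= (0 : R) <= 1 by rewrite lexx ler01.
have A0 : A !=set0 by exists (a i0 0), i0, 0.
have B0 : B !=set0 by exists (b i0 0%N), i0, 0%N.
have uA : ubound A M by move=> _ [i [t [t01 ->]]]; exact: le_trans (ler_norm _) (aM _ t01).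
have uB : ubound B M by move=> _ [i [k [kT ->]]]; exact: le_trans (ler_norm _) (bM _ kT).
have hA : has_ubound A by exists M.
have hB : has_ubound B by exists M.
have aA i t : 0 <= t <= 1 -> a i t <= sup A.
  by move=> t01; apply: ub_le_sup => //; exists i, t.
have bB i k : (k <= T)%N -> b i k <= sup B.
  by move=> kT; apply: ub_le_sup => //; exists i, k.
split.
- rewrite ler_norml ge_sup// andbT (le_trans _ (aA i0 _ o01))//.
  by have := aM i0 o01; rewrite ler_norml => /andP[].
- rewrite ler_norml ge_sup// andbT (le_trans _ (bB i0 _ (leq0n _)))//.
  by have := bM i0 (leq0n T); rewrite ler_norml => /andP[].
- rewrite ler_norml lerBrDr lerBlDr; apply/andP; split.
    rewrite addrC lerBlDr; apply: ge_sup => // _ [i [k [kT ->]]].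
    have t01 := grid_in01 gtau kT.
    have := @ab i _ k t01 kT; rewrite subrr normr0 (mesh_ge0 R N) => /(_ isT).
    rewrite ler_norml => /andP[h1 _]; have := aA i _ t01; lra.
  apply: ge_sup => // _ [i [t [t01 ->]]].
  have [k kT tk] := grid_near gtau t01.
  have := @ab i _ k t01 kT tk; rewrite ler_norml => /andP[_ h1].
  have := bB i k kT; lra.
Qed.

End SupClose.

Section ZetaClose.
Variable R : realType.

(** The two cases in the definition of the optimality functions agree on Psi = 0;
this is the form that shows that they are Lipschitz in Psi. *)
Lemma zeta_casesE (gamma P D0 D1 : R) :
  (if P <= 0 then Num.max D0 (D1 + gamma * P) else Num.max (D0 - P) D1) =
  Num.max (D0 - Num.max P 0) (D1 + gamma * Num.min P 0).
Proof.
by case: (leP P 0) => _; rewrite ?subr0// mulr0 addr0.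
Qed.

Lemma dist_max (a b c d e : R) : `|a - c| <= e -> `|b - d| <= e ->
  `|Num.max a b - Num.max c d| <= e.
Proof.
rewrite !ler_norml => /andP[h1 h2] /andP[h3 h4].
case: (leP a b) => ?; case: (leP c d) => ?; apply/andP; split; lra.
Qed.

Lemma dist_min (a b c d e : R) : `|a - c| <= e -> `|b - d| <= e ->
  `|Num.min a b - Num.min c d| <= e.
Proof.
rewrite !ler_norml => /andP[h1 h2] /andP[h3 h4].
case: (leP a b) => ?; case: (leP c d) => ?; apply/andP; split; lra.
Qed.

Lemma zeta_cases_close (gamma P P' D0 D0' D1 D1' e : R) : 0 < gamma ->
  `|P - P'| <= e -> `|D0 - D0'| <= e -> `|D1 - D1'| <= e ->
  `|(if P <= 0 then Num.max D0 (D1 + gamma * P) else Num.max (D0 - P) D1) -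
    (if P' <= 0 then Num.max D0' (D1' + gamma * P') else Num.max (D0' - P') D1')|
    <= (2 + gamma) * e.
Proof.
move=> g0 hP h0 h1; rewrite !zeta_casesE.
have e0 : 0 <= e by exact: le_trans (normr_ge0 _) hP.
have z0 : `|(0 : R) - 0| <= e by rewrite subrr normr0.
have hM := dist_max hP z0; have hm := dist_min hP z0.
have ge0 : 0 <= gamma * e by rewrite mulr_ge0// ltW.
apply: dist_max.
  move: h0 hM; rewrite !ler_norml => /andP[? ?] /andP[? ?].
  by apply/andP; split; lra.
have : `|gamma * Num.min P 0 - gamma * Num.min P' 0| <= gamma * e.
  by rewrite -mulrBr normrM gtr0_norm// ler_pM2l.
move: h1; rewrite !ler_norml => /andP[? ?] /andP[? ?].
by apply/andP; split; lra.
Qed.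

Lemma zeta_cases_bound (gamma P D0 D1 e : R) : 0 < gamma ->
  `|P| <= e -> `|D0| <= e -> `|D1| <= e ->
  `|if P <= 0 then Num.max D0 (D1 + gamma * P) else Num.max (D0 - P) D1|
    <= (2 + gamma) * e.
Proof.
move=> g0 hP h0 h1.
have := @zeta_cases_close gamma P 0 D0 0 D1 0 e g0.
by rewrite !subr0 lexx mulr0 addr0 maxxx subr0; exact.
Qed.

Variables (n m q Nc : nat).
Variables (f : 'I_q -> R -> 'rV[R]_n -> 'rV[R]_m -> 'rV[R]_n) (U : set 'rV[R]_m).
Variable K : R.
Hypothesis S : control_system (control_values (q := q) U)
  (merged_field f) (merged_dx f) (merged_dc f) K.
Hypothesis U_convex : convex_set U.
Variables (x0 : 'rV[R]_n) (h0 : 'rV[R]_n -> R) (h : 'I_Nc -> 'rV[R]_n -> R) (H : R).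
Hypothesis Nc_gt0 : (0 < Nc)%N.
Hypotheses (H_ge0 : 0 <= H) (ch0 : cost_bound h0 H) (ch : forall j, cost_bound (h j) H).
Variable gamma : R.
Hypothesis gamma_gt0 : 0 < gamma.

Lemma zeta_sub_norm xi xi' :
  zeta f x0 h0 h gamma xi xi' - norm_X (xi' - xi) =
  let DJ := dir_deriv (J f x0 h0) xi (xi' - xi) in
  let Dpsi := sup [set y | exists j t,
    0 <= t <= 1 /\ y = dir_deriv (psi f x0 h j t) xi (xi' - xi)] in
  if Psi f x0 h xi <= 0 then Num.max DJ (Dpsi + gamma * Psi f x0 h xi)
  else Num.max (DJ - Psi f x0 h xi) Dpsi.
Proof. exact: addrK. Qed.

Lemma zeta_tau_sub_norm tau xi xi' :
  zeta_tau f x0 h0 h gamma tau xi xi' - norm_X (xi' - xi) =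
  let DJ := dir_deriv (J_tau f x0 h0 tau) xi (xi' - xi) in
  let Dpsi := sup [set y | exists j k, (k <= (size tau).-1)%N /\
    y = dir_deriv (psi_tau f x0 h tau j tau`_k) xi (xi' - xi)] in
  if Psi_tau f x0 h tau xi <= 0 then Num.max DJ (Dpsi + gamma * Psi_tau f x0 h tau xi)
  else Num.max (DJ - Psi_tau f x0 h tau xi) Dpsi.
Proof. exact: addrK. Qed.

Let state_bound := state_bound K x0.
Let ball_const := ball_const K x0.
Let sens_bound := sens_bound K x0.
Let sens_lip := sens_lip K x0.
Let euler_rate := euler_rate K x0.
Let sens_rate := sens_rate K x0.

(** For the values and the directional derivatives of the costs, E1 is the rate of
consistency and E2 is an a priori bound. *)
Let E1 := H * (ball_const + euler_rate) * (1 + sens_bound) +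
  H * (1 + state_bound) * (sens_lip + sens_rate).
Let E2 := H * (1 + state_bound) * (1 + sens_bound).

(** Every ingredient of zeta is a Lipschitz function of the trajectory and of its
sensitivity, and the discrete ones are the same functions of the Euler iterates and of
their linearization. The directions xi' and xi'' only have to have nearly the same
averages over the cells. *)
Lemma zeta_close : exists2 C : R, 0 <= C &
  forall (N : nat) (tau : seq R) (xi xi' xi'' : control R m q) (e : R),
  grid N tau -> X_tau_r U tau xi -> X_r U xi' -> X_r U xi'' -> 0 <= e ->
  (forall i, (i < (size tau).-1)%N ->
    `|vint tau`_i tau`_i.+1 (direction xi xi') -
      (tau`_i.+1 - tau`_i) *: direction xi xi'' tau`_i| <= (tau`_i.+1 - tau`_i) * e) ->
  [/\ `|zeta f x0 h0 h gamma xi xi' - norm_X (xi' - xi)| <= C,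
      `|zeta_tau f x0 h0 h gamma tau xi xi'' - norm_X (xi'' - xi)| <= C &
      `|(zeta f x0 h0 h gamma xi xi' - norm_X (xi' - xi)) -
        (zeta_tau f x0 h0 h gamma tau xi xi'' - norm_X (xi'' - xi))|
        <= C * (2 ^- N + e)].
Proof.
have state_bound0 : 0 <= state_bound := state_bound_ge0 S x0.
have ball_const0 : 0 <= ball_const := ltW (ball_const_gt0 S x0).
have sens_bound0 : 0 <= sens_bound := sens_bound_ge0 S x0.
have sens_lip0 : 0 <= sens_lip := sens_lip_ge0 S x0.
have euler_rate0 : 0 <= euler_rate := euler_rate_ge0 S x0.
have sens_rate0 : 0 <= sens_rate := sens_rate_ge0 S x0.
have E10 : 0 <= E1.
  apply: addr_ge0; apply: mulr_ge0; try exact: addr_ge0.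
    by apply: mulr_ge0 => //; exact: addr_ge0.
  by apply: mulr_ge0 => //; exact: addr_ge0.
have E20 : 0 <= E2.
  by apply: mulr_ge0; [apply: mulr_ge0 => //; exact: addr_ge0|exact: addr_ge0].
have g20 : 0 <= 2 + gamma by rewrite addr_ge0// ltW.
exists ((2 + gamma) * (E1 + E2)); first by rewrite mulr_ge0// addr_ge0.
move=> N tau xi xi' xi'' e gtau [hx pu pd] hx' hx'' e0 avg.
pose he : R := 2 ^- N + e.
have he0 : 0 <= he by rewrite addr_ge0// mesh_ge0.
have hhe : 2 ^- N <= he by rewrite lerDl.
have ac := admissible_ctl hx.
have fx := trajectory_flow S x0 ac.
have bp := direction_vbm S hx hx'.
have pK t := @direction_le _ _ _ _ _ _ _ S _ _ t hx hx'.
have pK' t := @direction_le _ _ _ _ _ _ _ S _ _ t hx hx''.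
have [y sy] := sensitivity_exists S ac fx bp.
have pc i : (i < (size tau).-1)%N -> forall s, tau`_i <= s < tau`_i.+1 ->
    ctl xi s = ctl xi tau`_i.
  move=> iT s hs; have hi : tau`_i <= tau`_i < tau`_i.+1.
    by rewrite lexx; case/andP: hs => h1 h2; exact: le_lt_trans h1 h2.
  by rewrite /ctl (pu.1 i iT s _ hs hi) (pd.1 i iT s _ hs hi).
set x := trajectory f x0 xi in fx sy.
pose z k := eul (merged_field f) x0 tau (ctl xi) k.
pose Y k := eul_sens (merged_field f) (merged_dx f) (merged_dc f) x0 tau (ctl xi)
  (direction xi xi'') k.
have xr t : 0 <= t <= 1 -> `|x t| <= state_bound by exact: (flow_bound S ac fx).
have zr k : (k <= (size tau).-1)%N -> `|z k| <= state_bound by exact: (eul_bound S x0 gtau ac.2).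
have yr t : 0 <= t <= 1 -> `|y t| <= sens_bound by exact: (sensitivity_bound S ac fx bp pK sy).
have Yr k : (k <= (size tau).-1)%N -> `|Y k| <= sens_bound.
  exact: (eul_sens_bound S x0 gtau ac.2 pK').
have xz t k : 0 <= t <= 1 -> (k <= (size tau).-1)%N -> `|t - tau`_k| <= 2 ^- N ->
    `|x t - z k| <= (ball_const + euler_rate) * he.
  move=> t01 kT tk.
  rewrite -[x t - _](subrKA (x tau`_k)) (le_trans (ler_normD _ _))// mulrDl lerD//.
    rewrite (le_trans (flow_lipschitz S ac fx t01 (grid_in01 gtau kT)))//.
    by rewrite ler_wpM2l// (le_trans tk).
  by rewrite (le_trans (euler_error S gtau ac fx pc kT))// ler_wpM2l.
have yY t k : 0 <= t <= 1 -> (k <= (size tau).-1)%N -> `|t - tau`_k| <= 2 ^- N ->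
    `|y t - Y k| <= (sens_lip + sens_rate) * he.
  move=> t01 kT tk.
  rewrite -[y t - _](subrKA (y tau`_k)) (le_trans (ler_normD _ _))// mulrDl lerD//.
    rewrite (le_trans (sensitivity_lipschitz S ac fx bp pK sy t01 (grid_in01 gtau kT)))//.
    by rewrite ler_wpM2l// (le_trans tk).
  exact: (euler_sensitivity_error S gtau ac fx pc bp pK sy e0 avg kT).
have vx g t : cost_bound g H -> 0 <= t <= 1 -> `|g (x t)| <= E2.
  move=> [_ _ c _ _] t01; rewrite (le_trans (c _))// /E2 -[leLHS]mulr1.
  apply: ler_pM; rewrite ?mulr_ge0 ?addr_ge0//; last by rewrite lerDl.
  by rewrite ler_wpM2l// lerD2l xr.
have vz g k : cost_bound g H -> (k <= (size tau).-1)%N -> `|g (z k)| <= E2.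
  move=> [_ _ c _ _] kT; rewrite (le_trans (c _))// /E2 -[leLHS]mulr1.
  apply: ler_pM; rewrite ?mulr_ge0 ?addr_ge0//; last by rewrite lerDl.
  by rewrite ler_wpM2l// lerD2l zr.
have vxz g t k : cost_bound g H -> 0 <= t <= 1 -> (k <= (size tau).-1)%N ->
    `|t - tau`_k| <= 2 ^- N -> `|g (x t) - g (z k)| <= E1 * he.
  move=> [_ c _ _ _] t01 kT tk; rewrite (le_trans (c _ _))//.
  rewrite (@le_trans _ _ (H * ((ball_const + euler_rate) * he)))//; first by rewrite ler_wpM2l// xz.
  have p1 : 0 <= H * (ball_const + euler_rate) * he * sens_bound.
    by apply: mulr_ge0 => //; apply: mulr_ge0 => //; apply: mulr_ge0 => //; exact: addr_ge0.
  have p2 : 0 <= H * (1 + state_bound) * (sens_lip + sens_rate) * he.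
    apply: mulr_ge0 => //; apply: mulr_ge0; last exact: addr_ge0.
    by apply: mulr_ge0 => //; exact: addr_ge0.
  have -> : E1 * he = H * ((ball_const + euler_rate) * he) + (H * (ball_const + euler_rate) * he * sens_bound +
    H * (1 + state_bound) * (sens_lip + sens_rate) * he) by rewrite /E1; ring.
  by rewrite lerDl addr_ge0.
have dx g t : cost_bound g H -> 0 <= t <= 1 -> `|'d g (x t) (y t)| <= E2.
  move=> [_ _ _ c _] t01; rewrite (le_trans (c _ _))// /E2.
  apply: ler_pM; rewrite ?mulr_ge0 ?addr_ge0//.
    by rewrite ler_wpM2l// lerD2l xr.
  by rewrite (le_trans (yr _ t01))// lerDr.
have dz g k : cost_bound g H -> (k <= (size tau).-1)%N -> `|'d g (z k) (Y k)| <= E2.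
  move=> [_ _ _ c _] kT; rewrite (le_trans (c _ _))// /E2.
  apply: ler_pM; rewrite ?mulr_ge0 ?addr_ge0//.
    by rewrite ler_wpM2l// lerD2l zr.
  by rewrite (le_trans (Yr _ kT))// lerDr.
have dxz g t k : cost_bound g H -> 0 <= t <= 1 -> (k <= (size tau).-1)%N ->
    `|t - tau`_k| <= 2 ^- N -> `|'d g (x t) (y t) - 'd g (z k) (Y k)| <= E1 * he.
  move=> [_ _ _ _ c] t01 kT tk; rewrite (le_trans (c _ _ _ _))//.
  have -> : E1 * he = H * ((ball_const + euler_rate) * he) * (1 + sens_bound) +
    H * (1 + state_bound) * ((sens_lip + sens_rate) * he) by rewrite /E1; ring.
  apply: lerD; apply: ler_pM; rewrite ?mulr_ge0 ?addr_ge0//.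
  - by rewrite ler_wpM2l// xz.
  - by rewrite (le_trans (yr _ t01))// lerDr.
  - by rewrite ler_wpM2l// lerD2l zr.
  - exact: yY.
have dG g t : cost_bound g H -> 0 <= t <= 1 ->
    dir_deriv (fun xi => g (phi f x0 t xi)) xi (xi' - xi) = 'd g (x t) (y t).
  by move=> [c1 c2 _ _ _] t01; exact: (dir_deriv_phi S U_convex hx hx' sy c1 c2 t01).
have dGz g k : cost_bound g H -> (k <= (size tau).-1)%N ->
    dir_deriv (fun xi => g (phi_tau f x0 tau tau`_k xi)) xi (xi'' - xi) =
    'd g (z k) (Y k).
  move=> [c1 c2 _ _ _] kT.
  rewrite -(dir_deriv_euler S U_convex x0 gtau hx hx'' c1 c2 kT).
  by congr dir_deriv; apply/funext => w; rewrite (phi_tau_grid f x0 gtau).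
have o1 : 0 <= (1 : R) <= 1 by rewrite lexx ler01.
have tauT : tau`_(size tau).-1 = 1 by case: gtau.
have nearT : `|1 - tau`_(size tau).-1| <= 2 ^- N by rewrite tauT subrr normr0 mesh_ge0.
have dJz : dir_deriv (J_tau f x0 h0 tau) xi (xi'' - xi) =
    'd h0 (z (size tau).-1) (Y (size tau).-1).
  by rewrite -(dGz h0 _ ch0 (leqnn _)) tauT.
pose i0 : 'I_Nc := Ordinal Nc_gt0.
have ptE j k : (k <= (size tau).-1)%N ->
    psi_tau f x0 h tau j tau`_k xi = h j (z k).
  by move=> kT; rewrite /psi_tau (phi_tau_grid f x0 gtau xi kT) euler_eul.
have pM j t : 0 <= t <= 1 -> `|psi f x0 h j t xi| <= E2.
  by move=> t01; exact: (vx (h j) t (ch j) t01).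
have ptM j k : (k <= (size tau).-1)%N -> `|psi_tau f x0 h tau j tau`_k xi| <= E2.
  by move=> kT; rewrite (ptE j k kT); exact: (vz (h j) k (ch j) kT).
have ptC j t k : 0 <= t <= 1 -> (k <= (size tau).-1)%N -> `|t - tau`_k| <= 2 ^- N ->
    `|psi f x0 h j t xi - psi_tau f x0 h tau j tau`_k xi| <= E1 * he.
  by move=> t01 kT tk; rewrite (ptE j k kT); exact: (vxz (h j) t k (ch j) t01 kT tk).
have [P1 P2 P3] := sup_close i0 gtau pM ptM ptC.
have dM j t : 0 <= t <= 1 -> `|dir_deriv (psi f x0 h j t) xi (xi' - xi)| <= E2.
  by move=> t01; rewrite (dG (h j) t (ch j) t01); exact: (dx (h j) t (ch j) t01).
have dtM j k : (k <= (size tau).-1)%N ->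
    `|dir_deriv (psi_tau f x0 h tau j tau`_k) xi (xi'' - xi)| <= E2.
  by move=> kT; rewrite (dGz (h j) k (ch j) kT); exact: (dz (h j) k (ch j) kT).
have dtC j t k : 0 <= t <= 1 -> (k <= (size tau).-1)%N -> `|t - tau`_k| <= 2 ^- N ->
    `|dir_deriv (psi f x0 h j t) xi (xi' - xi) -
      dir_deriv (psi_tau f x0 h tau j tau`_k) xi (xi'' - xi)| <= E1 * he.
  move=> t01 kT tk; rewrite (dG (h j) t (ch j) t01) (dGz (h j) k (ch j) kT).
  exact: (dxz (h j) t k (ch j) t01 kT tk).
have [D1 D2 D3] := sup_close i0 gtau dM dtM dtC.
have dJx : dir_deriv (J f x0 h0) xi (xi' - xi) = 'd h0 (x 1) (y 1).
  exact: (dG h0 1 ch0 o1).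
have J1 : `|dir_deriv (J f x0 h0) xi (xi' - xi)| <= E2.
  by rewrite dJx; exact: (dx h0 1 ch0 o1).
have J2 : `|dir_deriv (J_tau f x0 h0 tau) xi (xi'' - xi)| <= E2.
  by rewrite dJz; exact: (dz h0 _ ch0 (leqnn _)).
have J3 : `|dir_deriv (J f x0 h0) xi (xi' - xi) -
    dir_deriv (J_tau f x0 h0 tau) xi (xi'' - xi)| <= E1 * he.
  by rewrite dJx dJz; exact: (dxz h0 1 _ ch0 o1 (leqnn _) nearT).
pose PP := Psi f x0 h xi; pose PT := Psi_tau f x0 h tau xi.
pose DA := dir_deriv (J f x0 h0) xi (xi' - xi).
pose DB := dir_deriv (J_tau f x0 h0 tau) xi (xi'' - xi).
pose SA := sup [set y | exists j t,
  0 <= t <= 1 /\ y = dir_deriv (psi f x0 h j t) xi (xi' - xi)].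
pose SB := sup [set y | exists j k, (k <= (size tau).-1)%N /\
  y = dir_deriv (psi_tau f x0 h tau j tau`_k) xi (xi'' - xi)].
have key (u v : R) :
    u = (if PP <= 0 then Num.max DA (SA + gamma * PP) else Num.max (DA - PP) SA) ->
    v = (if PT <= 0 then Num.max DB (SB + gamma * PT) else Num.max (DB - PT) SB) ->
    [/\ `|u| <= (2 + gamma) * (E1 + E2), `|v| <= (2 + gamma) * (E1 + E2) &
        `|u - v| <= (2 + gamma) * (E1 + E2) * he]; last first.
  exact: (key _ _ (zeta_sub_norm xi xi') (zeta_tau_sub_norm tau xi xi'')).
move=> -> ->; split.
- apply: le_trans (zeta_cases_bound gamma_gt0 P1 J1 D1) _.
  by rewrite ler_wpM2l// lerDr.
- apply: le_trans (zeta_cases_bound gamma_gt0 P2 J2 D2) _.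
  by rewrite ler_wpM2l// lerDr.
apply: le_trans (zeta_cases_close gamma_gt0 P3 J3 D3) _.
by rewrite -mulrA ler_wpM2l// ler_wpM2r// lerDl.
Qed.

End ZetaClose.

(** * Points of a convex set near a mean *)

Section NearMean.
Variable R : realType.
Notation mu := (@lebesgue_measure R).
Notation integrable01 g := (mu.-integrable `[0, 1] (EFin \o g)).

Lemma sqr_norm2D k (u v : 'rV[R]_k) :
  norm2 (u + v) ^+ 2 = norm2 u ^+ 2 + 2 * dot u v + norm2 v ^+ 2.
Proof.
rewrite !sqr_norm2 /dot mulr_sumr -!big_split/=; apply: eq_bigr => i _.
by rewrite mxE; ring.
Qed.

Lemma dot_norm2 k (u : 'rV[R]_k) : dot u u = norm2 u ^+ 2.
Proof. by rewrite sqr_norm2; apply: eq_bigr => i _; rewrite expr2. Qed.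

Lemma integrable01_dot k (w : R -> 'rV[R]_k) (c : 'rV[R]_k) : vintegrable w ->
  integrable01 (fun s => dot (w s) c).
Proof. by move=> hw; apply: integrable01_sum => i; exact: integrable01Zr. Qed.

Lemma Rintegral_dot k (w : R -> 'rV[R]_k) (c : 'rV[R]_k) (a b : R) :
  0 <= a -> b <= 1 -> vintegrable w ->
  \int[mu]_(s in `[a, b]) dot (w s) c = dot (vint a b w) c.
Proof.
move=> a0 b1 hw; rewrite Rintegral_sum//; last by move=> i; exact: integrable01Zr.
apply: eq_bigr => i _; rewrite mxE RintegralZr//.
exact: integrable01_sub.
Qed.

Lemma vbm_sqr_norm2_integrable k (w : R -> 'rV[R]_k) : vbm w ->
  integrable01 (fun s => norm2 (w s) ^+ 2).
Proof.
move=> [mw [C hC]].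
apply: (@integrable01_bounded _ _ ((k%:R * C) ^+ 2)).
  rewrite (_ : (fun s => _) = (fun s => \sum_i w s 0 i ^+ 2)).
    apply: measurable_sum => i; apply: measurable_funX; exact: mw.
  by apply/funext => s; rewrite sqr_norm2.
move=> t t01; rewrite ger0_norm ?sqr_ge0//.
have h1 : norm2 (w t) <= k%:R * C.
  by rewrite (le_trans (norm2_le_norm _))// ler_wpM2l// hC.
by rewrite lerXn2r ?nnegrE ?norm2_ge0// (le_trans (norm2_ge0 _) h1).
Qed.

(** The mean of w over [a, b] may fail to lie in V, since V need not be closed. But a point
of V that nearly minimizes the Euclidean distance to the mean is close to it, by the
variational inequality for near-projections, integrated over [a, b]. *)
Lemma near_mean k (V : set 'rV[R]_k) (D : R) (w : R -> 'rV[R]_k) (a b e : R) :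
  segment_closed V -> (forall v, V v -> `|v| <= D) -> vbm w ->
  (forall t, 0 <= t <= 1 -> V (w t)) ->
  0 <= a -> a < b -> b <= 1 -> 0 < e ->
  exists2 p, V p & `|vint a b w - (b - a) *: p| <= (b - a) * e.
Proof.
move=> sV VD bw wV a0 ab b1 e0.
pose d := b - a.
have d0 : 0 < d by rewrite subr_gt0.
have iw := vbm_integrable bw.
pose mean := d^-1 *: vint a b w.
have Ve : V (w a) by apply: wV; rewrite a0 (le_trans (ltW ab)).
have D0 : 0 <= D by exact: le_trans (VD _ Ve).
pose Q : R := (k%:R * (2 * D)) ^+ 2.
have Q0 : 0 <= Q by exact: sqr_ge0.
have diam u v : V u -> V v -> norm2 (u - v) ^+ 2 <= Q.
  move=> /VD hu /VD hv; rewrite /Q lerXn2r ?nnegrE ?norm2_ge0// ?mulr_ge0//.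
  rewrite (le_trans (norm2_le_norm _))// ler_wpM2l// (le_trans (ler_normB _ _))//.
  by rewrite mulr_natl mulr2n lerD.
pose G := [set norm2 (v - mean) ^+ 2 | v in V].
have G0 : has_lbound G by exists 0 => _ [v _ <-]; exact: sqr_ge0.
have hinf : has_inf G by split=> //; exists (norm2 (w a - mean) ^+ 2), (w a).
(* a step of length eta towards v, against the precision eta^2 of the near-minimizer,
   gives the variational inequality up to eta (1 + Q) / 2 <= e^2 *)
pose eta := Num.min 1 (2 * e ^+ 2 / (1 + Q)).
have Q1 : 0 < 1 + Q by rewrite ltr_pwDl.
have eta0 : 0 < eta by rewrite lt_min ltr01/= divr_gt0// mulr_gt0// exprn_gt0.
have eta1 : eta <= 1 by rewrite /eta ge_min lexx.
have etaQ : eta * (1 + Q) <= 2 * e ^+ 2.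
  by rewrite -ler_pdivlMr// /eta ge_min lexx orbT.
have eta20 : 0 < eta ^+ 2 by rewrite exprn_gt0.
have [_ [p Vp <-] hp] := inf_adherent eta20 hinf.
have pmin v : V v -> norm2 (p - mean) ^+ 2 <= norm2 (v - mean) ^+ 2 + eta ^+ 2.
  move=> Vv; apply/ltW/(lt_le_trans hp); rewrite lerD2r.
  by apply: ge_inf => //; exists v.
exists p => //.
have var v : V v -> dot (v - p) (mean - p) <= e ^+ 2.
  move=> Vv.
  have Vs : V (p + eta *: (v - p)) by apply: sV => //; rewrite (ltW eta0).
  have := pmin _ Vs.
  have -> : p + eta *: (v - p) - mean = (p - mean) + eta *: (v - p) by rewrite addrAC.
  rewrite (sqr_norm2D (p - mean)) norm2Z gtr0_norm// exprMn.
  have -> : dot (p - mean) (eta *: (v - p)) = - (eta * dot (v - p) (mean - p)).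
    rewrite /dot mulr_sumr -sumrN; apply: eq_bigr => i _; rewrite !mxE; ring.
  move=> h.
  have h2 : eta ^+ 2 * norm2 (v - p) ^+ 2 <= eta ^+ 2 * Q.
    by rewrite ler_wpM2l ?(ltW eta20)// diam.
  have h3 : eta * (2 * dot (v - p) (mean - p)) <= eta * (eta * (1 + Q)).
    by move: h; lra.
  move: h3; rewrite ler_pM2l// => h3; lra.
have vE : vint a b w = d *: mean by rewrite /mean scalerA divff ?gt_eqF// scale1r.
have main : norm2 (mean - p) ^+ 2 <= e ^+ 2.
  rewrite -dot_norm2 -(ler_pM2l d0).
  have icst := vintegrable_cst p.
  have -> : d * dot (mean - p) (mean - p) =
      \int[mu]_(s in `[a, b]) dot (w s - p) (mean - p).
    rewrite Rintegral_dot//; last exact: vintegrableB.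
    rewrite vintB// vE vint_cst ?(ltW ab)// -/d -scalerBr /dot mulr_sumr.
    by apply: eq_bigr => i _; rewrite [in RHS]mxE mulrA.
  rewrite -Rintegral_itv_cst ?(ltW ab)//; apply: le_Rintegral => //.
  - apply: integrable01_sub => //; apply: integrable01_dot; exact: vintegrableB.
  - by apply: integrable01_sub => //; exact: integrable01_cst.
  move=> s; rewrite /= in_itv/= => /andP[as_ sb]; apply/var/wV.
  by rewrite (le_trans a0 as_) (le_trans sb b1).
rewrite vE -/d -scalerBr normrZ gtr0_norm// ler_pM2l//.
rewrite (le_trans (norm_le_norm2 _))//.
by rewrite -(@ler_pXn2r _ 2) ?nnegrE ?norm2_ge0// ltW.
Qed.

(** Replacing w by such a point does not increase the distance to a constant c by much:
expand the square around p and drop the square of w - p. *)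
Lemma near_mean_sqr k (w : R -> 'rV[R]_k) (p c : 'rV[R]_k) (D a b e : R) :
  vbm w -> 0 <= a -> a <= b -> b <= 1 -> `|p| <= D -> `|c| <= D -> 0 <= e ->
  `|vint a b w - (b - a) *: p| <= (b - a) * e ->
  (b - a) * norm2 (p - c) ^+ 2 <=
    \int[mu]_(s in `[a, b]) (norm2 (w s - c) ^+ 2) + (b - a) * (4 * k%:R * D * e).
Proof.
move=> bw a0 ab b1 pD cD e0 he.
have D0 : 0 <= D by exact: le_trans pD.
have d0 : 0 <= b - a by rewrite subr_ge0.
have iw := vbm_integrable bw.
have bwc : vbm (fun s => w s - c) by apply: vbmD => //; exact: vbm_cst.
have iwp : vintegrable (fun s => w s - p) by apply: vintegrableB => //; exact: vintegrable_cst.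
have idot := integrable01_dot (p - c) iwp.
have idot2 : integrable01 (fun s => 2 * dot (w s - p) (p - c)).
  have := integrable01Zr 2 idot; by apply: eq_integrable => // s _; rewrite /= mulrC.
have icst := integrable01_cst (norm2 (p - c) ^+ 2).
have low : (b - a) * norm2 (p - c) ^+ 2 + 2 * dot (vint a b w - (b - a) *: p) (p - c) <=
    \int[mu]_(s in `[a, b]) (norm2 (w s - c) ^+ 2).
  have -> : vint a b w - (b - a) *: p = vint a b (fun s => w s - p).
    by rewrite vintB ?vint_cst//; exact: vintegrable_cst.
  rewrite -Rintegral_dot// -Rintegral_itv_cst// -RintegralZl//; last exact: integrable01_sub.
  rewrite -RintegralD//; [|exact: integrable01_sub..].
  apply: le_Rintegral => //.
  - apply: integrable01_sub => //.
    have := integrableD _ icst idot2; apply: (fun h => h _) => //.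
  - by apply: integrable01_sub => //; exact: vbm_sqr_norm2_integrable.
  move=> s _; have -> : w s - c = (p - c) + (w s - p) by rewrite [RHS]addrC subrKA.
  rewrite (sqr_norm2D (p - c)).
  have -> : dot (w s - p) (p - c) = dot (p - c) (w s - p).
    by apply: eq_bigr => i _; rewrite mulrC.
  by rewrite /= lerDl sqr_ge0.
have h2 : `|dot (vint a b w - (b - a) *: p) (p - c)| <= (b - a) * (2 * k%:R * D * e).
  rewrite (le_trans (norm_dot_le _ _))//.
  have -> : (b - a) * (2 * k%:R * D * e) = k%:R * (D + D) * ((b - a) * e) by ring.
  apply: ler_pM; rewrite ?mulr_ge0// ler_wpM2l// (le_trans (ler_normB _ _))//.
  by rewrite lerD.
move: h2; rewrite ler_norml => /andP[h2 _]; lra.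
Qed.

End NearMean.

(** * Approximation by piecewise constant controls *)

Section StepFunctions.
Variables (R : realType) (tau : seq R) (N : nat).
Hypothesis gtau : grid N tau.
Notation T := (size tau).-1.
Notation mu := (@lebesgue_measure R).
Notation integrable01 g := (mu.-integrable `[0, 1] (EFin \o g)).

(** Grid points equal to 1 are not counted, so that t = 1 belongs to the last nonempty cell,
as the left limit requires. *)
Definition cell_index (t : R) : nat :=
  count (fun s => (s <= t) && (s < 1)) (behead tau).

Lemma cell_index_mono s t : s <= t -> (cell_index s <= cell_index t)%N.
Proof.
move=> st; apply: sub_count => r /= /andP[rs ->]; rewrite andbT.
exact: le_trans rs st.
Qed.

Lemma cell_indexE i t : (i < T)%N -> tau`_i <= t < tau`_i.+1 -> cell_index t = i.
Proof.
move=> iT /andP[it ti]; have [t0 t1 _ _] := gtau.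
have sb : size (behead tau) = T by rewrite size_behead.
rewrite /cell_index -(cat_take_drop i (behead tau)) count_cat.
have ti1 : t < 1 by apply: (lt_le_trans ti); case/andP: (grid_in01 gtau iT).
have -> : count (fun s => (s <= t) && (s < 1)) (take i (behead tau)) = i.
  have si : size (take i (behead tau)) = i by rewrite size_take sb iT.
  rewrite -[RHS]si; apply/eqP; rewrite -all_count; apply/(all_nthP 0) => j.
  rewrite si => ji; rewrite nth_take// nth_behead.
  have h : tau`_j.+1 <= t by apply: le_trans it; apply: (grid_mono gtau) => //; exact: ltnW.
  by rewrite h (le_lt_trans h).
have -> : count (fun s => (s <= t) && (s < 1)) (drop i (behead tau)) = 0%N.
  apply/eqP; rewrite -leqn0 leqNgt -has_count; apply/hasPn => s /(nthP 0)[j].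
  rewrite size_drop sb => jT <-; rewrite nth_drop nth_behead negb_and -ltNge.
  rewrite (lt_le_trans ti)//; apply: (grid_mono gtau); first by rewrite ltnS leq_addr.
  by rewrite -ltn_subRL.
by rewrite addn0.
Qed.

Lemma cell_index_left : \forall t \near 1^'-, cell_index t = cell_index 1.
Proof.
rewrite /cell_index; elim: (behead tau) => [|s l IH]; first exact: nearW.
have [s1|s1] := ltP s 1; near=> t.
  rewrite /= s1 !andbT (ltW s1); congr (nat_of_bool _ + _)%N; last by near: t.
  by near: t; exact: nbhs_left_ge.
by rewrite /= ltNge s1 /= !andbF; congr (_ + _)%N; near: t.
Unshelve. all: by end_near. Qed.

Section Step.
Variables (k : nat) (V : set 'rV[R]_k) (D : R) (P : nat -> 'rV[R]_k).
Hypotheses (VD : forall v, V v -> `|v| <= D) (VP : forall i, V (P i)).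

Definition step (t : R) : 'rV[R]_k := P (cell_index t).

Let D0 : 0 <= D. Proof. exact: le_trans (VD (VP 0%N)). Qed.

(* a coordinate of the step function is a difference of nondecreasing functions: adding
   2D per cell compensates every downward jump *)
Let up j (t : R) : R := P (cell_index t) 0 j + 2 * D * (cell_index t)%:R.
Let lin (t : R) : R := 2 * D * (cell_index t)%:R.

Let stepE j : (fun t => step t 0 j) = up j \- lin.
Proof. by apply/funext => t; rewrite /step /up /lin /= addrK. Qed.

Let lin_mono : {homo lin : s t / s <= t}.
Proof.
by move=> s t st; rewrite /lin ler_wpM2l ?mulr_ge0// ler_nat cell_index_mono.
Qed.

Let up_mono j : {homo up j : s t / s <= t}.
Proof.
have H : {homo (fun i => P i 0 j + 2 * D * i%:R) : a b / (a <= b)%N >-> a <= b}.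
  apply: homo_leq => [//|b a c|i]; first exact: le_trans.
  have h i' : `|P i' 0 j| <= D by exact: le_trans (rV_norm_coord _ _) (VD (VP i')).
  have := h i; have := h i.+1; rewrite !ler_norml => /andP[? ?] /andP[? ?].
  by rewrite -(natr1 i) mulrDr; lra.
by move=> s t st; apply: H; exact: cell_index_mono.
Qed.

Lemma step_measurable j : measurable_fun (`[0, 1] : set R) (fun t => step t 0 j).
Proof.
by rewrite stepE; apply: measurable_funB; apply: nondecreasing_measurable.
Qed.

Lemma step_L2BV : L2BV V step.
Proof.
split.
- split; first exact: step_measurable.
  apply: vbm_sqr_norm2_integrable; split; first exact: step_measurable.
  by exists D => t _; apply/VD/VP.
- move=> j; rewrite stepE; apply: bounded_variationD => //.
    by apply: nondecreasing_bounded_variation => s t _ _; exact: up_mono.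
  apply: bounded_variationN.
  by apply: nondecreasing_bounded_variation => s t _ _; exact: lin_mono.
- by move=> t _; exact: VP.
Qed.

Lemma step_piecewise_constant : piecewise_constant tau step.
Proof.
split=> [i iT s t hs ht|]; first by rewrite /step (cell_indexE iT hs) (cell_indexE iT ht).
apply: cvg_near_cst; have := cell_index_left; apply: filterS => t.
by rewrite /step => ->.
Qed.

End Step.

Lemma Rintegral_eq_co (g1 g2 : R -> R) (a b : R) : 0 <= a -> b <= 1 ->
  integrable01 g1 -> integrable01 g2 -> (forall s, a <= s < b -> g1 s = g2 s) ->
  \int[mu]_(s in `[a, b]) g1 s = \int[mu]_(s in `[a, b]) g2 s.
Proof.
move=> a0 b1 i1 i2 g12.
have sub : `[a, b[ `<=` `[a, b] by apply: subset_itv; rewrite bnd_simp.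
have j1 : mu.-integrable `[a, b[ (EFin \o g1).
  by apply: integrableS (integrable01_sub a0 b1 i1).
have j2 : mu.-integrable `[a, b[ (EFin \o g2).
  by apply: integrableS (integrable01_sub a0 b1 i2).
rewrite -!Rintegral_itv_bndo_bndc//; apply: eq_Rintegral => s.
by rewrite inE/= in_itv/= => /g12.
Qed.

Lemma L2BV_vbm k (V : set 'rV[R]_k) D w : (forall v, V v -> `|v| <= D) -> L2BV V w ->
  vbm w.
Proof.
by move=> VD [[mw _] _ Vw]; split=> //; exists D => t t01; apply/VD/Vw.
Qed.

Lemma add_cell (A1 A2 B1 B2 E t t' : R) : A1 <= B1 + t * E ->
  A2 <= B2 + (t' - t) * E -> A1 + A2 <= B1 + B2 + t' * E.
Proof. lra. Qed.

(** On each cell take a point of V near the mean of w'. As w is constant there, the estimate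
of [near_mean_sqr] applies cell by cell and adds up to a bound for the L2 distances, in
which the variation of w' does not occur. *)
Lemma step_approximation k (V : set 'rV[R]_k) D w w' (e : R) :
  segment_closed V -> (forall v, V v -> `|v| <= D) ->
  L2BV V w -> piecewise_constant tau w -> L2BV V w' -> 0 < e ->
  exists w'', [/\ L2BV V w'', piecewise_constant tau w'',
    forall i, (i < T)%N ->
      `|vint tau`_i tau`_i.+1 w' - (tau`_i.+1 - tau`_i) *: w'' tau`_i| <=
      (tau`_i.+1 - tau`_i) * e &
    norm_L2 (w'' - w) <= norm_L2 (w' - w) + e].
Proof.
move=> sV VD Lw pw Lw' e0.
have bw := L2BV_vbm VD Lw; have bw' := L2BV_vbm VD Lw'.
have [_ _ Vw] := Lw; have [_ _ Vw'] := Lw'.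
have o01 : 0 <= (0 : R) <= 1 by rewrite lexx ler01.
have D0 : 0 <= D by exact: le_trans (VD _ (Vw _ o01)).
have KD0 : 0 <= 4 * k%:R * D by rewrite !mulr_ge0.
have KD1 : 0 < 1 + 4 * k%:R * D by rewrite ltr_pwDl.
(* so that the error 4 k D e1 of [near_mean_sqr] is at most e^2 *)
pose e1 := Num.min e (e ^+ 2 / (1 + 4 * k%:R * D)).
have e10 : 0 < e1 by rewrite lt_min e0/= divr_gt0// exprn_gt0.
have e1e : e1 <= e by rewrite /e1 ge_min lexx.
have e1e2 : 4 * k%:R * D * e1 <= e ^+ 2.
  have : e1 * (1 + 4 * k%:R * D) <= e ^+ 2 by rewrite -ler_pdivlMr// /e1 ge_min lexx orbT.
  have := ltW e10; lra.
have /choice[P hP] : forall i, exists p, V p /\ ((i < T)%N -> tau`_i < tau`_i.+1 ->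
    `|vint tau`_i tau`_i.+1 w' - (tau`_i.+1 - tau`_i) *: p| <= (tau`_i.+1 - tau`_i) * e1).
  move=> i; have [[iT tt]|H] := pselect ((i < T)%N /\ tau`_i < tau`_i.+1); last first.
    by exists (w 0); split=> [|iT tt]; [exact: Vw|case: H].
  have /andP[a0 _] := grid_in01 gtau (ltnW iT); have /andP[_ b1] := grid_in01 gtau iT.
  by have [p Vp hp] := near_mean sV VD bw' Vw' a0 tt b1 e10; exists p.
have VP i : V (P i) by case: (hP i).
pose w'' := step P.
have L'' : L2BV V w'' by exact: (step_L2BV VD VP).
have p'' : piecewise_constant tau w'' by exact: step_piecewise_constant.
have bw'' := L2BV_vbm VD L''.
have stepi i s : (i < T)%N -> tau`_i <= s < tau`_i.+1 -> w'' s = P i.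
  by move=> iT hs; rewrite /w'' /step (cell_indexE iT hs).
exists w''; split=> //.
  move=> i iT; have := grid_step gtau iT; rewrite le_eqVlt => /predU1P[<-|tt].
    by rewrite vintxx subrr scale0r subr0 normr0 mul0r.
  rewrite (stepi i)//; last by rewrite lexx.
  rewrite (le_trans ((hP i).2 iT tt))// ler_wpM2l// subr_ge0; exact: ltW.
have bdiff (v v' : R -> 'rV[R]_k) : vbm v -> vbm v' -> vbm (v - v').
  move=> [mv [Dv hv]] [mv' [Dv' hv']]; split.
    move=> i; rewrite (_ : (fun s => _) = (fun s => v s 0 i) \- (fun s => v' s 0 i)).
      exact: measurable_funB.
    by apply/funext => s; rewrite /= !mxE.
  exists (Dv + Dv') => t t01; rewrite (le_trans (ler_normB _ _))// lerD//.
    exact: hv.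
  exact: hv'.
have i2 := vbm_sqr_norm2_integrable (bdiff _ _ bw'' bw).
have i1 := vbm_sqr_norm2_integrable (bdiff _ _ bw' bw).
have cells i : (i <= T)%N ->
    \int[mu]_(s in `[0, tau`_i]) (norm2 ((w'' - w) s) ^+ 2) <=
    \int[mu]_(s in `[0, tau`_i]) (norm2 ((w' - w) s) ^+ 2) + tau`_i * (4 * k%:R * D * e1).
  elim: i => [|i IH] iT.
    by case: (gtau) => -> _ _ _; rewrite set_itv1 !Rintegral_set1 mul0r addr0.
  have := grid_step gtau iT; rewrite le_eqVlt => /predU1P[<-|tt]; first exact: IH (ltnW iT).
  have /andP[a0 a1] := grid_in01 gtau (ltnW iT); have /andP[b0 b1] := grid_in01 gtau iT.
  rewrite (Rintegral_chasles a0 (ltW tt) b1 i2) (Rintegral_chasles a0 (ltW tt) b1 i1).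
  have hi : tau`_i <= tau`_i < tau`_i.+1 by rewrite lexx.
  pose c := w tau`_i.
  have wc s : tau`_i <= s < tau`_i.+1 -> w s = c.
    by move=> hs; exact: (pw.1 i iT s _ hs hi).
  have e2 : \int[mu]_(s in `[tau`_i, tau`_i.+1]) (norm2 ((w'' - w) s) ^+ 2) =
      (tau`_i.+1 - tau`_i) * norm2 (P i - c) ^+ 2.
    apply: etrans (Rintegral_itv_cst _ (ltW tt)).
    apply: Rintegral_eq_co => //; first exact: integrable01_cst.
    by move=> s hs; rewrite -(wc s hs) -(stepi i s iT hs).
  have e3 : \int[mu]_(s in `[tau`_i, tau`_i.+1]) (norm2 ((w' - w) s) ^+ 2) =
      \int[mu]_(s in `[tau`_i, tau`_i.+1]) (norm2 (w' s - c) ^+ 2).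
    apply: Rintegral_eq_co => //.
      by apply: vbm_sqr_norm2_integrable; apply: vbmD => //; exact: vbm_cst.
    by move=> s hs; rewrite -(wc s hs).
  have cD : `|c| <= D by apply/VD/Vw; rewrite a0 a1.
  have c2 := near_mean_sqr bw' a0 (ltW tt) b1 (VD _ (VP i)) cD (ltW e10) ((hP i).2 iT tt).
  apply: add_cell; first exact: IH (ltnW iT).
  exact: (eq_ind_r (fun u => u <= _) (eq_ind_r (fun u => _ <= u + _) c2 e3) e2).
have T1 : tau`_T = 1 by case: gtau.
have := cells T (leqnn _); rewrite T1 mul1r => total.
rewrite /norm_L2.
set X := \int[_]_(_ in _) _ in total *; set Y := \int[_]_(_ in _) _ in total *.
have Y0 : 0 <= Y by apply: Rintegral_ge0 => s _; exact: sqr_ge0.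
have XY : X <= (Num.sqrt Y + e) ^+ 2.
  rewrite (le_trans total)// sqrrD sqr_sqrtr//.
  have : 0 <= Num.sqrt Y * e by rewrite mulr_ge0 ?sqrtr_ge0// ltW.
  rewrite mulr2n; lra.
have h0 : 0 <= Num.sqrt Y + e by rewrite addr_ge0 ?sqrtr_ge0// ltW.
by rewrite -[leRHS](ger0_norm h0) -sqrtr_sqr ler_wsqrtr.
Qed.

End StepFunctions.

(** * Consistency *)

Section Comparison.
Variable R : realType.

Lemma simplex_p_r q : @simplex_p R q `<=` @simplex_r R q.
Proof.
move=> _ [i ->]; split=> [j|].
  by rewrite mxE eqxx/=; case: (j == i); rewrite /= ?lexx ler01.
rewrite (bigD1 i)//= mxE !eqxx/= big1 ?addr0// => j ji.
by rewrite mxE eqxx/= (negbTE ji).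
Qed.

Lemma simplex_r_bounded q (d : 'rV[R]_q) : simplex_r d -> `|d| <= 1.
Proof.
move=> [d01 _]; apply: rV_normP => // i; have /andP[a0 a1] := d01 i.
by rewrite ger0_norm.
Qed.

Lemma vint_row_mx p q (a b : R) (u : R -> 'rV[R]_p) (v : R -> 'rV[R]_q) :
  vint a b (fun s => row_mx (u s) (v s)) = row_mx (vint a b u) (vint a b v).
Proof.
apply/rowP => i; rewrite [LHS]mxE; case: (split_ordP i) => j ->.
  by rewrite row_mxEl mxE; apply: eq_Rintegral => s _; rewrite row_mxEl.
by rewrite row_mxEr mxE; apply: eq_Rintegral => s _; rewrite row_mxEr.
Qed.

Lemma vint_eq_co k (a b : R) (w : R -> 'rV[R]_k) (v : 'rV[R]_k) :
  0 <= a -> a <= b -> b <= 1 -> vintegrable w ->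
  (forall s, a <= s < b -> w s = v) -> vint a b w = (b - a) *: v.
Proof.
move=> a0 ab b1 iw wv; rewrite -vint_cst//; apply/rowP => i; rewrite !mxE.
apply: Rintegral_eq_co => //; first exact: integrable01_cst.
by move=> s /wv ->.
Qed.

Lemma norm_L2_ge0 k (w : R -> 'rV[R]_k) : 0 <= norm_L2 w.
Proof. exact: sqrtr_ge0. Qed.

Lemma norm_X_ge0 m q (xi : control R m q) : 0 <= norm_X xi.
Proof. by rewrite addr_ge0// norm_L2_ge0. Qed.

Variables (n m q : nat) (U : set 'rV[R]_m).
Variables (f : 'I_q -> R -> 'rV[R]_n -> 'rV[R]_m -> 'rV[R]_n) (K : R).
Hypothesis S : control_system (control_values (q := q) U)
  (merged_field f) (merged_dx f) (merged_dc f) K.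
Hypotheses (U_convex : convex_set U) (U_bounded : bounded_set U).

Section Projection.
Variables (tau : seq R) (N : nat).
Hypothesis gtau : grid N tau.
Notation T := (size tau).-1.

Lemma ctl_vintegrable (xi : control R m q) : X_r U xi -> vintegrable (ctl xi).
Proof. by move=> /admissible_ctl/(admissible_vbm S)/vbm_integrable. Qed.

Lemma cell_average_direction (xi xi' xi'' : control R m q) e : X_tau_r U tau xi -> X_r U xi' ->
  forall i, (i < T)%N ->
  `|vint tau`_i tau`_i.+1 (ctl xi') - (tau`_i.+1 - tau`_i) *: ctl xi'' tau`_i| <= e ->
  `|vint tau`_i tau`_i.+1 (direction xi xi') -
    (tau`_i.+1 - tau`_i) *: direction xi xi'' tau`_i| <= e.
Proof.
move=> [hx pu pd] hx' i iT; congr (`|_| <= _).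
have /andP[a0 _] := grid_in01 gtau (ltnW iT); have /andP[_ b1] := grid_in01 gtau iT.
have ab := grid_step gtau iT.
have -> : vint tau`_i tau`_i.+1 (direction xi xi') =
    vint tau`_i tau`_i.+1 (ctl xi') - vint tau`_i tau`_i.+1 (ctl xi).
  by rewrite -vintB//; exact: ctl_vintegrable.
rewrite (@vint_eq_co _ _ _ (ctl xi) (ctl xi tau`_i))//.
- by rewrite /direction scalerBr opprB addrA subrK.
- exact: ctl_vintegrable.
move=> s hs; have hi : tau`_i <= tau`_i < tau`_i.+1.
  by rewrite lexx; case/andP: hs => h1 h2; exact: le_lt_trans h1 h2.
by rewrite /ctl (pu.1 i iT s _ hs hi) (pd.1 i iT s _ hs hi).
Qed.

Lemma cell_average_self (xi xi' : control R m q) : X_tau_r U tau xi -> X_tau_r U tau xi' ->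
  forall i, (i < T)%N ->
  `|vint tau`_i tau`_i.+1 (direction xi xi') -
    (tau`_i.+1 - tau`_i) *: direction xi xi' tau`_i| <= (tau`_i.+1 - tau`_i) * 0.
Proof.
move=> hx [hx' pu pd] i iT; apply: cell_average_direction => //.
have /andP[a0 _] := grid_in01 gtau (ltnW iT); have /andP[_ b1] := grid_in01 gtau iT.
have ab := grid_step gtau iT.
rewrite (@vint_eq_co _ _ _ (ctl xi') (ctl xi' tau`_i))//.
- by rewrite subrr normr0 mulr0.
- exact: ctl_vintegrable.
move=> s hs; have hi : tau`_i <= tau`_i < tau`_i.+1.
  by rewrite lexx; case/andP: hs => h1 h2; exact: le_lt_trans h1 h2.
by rewrite /ctl (pu.1 i iT s _ hs hi) (pd.1 i iT s _ hs hi).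
Qed.

(** U and the simplex are treated separately, so that the merged control stays
admissible. *)
Lemma grid_projection (xi xi' : control R m q) e : X_tau_r U tau xi -> X_r U xi' -> 0 < e ->
  exists2 xi'', X_tau_r U tau xi'' &
    (forall i, (i < T)%N ->
      `|vint tau`_i tau`_i.+1 (direction xi xi') -
        (tau`_i.+1 - tau`_i) *: direction xi xi'' tau`_i| <= (tau`_i.+1 - tau`_i) * e) /\
    norm_X (xi'' - xi) <= norm_X (xi' - xi) + 2 * e.
Proof.
move=> hx hx' e0; have [[hu hd] pu pd] := hx; have [hu' hd'] := hx'.
have [D D0 UD] := bounded_values U_bounded.
have [u'' [Lu'' pu'' avu nu]] := step_approximation gtau
  (convex_segment_closed U_convex) UD hu pu hu' e0.
have [d'' [Ld'' pd'' avd nd]] := step_approximation gtau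
  (@simplex_segment_closed R q) (@simplex_r_bounded q) hd pd hd' e0.
exists (u'', d''); first by split.
split.
  move=> i iT; apply: cell_average_direction => //.
  have d0 : 0 <= (tau`_i.+1 - tau`_i) * e.
    by apply: mulr_ge0; [rewrite subr_ge0 (grid_step gtau)|exact: ltW].
  rewrite /ctl vint_row_mx scale_row_mx opp_row_mx add_row_mx.
  by apply: norm_row_mx_le => //; [exact: avu|exact: avd].
by rewrite (le_trans (lerD nu nd))// addrACA -mulr2n mulr_natl.
Qed.

End Projection.

Variables (Nc : nat) (x0 : 'rV[R]_n) (h0 : 'rV[R]_n -> R) (h : 'I_Nc -> 'rV[R]_n -> R).
Variable H : R.
Hypothesis Nc_gt0 : (0 < Nc)%N.
Hypotheses (H_ge0 : 0 <= H) (ch0 : cost_bound h0 H) (ch : forall j, cost_bound (h j) H).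
Variable gamma : R.
Hypothesis gamma_gt0 : 0 < gamma.

(** A control on the grid competes in both problems, and a relaxed control competes on the
grid through its projection; in either case the two values of zeta differ by at most a
multiple of the mesh, plus an arbitrarily small e for the projection. *)
Lemma theta_close : exists2 C : R, 0 <= C &
  forall N tau (xi : control R m q), grid N tau -> X_tau_p U tau xi ->
  `|theta_tau f x0 U h0 h gamma tau xi - theta f x0 U h0 h gamma xi| <= C * 2 ^- N.
Proof.
have [C C0 hC] := zeta_close S U_convex x0 Nc_gt0 H_ge0 ch0 ch gamma_gt0.
exists C => // N tau xi gtau [[hu hd] pu pd].
have hx : X_r U xi.
  split=> //; have [? ? hs] := hd; split=> // t t01; exact/simplex_p_r/hs.
have hxt : X_tau_r U tau xi by split.
pose A := [set zeta f x0 h0 h gamma xi xi' | xi' in X_r U].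
pose B := [set zeta_tau f x0 h0 h gamma tau xi xi' | xi' in X_tau_r U tau].
have A0 : A !=set0 by exists (zeta f x0 h0 h gamma xi xi), xi.
have B0 : B !=set0 by exists (zeta_tau f x0 h0 h gamma tau xi xi), xi.
have low (z c : R) (d : control R m q) : `|z - norm_X d| <= c -> - c <= z.
  rewrite ler_norml => /andP[h1 _]; apply: le_trans h1 _.
  by rewrite gerDl oppr_le0 norm_X_ge0.
have lA : has_lbound A.
  exists (- C) => _ [xi' hx' <-].
  have [xi'' [hx'' _ _] [av _]] := grid_projection gtau hxt hx' ltr01.
  have [b1 _ _] := hC N tau xi xi' xi'' 1 gtau hxt hx' hx'' ler01 av.
  exact: low b1.
have lB : has_lbound B.
  exists (- C) => _ [xi' hxt' <-]; have [hx' _ _] := hxt'.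
  have [_ b2 _] := hC N tau xi xi' xi' 0 gtau hxt hx' hx' (lexx 0)
    (cell_average_self gtau hxt hxt').
  exact: low b2.
have h1 : theta f x0 U h0 h gamma xi - C * 2 ^- N <= theta_tau f x0 U h0 h gamma tau xi.
  apply: lb_le_inf => // _ [xi' hxt' <-]; have [hx' _ _] := hxt'.
  have [_ _] := hC N tau xi xi' xi' 0 gtau hxt hx' hx' (lexx 0)
    (cell_average_self gtau hxt hxt').
  have : theta f x0 U h0 h gamma xi <= zeta f x0 h0 h gamma xi xi'.
    by apply: ge_inf => //; exists xi'.
  rewrite addr0 ler_norml.
  move: (theta _ _ _ _ _ _ _) (zeta _ _ _ _ _ _ _) (zeta_tau _ _ _ _ _ _ _ _) (norm_X _).
  by move=> a b c d ab /andP[_ h2]; lra.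
have h2 : theta_tau f x0 U h0 h gamma tau xi - C * 2 ^- N <= theta f x0 U h0 h gamma xi.
  apply: lb_le_inf => // _ [xi' hx' <-].
  apply/ler_addgt0Pr => e e0.
  have C20 : 0 < C + 2 by rewrite ltr_wpDl.
  (* C for the cell averages, and 1 for each of the norms of u and of d *)
  have e20 : 0 < e / (C + 2) by rewrite divr_gt0.
  have [xi'' hxt'' [av nX]] := grid_projection gtau hxt hx' e20.
  have [hx'' _ _] := hxt''.
  have [_ _] := hC N tau xi xi' xi'' _ gtau hxt hx' hx'' (ltW e20) av.
  have : theta_tau f x0 U h0 h gamma tau xi <= zeta_tau f x0 h0 h gamma tau xi xi''.
    by apply: ge_inf => //; exists xi''.
  have eE : C * (e / (C + 2)) + 2 * (e / (C + 2)) = e.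
    by rewrite -mulrDl mulrC divfK// gt_eqF.
  rewrite ler_norml mulrDr.
  move: (e / (C + 2)) (C * 2 ^- N) eE nX.
  move: (theta_tau _ _ _ _ _ _ _ _) (zeta _ _ _ _ _ _ _) (zeta_tau _ _ _ _ _ _ _ _).
  move: (norm_X (xi'' - xi)) (norm_X (xi' - xi)).
  by move=> a b c d g v w vE nX cg /andP[h3 _]; lra.
move: h1 h2; move: (theta_tau _ _ _ _ _ _ _ _) (theta _ _ _ _ _ _ _) (C * 2 ^- N).
by move=> a b c h1 h2; rewrite ler_norml; apply/andP; split; lra.
Qed.

End Comparison.

Theorem theorem13 (R : realType) (n m q Nc : nat)
    (hn : (0 < n)%N) (hm : (0 < m)%N) (hq : (0 < q)%N) (hNc : (0 < Nc)%N)
    (x0 : 'rV[R]_n) (U : set 'rV[R]_m)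
    (U_bounded : bounded_set U) (U_convex : convex_set U)
    (f : 'I_q -> R -> 'rV[R]_n -> 'rV[R]_m -> 'rV[R]_n)
    (h0 : 'rV[R]_n -> R) (h : 'I_Nc -> 'rV[R]_n -> R)
    (L : R) (L_gt0 : 0 < L)
    (hf : dynamics_hyp U L f)
    (hh0 : cost_hyp L h0) (hh : forall j, cost_hyp L (h j))
    (gamma : R) (gamma_gt0 : 0 < gamma)
    (tau : nat -> seq R) (xi : nat -> control R m q)
    (htau : forall i, grid i (tau i))
    (hxi : forall i, X_tau_p U (tau i) (xi i)) :
  `|theta_tau f x0 U h0 h gamma (tau i) (xi i)
    - theta f x0 U h0 h gamma (xi i)| @[i --> \oo] --> (0 : R).
Proof.
have o01 : 0 <= (0 : R) <= 1 by rewrite lexx ler01.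
have U_neq0 : U !=set0.
  by have [[[_ _ Uu] _] _ _] := hxi 0%N; exists ((xi 0%N).1 0); exact: Uu.
have [K S] := control_system_vfield U_bounded U_convex U_neq0 L_gt0 hf.
have [H0 H0_ge0 ch0] := cost_bound_exists L_gt0 hh0.
have /choice[Hj hHj] : forall j, exists H, 0 <= H /\ cost_bound (h j) H.
  by move=> j; have [H ? ?] := cost_bound_exists L_gt0 (hh j); exists H.
pose H := H0 + \sum_j Hj j.
have H_ge0 : 0 <= H by rewrite addr_ge0// sumr_ge0// => j _; case: (hHj j).
have c0 : cost_bound h0 H.
  by apply: cost_bound_le ch0; rewrite lerDl sumr_ge0// => j _; case: (hHj j).
have cj j : cost_bound (h j) H.
  apply: cost_bound_le (hHj j).2; rewrite /H (bigD1 j)//= addrCA lerDl addr_ge0//.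
  by rewrite sumr_ge0// => i _; case: (hHj i).
have [C C_ge0 hC] := theta_close S U_convex U_bounded x0 hNc H_ge0 c0 cj gamma_gt0.
apply/cvgrPdist_le => e e0.
have eC : 0 < e / (C + 1) by rewrite divr_gt0// ltr_wpDl.
near=> i.
rewrite sub0r normrN normr_id (le_trans (hC i _ _ (htau i) (hxi i)))//.
have : 1 / 2 ^+ i < e / (C + 1).
  by near: i; exact: near_infty_natSinv_expn_lt (PosNum eC).
rewrite ltr_pdivlMr ?ltr_wpDl// mul1r => /ltW; apply: le_trans.
by rewrite mulrC ler_wpM2l ?invr_ge0 ?exprn_ge0// lerDl.
Unshelve. all: by end_near. Qed.
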